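(* Let $M_p$ be a weight sequence satisfying $(M.1)$, $(M.2)$, and $(M.3)$, and let $A_p$ be a weight sequence satisfying $(M.1)$ and $(M.2)$. Then $\mathcal{O}_C'^{\{M_p\},\{A_p\}}(\mathbb{R}^d)$ is not ultrabornological; in particular, the strong topology on $\mathcal{O}_C'^{\{M_p\},\{A_p\}}(\mathbb{R}^d)$ is strictly finer than the initial topology with respect to the mapping $$\mathcal{O}_C'^{\{M_p\},\{A_p\}}(\mathbb{R}^d)\to L_b(\mathcal{S}^{\{M_p\}}_{\{A_p\}}(\mathbb{R}^d),\mathcal{S}^{\{M_p\}}_{\{A_p\}}(\mathbb{R}^d)),\quad f\mapsto \ast_{f}.$$
   Context: Weight sequences. For a sequence $(M_p)_{p\in\mathbb{N}}$ of positive reals ($\mathbb N=\{0,1,2,\dots\}$) put $m_p := M_p/M_{p-1}$, $p\ge 1$. It is a weight sequence if $m_p\to\infty$. Write $M_\alpha=M_{|\alpha|}$ for $\alpha\in\mathbb{N}^d$. $(M.1)$: $M_p^2\le M_{p-1}M_{p+1}$, $p\ge1$. $(M.2)$: $M_{p+q}\le C_0H^{p+q}M_pM_q$ for all $p,q$, for some $C_0,H\ge1$. $(M.3)$: $\sum_{p=q}^\infty 1/m_p<Cq/m_q$ for all $q\ge1$, for some $C\ge1$. The associated function of $A_p$ is $A(t)=\sup_{p}\log(t^pA_0/A_p)$ for $t>0$, $A(0)=0$, and $A(x)=A(|x|)$ for $x\in\mathbb{R}^d$. Spaces. For $h>0$ and a positive continuous function $w$ on $\mathbb{R}^d$, $\mathcal{B}^{M_p,h}_w(\mathbb{R}^d)$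 is the Banach space of $\varphi\in C^\infty(\mathbb{R}^d)$ with $\sup_{\alpha\in\mathbb{N}^d}\sup_{x\in\mathbb R^d}h^{|\alpha|}|\varphi^{(\alpha)}(x)|w(x)/M_\alpha<\infty$. The Gelfand-Shilov space of Roumieu type is $\mathcal{S}^{\{M_p\}}_{\{A_p\}}(\mathbb{R}^d)=\varinjlim_{h\to0^+}\mathcal{B}^{M_p,h}_{e^{A(h\cdot)}}(\mathbb{R}^d)$. Further, $$\mathcal{O}_C^{\{M_p\},\{A_p\}}(\mathbb{R}^d):=\varinjlim_{h\to0^+}E_h,\qquad E_h:=\varprojlim_{N\ge1}\mathcal{B}^{M_p,h}_{e^{-A(\cdot/N)}}(\mathbb{R}^d),$$ an $(LF)$-space. Topology on the dual. $\mathcal{O}_C'^{\{M_p\},\{A_p\}}(\mathbb{R}^d)$ is the topological dual of $\mathcal{O}_C^{\{M_p\},\{A_p\}}(\mathbb{R}^d)$. Unless another topology is specified, it is endowed with the topology of uniform convergence on those subsets contained and bounded in $E_h$ for some $h>0$; this topology coincides with the initial topology with respect to the mapping $f\mapsto\ast_f$ displayed in the claim. Here $\ast_f(\varphi)=f\ast\varphi$ with $(f\ast\varphi)(x)=\langle f,\varphi(x-\cdot)\rangle$ for $\varphi\in\mathcal{S}^{\{M_p\}}_{\{A_p\}}(\mathbb{R}^d)$, and $L_b(E,F)$ is the space of continuous linear maps with the topology of uniform convergence on bounded subsets of $E$. The strong topology is that of uniform convergence on all bounded subsets of $\mathcal{O}_C^{\{M_p\},\{A_p\}}(\mathbb{R}^d)$.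 *)

(* Defs.v *)
From HB Require Import structures.
From mathcomp Require Import all_boot all_order all_algebra.
From mathcomp Require Import all_classical all_reals all_analysis.
From mathcomp Require Import complex.

Set Implicit Arguments.
Unset Strict Implicit.
Unset Printing Implicit Defensive.

Import Order.TTheory GRing.Theory Num.Theory.
Import numFieldNormedType.Exports.

Local Open Scope classical_set_scope.
Local Open Scope ring_scope.

Notation cabs := (@ComplexField.Normc.normc _).

Section Cabs.
Variable R : realType.
Implicit Types a b : R[i].

Lemma cabs_ge0 a : 0 <= cabs a.
Proof. by case: a => x y; rewrite sqrtr_ge0. Qed.

Lemma cabsE a : `|a| = (cabs a)%:C%C.
Proof. by case: a. Qed.

Lemma cabsR (t : R) : cabs t%:C%C = `|t|.
Proof. by rewrite /ComplexField.Normc.normc /= expr0n addr0 sqrtr_sqr. Qed.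

End Cabs.

Section Seminorms.
Variables (R : realType) (V : lmodType R[i]).

Definition seminorm (q : V -> R) :=
  (forall x y, q (x + y) <= q x + q y) /\
  (forall (a : R[i]) x, q (a *: x) = cabs a * q x).

Lemma seminorm0 q : seminorm q -> q 0 = 0.
Proof. by move=> [_ qZ]; rewrite -(scale0r 0) qZ ComplexField.Normc.normc0 mul0r. Qed.

Lemma seminormN q x : seminorm q -> q (- x) = q x.
Proof.
move=> [_ qZ]; rewrite -scaleN1r qZ normcN ComplexField.Normc.normc1 mul1r //.
Qed.

Lemma seminorm_ge0 q x : seminorm q -> 0 <= q x.
Proof.
move=> qs; have := qs.1 x (- x).
by rewrite subrr seminorm0// seminormN// -mulr2n pmulrn_lge0.
Qed.

Record seminorm_family := SeminormFamily {
  seminorms :> set (V -> R) ;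
  seminormsP : forall q, seminorms q -> seminorm q }.

End Seminorms.

(* V with the locally convex topology generated by the seminorms in Q *)
Definition lcs (R : realType) (V : lmodType R[i]) (Q : seminorm_family V) : Type
  := V.

Section Lcs.
Variables (R : realType) (V : lmodType R[i]) (Q : seminorm_family V).

HB.instance Definition _ := GRing.Lmodule.on (lcs Q).

Definition lcs_ball (s : seq (V -> R)) (e : R) (x : lcs Q) : set (lcs Q) :=
  [set y | forall q, q \in s -> q (y - x : V) < e].

Definition lcs_nbhs (x : lcs Q) : set_system (lcs Q) :=
  [set U | exists s e, [/\ (forall q, q \in s -> seminorms Q q), 0 < e & lcs_ball s e x `<=` U]].

HB.instance Definition _ := hasNbhs.Build (lcs Q) lcs_nbhs.

Lemma lcs_ballxx s e x : (forall q, q \in s -> seminorms Q q) -> 0 < e ->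
  lcs_ball s e x x.
Proof.
move=> sQ e0 q qs; rewrite subrr seminorm0//; exact: (seminormsP (sQ _ qs)).
Qed.

Lemma lcs_nbhs_ball s e x : (forall q, q \in s -> seminorms Q q) -> 0 < e ->
  nbhs (x : lcs Q) (lcs_ball s e x).
Proof. by move=> sQ e0; exists s, e; split. Qed.

Lemma lcs_nbhs_filter (x : lcs Q) : ProperFilter (nbhs x).
Proof.
split.
  by move=> [s [e [sQ e0 sU]]]; exact: (sU x (lcs_ballxx x sQ e0)).
split.
- by exists [::], 1.
- move=> A B [s [e [sQ e0 sA]]] [t [f [tQ f0 tB]]].
  exists (s ++ t), (Num.min e f); split.
  + by move=> q; rewrite mem_cat => /orP[/sQ|/tQ].
  + by rewrite lt_min e0.
  + move=> y xy; split.
      apply: sA => q qs; apply: (lt_le_trans (xy q _)).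
        by rewrite mem_cat qs.
      by rewrite ge_min lexx.
    apply: tB => q qs; apply: (lt_le_trans (xy q _)).
      by rewrite mem_cat qs orbT.
    by rewrite ge_min lexx orbT.
- by move=> A B AB [s [e [sQ e0 sA]]]; exists s, e; split=> // y /sA/AB.
Qed.

Lemma lcs_nbhs_singleton (x : lcs Q) (U : set (lcs Q)) : nbhs x U -> U x.
Proof. by move=> [s [e [sQ e0 sU]]]; exact: (sU x (lcs_ballxx x sQ e0)). Qed.

Lemma lcs_ball_margin (s : seq (V -> R)) (e : R) (x : V) :
  {in s, forall q : V -> R, q x < e} -> 0 < e ->
  exists2 d : R, 0 < d & {in s, forall q : V -> R, q x + d <= e}.
Proof.
elim: s => [|p s ih] xs e0; first by exists e.
have [d d0 dP] : exists2 d : R, 0 < d & {in s, forall q : V -> R, q x + d <= e}.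
  by apply: ih => // q qs; apply: xs; rewrite in_cons qs orbT.
have px : p x < e by apply: xs; rewrite mem_head.
exists (Num.min d (e - p x)); first by rewrite lt_min d0 subr_gt0.
move=> q; rewrite in_cons => /orP[/eqP->|qs].
  by rewrite -lerBrDl ge_min lexx orbT.
by apply: le_trans (dP q qs); rewrite lerD2l ge_min lexx.
Qed.

Lemma lcs_ball_nbhs s e x y : (forall q, q \in s -> seminorms Q q) -> 0 < e ->
  lcs_ball s e x y -> nbhs (y : lcs Q) (lcs_ball s e x).
Proof.
move=> sQ e0 xy; have [d d0 dP] := lcs_ball_margin xy e0.
exists s, d; split=> // z yz q qs.
apply: lt_le_trans (dP q qs).
rewrite (_ : z - x = (z - y) + (y - x)); last by rewrite addrA subrK.
apply: le_lt_trans ((seminormsP (sQ _ qs)).1 _ _) _.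
by rewrite addrC ltrD2l; exact: yz.
Qed.

Lemma lcs_nbhs_nbhs (x : lcs Q) (U : set (lcs Q)) :
  nbhs x U -> nbhs x (nbhs^~ U).
Proof.
move=> [s [e [sQ e0 sU]]]; exists s, e; split=> // y xy.
by apply: filterS sU _; [exact: lcs_nbhs_filter|exact: lcs_ball_nbhs].
Qed.

HB.instance Definition _ := Nbhs_isNbhsTopological.Build (lcs Q)
  lcs_nbhs_filter lcs_nbhs_singleton lcs_nbhs_nbhs.

Lemma lcs_add_continuous : continuous (fun x : lcs Q * lcs Q => x.1 + x.2).
Proof.
move=> [x y] U [s [e [sQ e0 sU]]].
have e2 : 0 < e / 2 by rewrite divr_gt0.
exists (lcs_ball s (e / 2) x, lcs_ball s (e / 2) y).
  by split; exact: lcs_nbhs_ball.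
move=> [x' y'] [/= xx' yy']; apply: sU => q qs /=.
rewrite (_ : x' + y' - (x + y) = (x' - x) + (y' - y)); last first.
  by rewrite opprD addrACA.
apply: le_lt_trans ((seminormsP (sQ _ qs)).1 _ _) _.
by rewrite (splitr e) ltrD//; [exact: xx'|exact: yy'].
Qed.

Lemma lcs_scale_continuous :
  continuous (fun z : R[i]^o * lcs Q => z.1 *: z.2).
Proof.
move=> [a x] U [s [e [sQ e0 sU]]].
pose M : R := \sum_(q <- s) q (x : V).
have M0 : 0 <= M.
  rewrite /M big_seq; apply: sumr_ge0 => q qs.
  by apply: seminorm_ge0; exact: (seminormsP (sQ _ qs)).
have qM q : q \in s -> q (x : V) <= M.
  move=> qs; rewrite /M (perm_big _ (perm_to_rem qs)) big_cons lerDl.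
  rewrite big_seq; apply: sumr_ge0 => p /mem_rem ps.
  by apply: seminorm_ge0; exact: (seminormsP (sQ _ ps)).
pose d : R := Num.min 1 (e / 2 / (M + 1)).
have M1 : 0 < M + 1 by rewrite ltr_wpDl.
have d0 : 0 < d by rewrite lt_min ltr01 !divr_gt0.
pose c : R := cabs a + 1.
have c0 : 0 < c by rewrite /c ltr_wpDl// cabs_ge0.
exists (ball (a : R[i]^o) (d%:C%C), lcs_ball s (e / 2 / c) x).
  split; last by apply: lcs_nbhs_ball => //; rewrite !divr_gt0.
  by apply: nbhsx_ballx; rewrite ltcR.
move=> [b y] [/= ab xy]; apply: sU => q qs /=.
have qP := seminormsP (sQ _ qs).
have bad : cabs (b - a) < d.
  by move: ab; rewrite -ball_normE /= distrC cabsE ltcR.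
have bc : cabs b <= c.
  rewrite -(subrK a b) (le_trans (le_normcD _ _))// addrC lerD2l.
  by apply/ltW/(lt_le_trans bad); rewrite ge_min lexx.
rewrite (_ : b *: y - a *: x = b *: (y - x) + (b - a) *: (x : V)); last first.
  by rewrite scalerBr scalerBl addrA subrK.
apply: le_lt_trans (qP.1 _ _) _; rewrite !qP.2 (splitr e) ltr_leD//.
  apply: (@le_lt_trans _ _ (c * q (y - x : V))).
    by rewrite ler_wpM2r// seminorm_ge0.
  by rewrite mulrC -ltr_pdivlMr//; exact: xy.
apply: (@le_trans _ _ (d * (M + 1))).
  apply: ler_pM; [exact: cabs_ge0|exact: seminorm_ge0|exact: ltW|].
  by rewrite (le_trans (qM _ qs))// lerDl.
by rewrite -ler_pdivlMr// ge_min lexx orbT.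
Qed.

Lemma lcs_locally_convex :
  exists2 B : set_system (lcs Q), (forall b, b \in B -> convex_set b) & basis B.
Proof.
exists [set U | exists s e x, [/\ (forall q, q \in s -> seminorms Q q), 0 < e &
                                   U = lcs_ball s e x]].
  move=> U /[!inE] -[s [e [x [sQ e0 ->]]]] y z t /[!inE] xy xz.
  move=> q qs; have qP := seminormsP (sQ _ qs).
  set a : R[i] := t%:num; set b : R[i] := 1 - t%:num.
  have ab : cabs a + cabs b = 1.
    have a0 : 0 <= a by rewrite /a ge0.
    have b0 : 0 <= b by rewrite /b subr_ge0 le1.
    apply: (@complexI R); rewrite rmorphD /= -!cabsE (ger0_norm a0).
    rewrite (ger0_norm b0).
    by rewrite addrC subrK.
  change (q (a *: (y : V) + b *: (z : V) - (x : V)) < e).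
  rewrite (_ : _ - _ = a *: (y - x : V) + b *: (z - x : V)); last first.
    by rewrite !scalerBr addrACA -opprD -scalerDl (addrC a) /b subrK scale1r.
  apply: le_lt_trans (qP.1 _ _) _; rewrite !qP.2.
  pose m := Num.max (q (y - x : V)) (q (z - x : V)).
  apply: (@le_lt_trans _ _ m); last by rewrite gt_max xy// xz.
  rewrite -[leRHS]mul1r -ab mulrDl.
  by rewrite lerD// ler_wpM2l ?cabs_ge0// le_max lexx ?orbT.
split.
  move=> U [s [e [x [sQ e0 ->]]]]; rewrite openE => y.
  exact: lcs_ball_nbhs.
move=> x U [s [e [sQ e0 sU]]]; exists (lcs_ball s e x) => //; split.
  by exists s, e, x.
exact: lcs_ballxx.
Qed.

HB.instance Definition _ := PreTopologicalLmod_isTvs.Build R[i] (lcs Q)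
  lcs_add_continuous lcs_scale_continuous lcs_locally_convex.
HB.instance Definition _ :=
  PreTopologicalNmodule_isTopologicalNmodule.Build (lcs Q) lcs_add_continuous.
HB.instance Definition _ :=
  TopologicalNmodule_isTopologicalLmodule.Build R[i] (lcs Q)
    lcs_scale_continuous.
HB.instance Definition _ := Uniform_isTvs.Build R[i] (lcs Q) lcs_locally_convex.

End Lcs.

Section Subspaces.
Variables (R : realType) (V : lmodType R[i]).

Record lsubspace := Subspace {
  subspace_set :> set V ;
  subspace0 : subspace_set 0 ;
  subspaceP : forall (a : R[i]) x y,
    subspace_set x -> subspace_set y -> subspace_set (a *: x + y) }.

Definition subspace_pred (W : lsubspace) : {pred V} := [pred x | `[< subspace_set W x >]].

Lemma subspace_pred_closed (W : lsubspace) : submod_closed (subspace_pred W).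
Proof.
split; first by apply/asboolP; exact: subspace0.
by move=> a x y /asboolP Wx /asboolP Wy; apply/asboolP; exact: subspaceP.
Qed.

HB.instance Definition _ W :=
  GRing.isSubmodClosed.Build R[i] V (subspace_pred W) (subspace_pred_closed W).

Record subsp (W : lsubspace) := Subsp {
  subsp_val :> V ;
  subsp_valP : subsp_val \in subspace_pred W }.

HB.instance Definition _ W := [isSub for @subsp_val W].
HB.instance Definition _ W := [Choice of subsp W by <:].
HB.instance Definition _ W := [SubChoice_isSubLmodule of subsp W by <:].

Definition mksub (W : lsubspace) (x : V) (Wx : subspace_set W x) : subsp W :=
  @Subsp W x (asboolT Wx).

Lemma subspW (W : lsubspace) (x : subsp W) : subspace_set W x.
Proof. exact/asboolP/(subsp_valP x). Qed.

Definition incl (W1 W2 : lsubspace) (W12 : W1 `<=` W2) (x : subsp W1) : subsp W2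
  := mksub (W12 _ (subspW x)).

Lemma incl_linear (W1 W2 : lsubspace) (W12 : W1 `<=` W2) : linear (incl W12).
Proof. by move=> a x y; apply: val_inj. Qed.

End Subspaces.

Section SeminormSup.
Variables (R : realType) (V : lmodType R[i]).

Lemma seminorm_sup (I : Type) (D : set I) (f : I -> V -> R) :
  (forall i, D i -> seminorm (f i)) ->
  (forall x, has_ubound [set f i x | i in D]) ->
  seminorm (fun x => sup [set f i x | i in D]).
Proof.
move=> fP fub; have [->|/set0P [i0 Di0]] := eqVneq D set0.
  by split=> [x y|a x]; rewrite !image_set0 sup0 ?addr0 ?mulr0.
have ub x i : D i -> f i x <= sup [set f i x | i in D].
  by move=> Di; apply: ub_le_sup; [exact: fub|exists i].
have leub x c : (forall i, D i -> f i x <= c) -> sup [set f i x | i in D] <= c.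
  move=> fc; apply: ge_sup; first by exists (f i0 x), i0.
  by move=> _ [i Di <-]; exact: fc.
have Zle a x : sup [set f i (a *: x) | i in D]
               <= cabs a * sup [set f i x | i in D].
  apply: leub => i Di; rewrite (fP _ Di).2 ler_wpM2l ?cabs_ge0//; exact: ub.
split=> [x y|a x].
  apply: leub => i Di; apply: le_trans ((fP _ Di).1 _ _) _.
  by apply: lerD; exact: ub.
apply/eqP; rewrite eq_le Zle /=; have [->|a0] := eqVneq a 0.
  rewrite ComplexField.Normc.normc0 mul0r.
  by apply: le_trans (ub _ _ Di0); apply: seminorm_ge0; exact: fP.
have ca0 : 0 < cabs a.
  rewrite lt_neqAle cabs_ge0 andbT eq_sym; apply: contra a0 => /eqP.
  by move/ComplexField.Normc.eq0_normc => ->.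
rewrite -ler_pdivlMl// -ComplexField.Normc.normcV.
by rewrite -{1}[x](scalerK a0) Zle.
Qed.

End SeminormSup.

Section Bounded.
Variable R : realType.

Lemma open_nbhs_lt (x y : R) : x < y -> nbhs x [set t | t < y].
Proof. by move=> xy; apply: open_nbhs_nbhs; split => //; exact: open_lt. Qed.

Definition absorbs (V : lmodType R[i]) (A B : set V) :=
  exists2 r : R, 0 < r &
    forall a : R[i], r <= cabs a -> B `<=` [set a *: x | x in A].

Definition tvs_bounded (E : tvsType R[i]) (B : set E) :=
  forall U : set E, nbhs 0 U -> absorbs U B.

Lemma tvs_bounded_image (E F : tvsType R[i]) (T : E -> F) (B : set E) :
  linear T -> continuous T -> tvs_bounded B -> tvs_bounded (T @` B).
Proof.
move=> Tl Tc Bb U U0.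
have T0 : T 0 = 0 by have := Tl (-1) 0 0; rewrite !scaleN1r !addNr.
have /Bb[r r0 rB] : nbhs 0 (T @^-1` U) by apply: Tc; rewrite T0.
exists r => // a ra _ [x Bx <-]; have [y Uy <-] := rB a ra x Bx.
by exists (T y) => //; rewrite -[a *: y]addr0 Tl T0 addr0.
Qed.

Lemma tvs_bounded_seminorm (E : tvsType R[i]) (B : set E) (q : E -> R) :
  seminorm q -> continuous q -> tvs_bounded B -> has_ubound (q @` B).
Proof.
move=> qs qc Bb.
have /Bb[r r0 rB] : nbhs 0 [set x | q x < 1].
  have := qc 0 [set t | t < 1]; apply; rewrite seminorm0//.
  exact: open_nbhs_lt.
exists r => _ [x Bx <-]; have [|y /= y1 <-] := rB r%:C%C _ x Bx.
  by rewrite cabsR ler_norm.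
by rewrite qs.2 cabsR gtr0_norm// -[leRHS]mulr1 ler_pM2l// ltW.
Qed.

End Bounded.

Section Inductive.
Variables (R : realType) (I : Type) (X : I -> tvsType R[i]).
Variables (V : lmodType R[i]) (j : forall i, X i -> V).

(* generates the finest locally convex topology on V for which all the j i are
   continuous *)
Definition inductive_family : seminorm_family V := {|
  seminorms := [set q | seminorm q /\ forall i, continuous (q \o @j i)] ;
  seminormsP := fun q => @proj1 _ _ |}.

Lemma inductive_continuous i : linear (@j i) ->
  continuous (@j i : X i -> lcs inductive_family).
Proof.
move=> jl x U [s [e [sQ e0 sU]]].
have jB (y z : X i) : j (y - z) = j y - j z.
  by have := jl (-1) z y; rewrite !scaleN1r [y - z]addrC => ->; rewrite addrC.
have j0 : @j i 0 = 0 by rewrite -[X in j X](subrr 0) jB subrr.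
suff : \forall y \near x, forall q, q \in s -> q (j y - j x) < e.
  by apply: filterS => y; exact: sU.
elim: s sQ {sU} => [|q s ih] sQ.
  by apply: nearW => y q; rewrite in_nil.
have sQ' q' : q' \in s -> seminorms inductive_family q'.
  by move=> q's; apply: sQ; rewrite in_cons q's orbT.
have [qs qc] := sQ q (mem_head _ _).
have qx : \forall y \near x, q (j y - j x) < e.
  have sc : (fun y : X i => y - x) @ x --> (0 : X i).
    rewrite -(subrr x).
    apply: (@continuous_comp _ _ _ (fun y => (y, x)) (fun z => z.1 - z.2)).
      by apply: cvg_pair => /=; [exact: cvg_id|exact: cvg_cst].
    exact: sub_continuous.
  have qU : nbhs (0 : X i) [set y | q (j y) < e].
    by apply: (qc i 0 [set t | t < e]); rewrite /= j0 seminorm0//; exact: open_nbhs_lt.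
  by near=> y; rewrite -jB; near: y; exact: (sc _ qU).
have {ih}sx := ih sQ'.
near=> y => p; rewrite in_cons => /orP[/eqP->|ps].
  by near: y.
by move: p ps; near: y.
Unshelve. all: by end_near. Qed.

End Inductive.

Section Hom.
Variables (R : realType) (E F : tvsType R[i]).

Lemma hom0 : linear (0 : E -> F) /\ continuous (0 : E -> F).
Proof.
split; first by move=> a x y /=; rewrite scaler0 addr0.
exact: cst_continuous.
Qed.

Lemma homP (a : R[i]) (S T : E -> F) :
  (linear S /\ continuous S) -> (linear T /\ continuous T) ->
  linear (a *: S + T) /\ continuous (a *: S + T).
Proof.
move=> [Sl Sc] [Tl Tc]; split=> [b x y|x].
  change (a *: S (b *: x + y) + T (b *: x + y) =
    b *: (a *: S x + T x) + (a *: S y + T y)).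
  by rewrite Sl Tl !scalerDr !scalerA mulrC addrACA.
apply: (@continuous_comp _ _ _ (fun x => (a *: S x, T x)) (fun z => z.1 + z.2)).
  apply: cvg_pair => /=; last exact: Tc.
  apply: (@continuous_comp _ _ _ (fun x => ((a : R[i]^o), S x))
    (fun z : R[i]^o * F => z.1 *: z.2)).
    apply: (@cvg_pair _ _ _ _ (nbhs (a : R[i]^o))); last exact: Sc.
    exact: cvg_cst.
  exact: scale_continuous.
exact: add_continuous.
Qed.

Definition hom_subspace : lsubspace (E -> F) := {|
  subspace_set := [set T | linear T /\ continuous T] ;
  subspace0 := hom0 ; subspaceP := homP |}.

Definition hom : Type := subsp hom_subspace.
HB.instance Definition _ := GRing.Lmodule.on hom.

End Hom.

Section UniformConvergence.
Variables (R : realType) (E F : tvsType R[i]).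
Variable (S : set (set E)) (S_bounded : S `<=` @tvs_bounded R E).

Lemma uniform_family_seminorm (p : hom E F -> R) :
  [set p | exists B q, [/\ S B, seminorm q, continuous q &
     p = (fun T : hom E F => sup [set q (subsp_val T x) | x in B])]] p ->
  seminorm p.
Proof.
move=> [B [q [SB qs qc ->]]].
apply: (@seminorm_sup _ (hom E F) _ B (fun x T => q (subsp_val T x))).
  by move=> x Bx; split=> [T1 T2|a T]; [exact: qs.1|exact: qs.2].
move=> T; have [Tl Tc] := subspW T.
apply: (@tvs_bounded_seminorm _ _ _ (q \o subsp_val T)).
- split=> [x y|a x] /=.
    by have := Tl 1 x y; rewrite !scale1r => ->; exact: qs.1.
  have T0 : subsp_val T 0 = 0 by have := Tl (-1) 0 0; rewrite !scaleN1r !addNr.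
  by have := Tl a x 0; rewrite T0 !addr0 => ->; exact: qs.2.
- by move=> x; apply: continuous_comp; [exact: Tc|exact: qc].
- exact: S_bounded.
Qed.

Definition uniform_family : seminorm_family (hom E F) :=
  SeminormFamily uniform_family_seminorm.

(* continuous linear maps with the topology of uniform convergence on the members
   of S *)
Definition hom_unif : Type := lcs uniform_family.
HB.instance Definition _ := Tvs.on hom_unif.

End UniformConvergence.

Section Ultrabornological.
Variables (R : realType) (E : tvsType R[i]).

Definition absolutely_convex (D : set E) :=
  forall (a b : R[i]) x y,
    cabs a + cabs b <= 1 -> D x -> D y -> D (a *: x + b *: y).

(* the linear span of D when D is nonempty and absolutely convex *)
Definition disk_span (D : set E) : set E :=
  [set x | exists2 t : R, 0 < t & exists2 y, D y & x = t%:C%C *: y].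

Definition minkowski_gauge (D : set E) (x : E) : R :=
  inf [set t : R | 0 < t /\ exists2 y, D y & x = t%:C%C *: y].

Definition banach_disk (D : set E) :=
  [/\ D !=set0, absolutely_convex D, tvs_bounded D,
      forall x, disk_span D x -> minkowski_gauge D x = 0 -> x = 0 &
      forall u : nat -> E, (forall n, disk_span D (u n)) ->
        (forall e : R, 0 < e -> exists N, forall m n, (N <= m)%N -> (N <= n)%N ->
           minkowski_gauge D (u m - u n) < e) ->
        exists2 l, disk_span D l &
          forall e : R, 0 < e -> exists N, forall n, (N <= n)%N ->
            minkowski_gauge D (u n - l) < e].

(* equivalently for Hausdorff E: E carries the inductive topology of a family of
   Banach spaces *)
Definition ultrabornological :=
  forall U : set E, absolutely_convex U ->
    (forall D, banach_disk D -> absorbs U D) -> nbhs 0 U.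

End Ultrabornological.

Section WeightSequences.
Variable R : realType.

Record weight_sequence := WeightSequence {
  wseq :> nat -> R ;
  wseq_gt0 : forall p, 0 < wseq p ;
  wseq_lim : (fun p => wseq p.+1 / wseq p) @ \oo --> +oo }.

Variable M : weight_sequence.

Definition wquot (p : nat) : R := M p / M p.-1.

Definition cond_M1 := forall p, (1 <= p)%N -> M p ^+ 2 <= M p.-1 * M p.+1.

Definition cond_M2 := exists C0 H : R, [/\ 1 <= C0, 1 <= H &
  forall p q, M (p + q)%N <= C0 * H ^+ (p + q) * M p * M q].

Definition cond_M3 := exists2 C : R, 1 <= C &
  forall q, (1 <= q)%N ->
    (\sum_(q <= p <oo) (1 / wquot p)%:E < (C * q%:R / wquot q)%:E)%E.

Definition assoc_fun (t : R) : R :=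
  if 0 < t then sup [set ln (t ^+ p * M 0%N / M p) | p in [set: nat]] else 0.

Lemma assoc_ubound t : 0 < t ->
  has_ubound [set ln (t ^+ p * M 0%N / M p) | p in [set: nat]].
Proof.
move=> t0; pose u p := t ^+ p * M 0%N / M p.
have u0 p : 0 < u p by rewrite divr_gt0 ?mulr_gt0 ?exprn_gt0 ?wseq_gt0.
have [P _ PP] : \forall p \near \oo, t <= M p.+1 / M p.
  exact: (cvgryPge _).1 (wseq_lim M) t.
have uS p : (P <= p)%N -> u p.+1 <= u p.
  move=> /PP /= tp; rewrite /u exprS ler_pdivrMr ?wseq_gt0//.
  rewrite [leRHS](_ : _ = t ^+ p * M 0%N * (M p.+1 / M p)); last first.
    by rewrite mulrAC mulrA.
  by rewrite -mulrA mulrC ler_wpM2l// mulr_ge0// ltW// ?exprn_gt0 ?wseq_gt0.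
have uP k : u (P + k)%N <= u P.
  elim: k => [|k ih]; first by rewrite addn0.
  by rewrite addnS (le_trans (uS _ _))// leq_addr.
pose c := \sum_(i < P.+1) u i.
have uc p : u p <= c.
  have le_c j : (j < P.+1)%N -> u j <= c.
    move=> jP; rewrite /c (bigD1 (Ordinal jP))//= lerDl sumr_ge0// => i _.
    exact: ltW.
  have [pP|/ltnW Pp] := leqP p P; first exact: le_c.
  by rewrite -(subnKC Pp) (le_trans (uP _))// le_c.
have c0 : 0 < c := lt_le_trans (u0 0%N) (uc 0%N).
by exists (ln c) => _ [p _ <-]; rewrite ler_ln ?posrE ?uc//; exact: u0.
Qed.

Lemma assoc_ge0 t : 0 <= assoc_fun t.
Proof.
rewrite /assoc_fun; case: ifPn => // t0.
apply: le_trans (ub_le_sup (assoc_ubound t0) _); last by exists 0%N.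
by rewrite expr0 mul1r divff ?ln1// gt_eqF// wseq_gt0.
Qed.

Lemma le_assoc s t : s <= t -> assoc_fun s <= assoc_fun t.
Proof.
move=> st; rewrite {1}/assoc_fun; case: ifPn => [s0|_]; last exact: assoc_ge0.
have t0 := lt_le_trans s0 st; rewrite /assoc_fun t0.
apply: ge_sup; first by exists (ln (s ^+ 0 * M 0%N / M 0%N)), 0%N.
move=> _ [p _ <-]; apply: (@le_trans _ _ (ln (t ^+ p * M 0%N / M p))).
  have c0 : 0 < M 0%N / M p by rewrite divr_gt0// wseq_gt0.
  rewrite -!mulrA ler_ln ?posrE; do ?by rewrite mulr_gt0// exprn_gt0.
  by apply: ler_wpM2r; [exact: ltW|apply: lerXn2r => //; rewrite nnegrE ltW].
by apply: ub_le_sup; [exact: assoc_ubound|exists p].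
Qed.

End WeightSequences.

Section SmoothFunctions.
Variables (R : realType) (d : nat).
Local Notation Rd := 'rV[R]_d.
Implicit Types f g : Rd -> R[i]^o.

(* Euclidean norm; the library norm on row vectors is the maximum norm *)
Definition enorm (x : Rd) : R := Num.sqrt (\sum_(k < d) x 0 k ^+ 2).

(* R[i] is not a normed space over R in the library: real and imaginary parts
   are differentiated separately *)
Definition refun f : Rd -> R^o := fun x => complex.Re (f x).
Definition imfun f : Rd -> R^o := fun x => complex.Im (f x).

Definition cdifferentiable f (x : Rd) :=
  differentiable (refun f) x /\ differentiable (imfun f) x.

Definition partial (k : 'I_d) f : Rd -> R[i]^o := fun x =>
  Complex ('D_('e_k) (refun f) x) ('D_('e_k) (imfun f) x).

Definition partials (s : seq 'I_d) f : Rd -> R[i]^o := foldr partial f s.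

(* C^infinity: the iterated partial derivatives of all orders exist and are
   differentiable *)
Definition smooth f := forall s x, cdifferentiable (partials s f) x.

Definition multiindex := {ffun 'I_d -> nat}.

Definition mlen (a : multiindex) : nat := (\sum_(k < d) a k)%N.

Definition mderiv (a : multiindex) f : Rd -> R[i]^o :=
  partials (flatten [seq nseq (a k) k | k <- enum 'I_d]) f.

Lemma derive_comb (a b : R) (F G H : Rd -> R^o) x v :
  derivable F x v -> derivable G x v -> derivable H x v ->
  'D_v (a *: F + b *: G + H) x = a * 'D_v F x + b * 'D_v G x + 'D_v H x.
Proof.
move=> dF dG dH.
have daF : derivable (a *: F) x v by exact: derivableZ.
have dbG : derivable (b *: G) x v by exact: derivableZ.
rewrite (deriveD (derivableD daF dbG) dH) (deriveD daF dbG).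
by rewrite (deriveZ a dF) (deriveZ b dG).
Qed.

Lemma differentiable_comb (a b : R) (F G H : Rd -> R^o) x :
  differentiable F x -> differentiable G x -> differentiable H x ->
  differentiable (a *: F + b *: G + H) x.
Proof.
move=> dF dG dH.
have daF : differentiable (a *: F) x by exact: differentiableZ.
have dbG : differentiable (b *: G) x by exact: differentiableZ.
exact: (differentiableD (differentiableD daF dbG) dH).
Qed.

Lemma refun_comb (a : R[i]) f g : refun (a *: f + g) =
  complex.Re a *: refun f + (- complex.Im a) *: imfun f + refun g.
Proof.
case: a => a1 a2; apply/funext => y.
change (complex.Re (Complex a1 a2 * f y + g y) =
    a1 * complex.Re (f y) + (- a2) * complex.Im (f y) + complex.Re (g y)).
by case: (f y) (g y) => ? ? [? ?] /=; rewrite mulNr.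
Qed.

Lemma imfun_comb (a : R[i]) f g : imfun (a *: f + g) =
  complex.Re a *: imfun f + complex.Im a *: refun f + imfun g.
Proof.
case: a => a1 a2; apply/funext => y.
change (complex.Im (Complex a1 a2 * f y + g y) =
    a1 * complex.Im (f y) + a2 * complex.Re (f y) + complex.Im (g y)).
by case: (f y) (g y) => ? ? [? ?].
Qed.

Lemma cdifferentiableP (a : R[i]) f g x :
  cdifferentiable f x -> cdifferentiable g x ->
  cdifferentiable (a *: f + g) x /\
  forall k, partial k (a *: f + g) x = a *: partial k f x + partial k g x.
Proof.
move=> [f1 f2] [g1 g2]; split.
  by split; rewrite ?refun_comb ?imfun_comb; exact: differentiable_comb.
move=> k; rewrite /partial refun_comb imfun_comb.
rewrite (derive_comb _ _ (diff_derivable f1) (diff_derivable f2) (diff_derivable g1)).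
rewrite (derive_comb _ _ (diff_derivable f2) (diff_derivable f1) (diff_derivable g2)).
by case: a => a1 a2; rewrite mulNr.
Qed.

Lemma partialsP (a : R[i]) f g s : smooth f -> smooth g ->
  partials s (a *: f + g) = a *: partials s f + partials s g.
Proof.
move=> fs gs; elim: s => [//|k s ih] /=; rewrite ih; apply/funext => x.
exact: (cdifferentiableP a (fs s x) (gs s x)).2.
Qed.

Lemma smoothP (a : R[i]) f g : smooth f -> smooth g -> smooth (a *: f + g).
Proof.
move=> fs gs s x; rewrite partialsP//.
exact: (cdifferentiableP a (fs s x) (gs s x)).1.
Qed.

Lemma refun0 : refun 0 = cst (0 : R^o). Proof. by []. Qed.
Lemma imfun0 : imfun 0 = cst (0 : R^o). Proof. by []. Qed.

Lemma partials0 s : partials s 0 = 0.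
Proof.
elim: s => [//|k s ih]; rewrite /= ih; apply/funext => x.
rewrite /partial refun0 imfun0.
have -> : 'D_('e_k) (cst (0 : R^o) : Rd -> R^o) x = 0 by exact: derive_cst.
by [].
Qed.

Lemma smooth0 : smooth 0.
Proof.
move=> s x; rewrite partials0; split; rewrite ?refun0 ?imfun0.
  exact: differentiable_cst.
exact: differentiable_cst.
Qed.

(* f (x - .) *)
Definition transl (x : Rd) f : Rd -> R[i]^o := fun y => f (x - y).

Lemma transl_diff (x : Rd) (F : Rd -> R^o) (y v : Rd) :
  differentiable F (x - y) ->
  differentiable (fun y => F (x - y) : R^o) y /\
  'D_v (fun y => F (x - y) : R^o) y = - 'D_v F (x - y).
Proof.
move=> dF; pose A : Rd -> Rd := cst x - id.
have dc : differentiable (cst x : Rd -> Rd) y by exact: differentiable_cst.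
have di : differentiable (id : Rd -> Rd) y by [].
have dA : differentiable A y := differentiableB dc di.
have dFA : differentiable (F \o A) y by exact: differentiable_comp.
split; first exact: dFA.
transitivity ('D_(- v) F (x - y)); last first.
  by rewrite (deriveE (- v) dF) (deriveE v dF) linearN.
rewrite /derive; set u := (X in lim (X @ _) = _).
set w := (X in _ = lim (X @ _)); suff -> : u = w by [].
by apply/funext => h; rewrite /u /w /shift /= scalerN opprD addrCA.
Qed.

Lemma cdifferentiable_transl x f y : cdifferentiable f (x - y) ->
  cdifferentiable (transl x f) y /\
  forall k, partial k (transl x f) y = - partial k f (x - y).
Proof.
move=> [f1 f2]; split=> [|k].
  by split; [exact: (transl_diff 0 f1).1|exact: (transl_diff 0 f2).1].
by rewrite /partial (transl_diff 'e_k f1).2 (transl_diff 'e_k f2).2.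
Qed.

Lemma partials_transl x f s : smooth f ->
  partials s (transl x f) = (-1) ^+ size s *: transl x (partials s f).
Proof.
move=> fs; elim: s => [|k s ih]; first by rewrite expr0 scale1r.
rewrite /= ih; apply/funext => y.
have [dT kT] := cdifferentiable_transl (fs s (x - y)).
rewrite -[X in partial k X]addr0 (cdifferentiableP _ dT (smooth0 [::] y)).2 kT.
have -> : partial k 0 y = 0 := congr1 (fun g => g y) (partials0 [:: k]).
rewrite exprS mulN1r.
change ((-1) ^+ size s * - partial k (partials s f) (x - y) + 0 =
  - (-1) ^+ size s * partial k (partials s f) (x - y)).
by rewrite addr0 mulrN mulNr.
Qed.

Lemma smooth_transl x f : smooth f -> smooth (transl x f).
Proof.
move=> fs s y; rewrite partials_transl// -[X in cdifferentiable X]addr0.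
apply: (cdifferentiableP _ _ (smooth0 [::] y)).1.
exact: (cdifferentiable_transl (fs s (x - y))).1.
Qed.

End SmoothFunctions.

Section SeminormPullback.
Variables (R : realType) (V W : lmodType R[i]).

Lemma seminorm_comp (j : V -> W) (q : W -> R) :
  linear j -> seminorm q -> seminorm (q \o j).
Proof.
move=> jl [qD qZ]; have j0 : j 0 = 0.
  by have := jl (-1) 0 0; rewrite !scaleN1r !addNr.
split=> [x y|a x] /=.
  by have := jl 1 x y; rewrite !scale1r => ->; exact: qD.
by have := jl a x 0; rewrite j0 !addr0 => ->; exact: qZ.
Qed.

End SeminormPullback.

Section WeightedBanach.
Variables (R : realType) (d : nat) (M : weight_sequence R).
Local Notation Rd := 'rV[R]_d.
Implicit Types (h : {posnum R}) (w : Rd -> {posnum R}) (f : Rd -> R[i]^o).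

(* the space of all f with sup_p (bterm h w p f) finite, normed by this
   supremum *)
Definition bterm h w (p : multiindex d * Rd) f : R :=
  h%:num ^+ mlen p.1 * cabs (mderiv p.1 f p.2) * (w p.2)%:num / M (mlen p.1).

Definition bset h w : set (Rd -> R[i]^o) :=
  [set f | smooth f /\ has_ubound [set bterm h w p f | p in setT]].

Lemma bterm_ge0 h w p f : 0 <= bterm h w p f.
Proof.
by rewrite /bterm divr_ge0 ?mulr_ge0 ?cabs_ge0// ltW// wseq_gt0.
Qed.

Lemma bterm_comb h w p (a : R[i]) f g : smooth f -> smooth g ->
  bterm h w p (a *: f + g) <= cabs a * bterm h w p f + bterm h w p g.
Proof.
move=> fs gs; rewrite /bterm /mderiv partialsP//.
set c := h%:num ^+ _; set F := partials _ f; set G := partials _ g.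
set u := (w p.2)%:num; set v := M (mlen p.1).
have v0 : 0 < v by exact: wseq_gt0.
have ab : cabs ((a *: F + G) p.2) <= cabs a * cabs (F p.2) + cabs (G p.2).
  by rewrite -ComplexField.Normc.normcM; exact: le_normcD.
have -> : cabs a * (c * cabs (F p.2) * u / v) + c * cabs (G p.2) * u / v =
    c * (cabs a * cabs (F p.2) + cabs (G p.2)) * u / v.
  by rewrite mulrDr !mulrDl !mulrA (mulrC (cabs a)).
rewrite ler_wpM2r ?invr_ge0 ?(ltW v0)// ler_wpM2r ?/u//.
by rewrite ler_wpM2l ?/c.
Qed.

Lemma mderiv0 a : mderiv a (0 : Rd -> R[i]^o) = 0.
Proof. exact: partials0. Qed.

Lemma bset0 h w : bset h w 0.
Proof.
split; first exact: smooth0.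
exists 0 => _ [p _ <-]; rewrite /bterm mderiv0.
by rewrite ComplexField.Normc.normc0 mulr0 !mul0r.
Qed.

Lemma bsetP h w (a : R[i]) f g : bset h w f -> bset h w g -> bset h w (a *: f + g).
Proof.
move=> [fs [b fb]] [gs [c gc]]; split; first exact: smoothP.
exists (cabs a * b + c) => _ [p _ <-].
apply: le_trans (bterm_comb h w p a fs gs) _.
by rewrite lerD ?ler_wpM2l ?cabs_ge0//; [apply: fb|apply: gc]; exists p.
Qed.

Definition bsub h w : lsubspace (Rd -> R[i]^o) := {|
  subspace_set := bset h w ; subspace0 := bset0 h w ; subspaceP := @bsetP h w |}.

Definition bnorm h w (f : subsp (bsub h w)) : R :=
  sup [set bterm h w p (subsp_val f) | p in setT].

Lemma bterm_seminorm h w p :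
  seminorm (fun f : subsp (bsub h w) => bterm h w p (subsp_val f)).
Proof.
split=> [f g|a f].
  have := bterm_comb h w p 1 (subspW f).1 (subspW g).1.
  by rewrite scale1r ComplexField.Normc.normc1 mul1r.
have E : mderiv p.1 (a *: subsp_val f) p.2 = a * mderiv p.1 (subsp_val f) p.2.
  rewrite -[in LHS](addr0 (a *: subsp_val f)) /mderiv.
  rewrite (partialsP a _ (subspW f).1 (@smooth0 R d)) partials0.
  by rewrite addr0.
have -> : bterm h w p (subsp_val (a *: f)) =
    h%:num ^+ mlen p.1 * cabs (mderiv p.1 (a *: subsp_val f) p.2) *
    (w p.2)%:num / M (mlen p.1) by [].
rewrite E ComplexField.Normc.normcM /bterm.
by rewrite (mulrCA _ (cabs a)) -!mulrA.
Qed.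

Lemma bnorm_seminorm h w : seminorm (@bnorm h w).
Proof.
apply: (@seminorm_sup _ _ _ setT
  (fun p (f : subsp (bsub h w)) => bterm h w p (subsp_val f))).
  by move=> p _; exact: bterm_seminorm.
by move=> f; exact: (subspW f).2.
Qed.

Definition bfamily h w : seminorm_family (subsp (bsub h w)).
Proof.
by exists [set @bnorm h w] => _ ->; exact: bnorm_seminorm.
Defined.

Definition bspace h w : Type := lcs (bfamily h w).
HB.instance Definition _ h w := Tvs.on (bspace h w).

Lemma bset_le h h' w w' : h%:num <= h'%:num ->
  (forall x, (w x)%:num <= (w' x)%:num) -> bset h' w' `<=` bset h w.
Proof.
move=> hh ww f [fs [b fb]]; split=> //; exists b => _ [p _ <-].
apply: le_trans (fb (bterm h' w' p f) _); last by exists p.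
rewrite /bterm ler_wpM2r ?invr_ge0 ?(ltW (wseq_gt0 _ _))//.
apply: ler_pM; rewrite ?mulr_ge0 ?cabs_ge0//.
by rewrite ler_wpM2r ?cabs_ge0// lerXn2r ?nnegrE.
Qed.

End WeightedBanach.

Section Spaces.
Variables (R : realType) (d : nat) (M A : weight_sequence R).
Local Notation Rd := 'rV[R]_d.
Implicit Types (h : {posnum R}) (N : nat) (f : Rd -> R[i]^o) (x : Rd).

(* e^{A(h .)} and e^{- A(. / N)} *)
Definition weightS h x : {posnum R} :=
  PosNum (expR_gt0 (assoc_fun A (enorm (h%:num *: x)))).

Definition weightO N x : {posnum R} :=
  PosNum (expR_gt0 (- assoc_fun A (enorm (N%:R^-1 *: x)))).

(* union over h > 0 of the Banach spaces with weight e^{A(h .)} *)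
Definition sset : set (Rd -> R[i]^o) :=
  [set f | exists h, bset M h (weightS h) f].

Lemma enormZ (c : R) x : enorm (c *: x) = `|c| * enorm x.
Proof.
rewrite /enorm; have -> : \sum_(k < d) (c *: x) 0 k ^+ 2 =
    c ^+ 2 * \sum_(k < d) x 0 k ^+ 2.
  by rewrite mulr_sumr; apply: eq_bigr => k _; rewrite mxE exprMn.
by rewrite sqrtrM ?sqr_ge0// sqrtr_sqr.
Qed.

Lemma sset_le h h' : h%:num <= h'%:num ->
  bset M h' (weightS h') `<=` bset M h (weightS h).
Proof.
move=> hh; apply: bset_le => [|x]; first exact: hh.
change (expR (assoc_fun A (enorm (h%:num *: x))) <=
        expR (assoc_fun A (enorm (h'%:num *: x)))).
rewrite ler_expR; apply: le_assoc; rewrite !enormZ !gtr0_norm//.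
by apply: ler_wpM2r; [exact: sqrtr_ge0|exact: hh].
Qed.

Lemma sset0 : sset 0. Proof. by exists 1%:pos; exact: bset0. Qed.

Lemma ssetP (a : R[i]) f g : sset f -> sset g -> sset (a *: f + g).
Proof.
move=> [h fh] [h' gh']; exists (Num.min h%:num h'%:num)%:pos.
apply: bsetP; [apply: sset_le fh|apply: sset_le gh'];
  by rewrite ge_min lexx ?orbT.
Qed.

Definition ssub : lsubspace (Rd -> R[i]^o) := {|
  subspace_set := sset ; subspace0 := sset0 ; subspaceP := ssetP |}.

Lemma bsub_ssub h : bsub M h (weightS h) `<=` ssub.
Proof. by move=> f fh; exists h. Qed.

Definition sspace : Type := lcs (inductive_family
  (fun h (f : bspace M h (weightS h)) => incl (@bsub_ssub h) f)).
HB.instance Definition _ := Tvs.on sspace.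

Definition eset h : set (Rd -> R[i]^o) :=
  [set f | forall N, (1 <= N)%N -> bset M h (weightO N) f].

Lemma eset0 h : eset h 0. Proof. by move=> N _; exact: bset0. Qed.

Lemma esetP h (a : R[i]) f g : eset h f -> eset h g -> eset h (a *: f + g).
Proof. by move=> fh gh N N1; apply: bsetP; [exact: fh|exact: gh]. Qed.

Definition esub h : lsubspace (Rd -> R[i]^o) := {|
  subspace_set := eset h ; subspace0 := eset0 h ; subspaceP := @esetP h |}.

Lemma esub_bsub h N : (1 <= N)%N -> esub h `<=` bsub M h (weightO N).
Proof. by move=> N1 f; exact. Qed.

(* generates the projective limit topology over N *)
Definition efamily h : seminorm_family (subsp (esub h)).
Proof.
exists [set q | exists N (N1 : (1 <= N)%N),
  q = @bnorm R d M h (weightO N) \o incl (@esub_bsub h N N1)].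
move=> _ [N [N1 ->]]; apply: seminorm_comp; last exact: bnorm_seminorm.
exact: incl_linear.
Defined.

Definition espace h : Type := lcs (efamily h).
HB.instance Definition _ h := Tvs.on (espace h).

Definition ocset : set (Rd -> R[i]^o) := [set f | exists h, eset h f].

Lemma eset_le h h' : h%:num <= h'%:num -> eset h' `<=` eset h.
Proof. by move=> hh f fh N N1; apply: bset_le (fh N N1). Qed.

Lemma ocset0 : ocset 0. Proof. by exists 1%:pos; exact: eset0. Qed.

Lemma ocsetP (a : R[i]) f g : ocset f -> ocset g -> ocset (a *: f + g).
Proof.
move=> [h fh] [h' gh']; exists (Num.min h%:num h'%:num)%:pos.
apply: esetP; [apply: eset_le fh|apply: eset_le gh'];
  by rewrite ge_min lexx ?orbT.
Qed.

Definition ocsub : lsubspace (Rd -> R[i]^o) := {|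
  subspace_set := ocset ; subspace0 := ocset0 ; subspaceP := ocsetP |}.

Lemma esub_ocsub h : esub h `<=` ocsub.
Proof. by move=> f fh; exists h. Qed.

Definition e_incl h (f : espace h) : subsp ocsub := incl (@esub_ocsub h) f.

Definition ocspace : Type := lcs (inductive_family e_incl).
HB.instance Definition _ := Tvs.on ocspace.

(* the sets contained and bounded in espace h for some h *)
Definition step_bounded : set (set ocspace) :=
  [set B | exists h (B0 : set (espace h)), tvs_bounded B0 /\ B = @e_incl h @` B0].

Lemma step_bounded_bounded : step_bounded `<=` @tvs_bounded R ocspace.
Proof.
move=> _ [h [B0 [B0b ->]]].
apply: (@tvs_bounded_image _ (espace h) ocspace (@e_incl h)) => //.
  exact: incl_linear.
exact: (@inductive_continuous _ _ _ _ e_incl h (@incl_linear _ _ _ _ _)).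
Qed.

Definition oc_dual : Type :=
  @hom_unif R ocspace R[i]^o step_bounded step_bounded_bounded.
HB.instance Definition _ := Tvs.on oc_dual.

Definition oc_strong_dual : Type :=
  @hom_unif R ocspace R[i]^o (@tvs_bounded R ocspace) (@subset_refl _ _).
HB.instance Definition _ := Tvs.on oc_strong_dual.

Definition Lb_sspace : Type :=
  @hom_unif R sspace sspace (@tvs_bounded R sspace) (@subset_refl _ _).
HB.instance Definition _ := Tvs.on Lb_sspace.

Lemma transl_ocset x (phi : sspace) :
  ocset (transl x (subsp_val phi)).
Proof.
have [h [fs [b fb]]] := subspW phi; exists h => N N1.
split; first exact: smooth_transl.
exists b => _ [p _ <-].
apply: le_trans (fb (bterm M h (weightS h) (p.1, x - p.2) (subsp_val phi)) _);
  last by exists (p.1, x - p.2).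
rewrite /bterm ler_wpM2r ?invr_ge0 ?(ltW (wseq_gt0 _ _))//=.
rewrite /mderiv partials_transl//.
set s := flatten _; set F := partials s _.
have -> : cabs (((-1) ^+ size s *: transl x F) p.2) = cabs (F (x - p.2)).
  rewrite -[X in cabs X]/((-1) ^+ size s * F (x - p.2)).
  rewrite ComplexField.Normc.normcM -signr_odd; case: odd.
    by rewrite expr1 normcN ComplexField.Normc.normc1 mul1r.
  by rewrite expr0 ComplexField.Normc.normc1 mul1r.
apply: ler_pM; rewrite ?mulr_ge0 ?cabs_ge0 ?expR_ge0//.
by rewrite ler_expR (@le_trans _ _ 0)// ?oppr_le0 assoc_ge0.
Qed.

Definition convolution (f : hom ocspace R[i]^o) (phi : sspace) : Rd -> R[i]^o :=
  fun x => subsp_val f (@mksub _ _ ocsub _ (transl_ocset x phi)).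

(* convolution with f maps sspace continuously into itself when M satisfies (M.1)
   and (M.2) and A satisfies (M.1) and (M.2); the default 0 of xget is only there
   to make the map total *)
Definition convolution_op (f : hom ocspace R[i]^o) : Lb_sspace :=
  xget (0 : Lb_sspace) [set T : hom sspace sspace |
    forall phi, subsp_val (subsp_val T phi : sspace) = convolution f phi].

End Spaces.

Definition strictly_finer (T : Type) (t1 t2 : set_system T) :=
  t2 `<=` t1 /\ ~ (t1 `<=` t2).

(* Main.v *)
(* Everything rests on a subset B of O_C which is bounded but not contained and bounded in
   any E_h. It consists of multiples of
     x |-> ((1 - e^{i s x_k}) / 2)^r e^{i xi x_k},
   which vanish to order r at 0 and peak at x_k = pi / s; by (M.3) the parameters can be
   chosen such that each derivative bound defining E_h is missed, while all continuous
   seminorms of O_C stay bounded.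

   The polar of B is not a neighbourhood of 0 in O_C': suitable multiples of the evaluations
   of derivatives are small on a given set bounded in some E_h, but not on B. On the other
   hand, since B is bounded, the uniform boundedness principle on the Banach space spanned
   by a Banach disk shows that the polar of B absorbs all Banach disks, so O_C' is not
   ultrabornological. The polar of B is a neighbourhood of 0 for the strong topology.

   It remains to see that f |-> *_f is continuous on O_C', so that the initial topology is
   coarser than that of O_C'. The unit ball of a continuous seminorm q on S contains the
   polar of a set L of multiples of point evaluations of derivatives which is
   equicontinuous on each step of S: as in the Banach-Dieudonne theorem, L is a union of
   finite sets found step by step, by compactness of the inclusions between the steps. Then
   q(f * phi) is at most the supremum of |f| over the translates d^s phi(x - .) weighted by
   L, and these form a set bounded in some E_h as phi runs through a bounded set. *)

From HB Require Import structures.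
From mathcomp Require Import all_boot all_order all_algebra.
From mathcomp Require Import all_classical all_reals all_analysis.
From mathcomp Require Import complex ring lra.
Require Import Defs.

Set Implicit Arguments.
Unset Strict Implicit.
Unset Printing Implicit Defensive.

Import Order.TTheory GRing.Theory Num.Theory.
Import numFieldNormedType.Exports.

Local Open Scope classical_set_scope.
Local Open Scope ring_scope.

(** * Smooth functions *)

(** B is a union of countable families of peaks, one for each m >= 1. The m-th family is bounded, by
    a constant c independent of m, in the norm with h = 1 and weight e^{-A(. / m)}; it is bounded in
    E_{1/k} for some k depending on m; and it is unbounded in E_{1/m}, already for a single weight
    e^{-A(. / K)}. A continuous seminorm on O_C, restricted to E_1, is controlled by one weight
    e^{-A(. / N)}, so it has a common bound on all families with m >= N, and each of the finitely
    many others is bounded in some step. The zero of order r makes the weighted bound possible,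
    since |u|^r <= m^r (A_r / A_0) e^{A(u / m)}. By (M.1) and (M.2), e^{M(mu_p)} and e^{A(a_p)} grow
    at most exponentially in p, and dividing the argument by a constant brings the base as close to
    1 as desired; k and K absorb such losses. The power m^{q+1} cannot be absorbed in this way
    because m is prescribed; it is beaten by means of (M.3). *)

Section ComplexNumbers.
Variable R : realType.
Implicit Types a b : R[i].

Lemma cabsM a b : cabs (a * b) = cabs a * cabs b.
Proof. exact: ComplexField.Normc.normcM. Qed.

Lemma cabsD a b : cabs (a + b) <= cabs a + cabs b.
Proof. exact: le_normcD. Qed.

Lemma cabsN a : cabs (- a) = cabs a.
Proof. exact: normcN. Qed.

Lemma cabsB a b : cabs (a - b) <= cabs a + cabs b.
Proof. by rewrite -(cabsN b); exact: cabsD. Qed.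

Lemma cabsBC a b : cabs (a - b) = cabs (b - a).
Proof. by rewrite -cabsN opprB. Qed.

Lemma cabs0 : cabs (0 : R[i]) = 0.
Proof. exact: ComplexField.Normc.normc0. Qed.

Lemma cabs1 : cabs (1 : R[i]) = 1.
Proof. exact: ComplexField.Normc.normc1. Qed.

Lemma cabsX a n : cabs (a ^+ n) = cabs a ^+ n.
Proof. by elim: n => [|n ih]; rewrite ?cabs1// !exprS cabsM ih. Qed.

Lemma normRe_le a : `|complex.Re a| <= cabs a.
Proof.
case: a => x y; rewrite /ComplexField.Normc.normc /= -sqrtr_sqr ler_wsqrtr//.
by rewrite lerDl sqr_ge0.
Qed.

Lemma normIm_le a : `|complex.Im a| <= cabs a.
Proof.
case: a => x y; rewrite /ComplexField.Normc.normc /= -sqrtr_sqr ler_wsqrtr//.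
by rewrite lerDr sqr_ge0.
Qed.

Lemma cabs_leD a : cabs a <= `|complex.Re a| + `|complex.Im a|.
Proof.
case: a => x y; rewrite /ComplexField.Normc.normc /=.
rewrite -[leRHS]ger0_norm ?addr_ge0// -sqrtr_sqr ler_wsqrtr//.
rewrite sqrrD !real_normK ?num_real//.
by rewrite lerD2r lerDl mulrn_wge0// mulr_ge0.
Qed.

End ComplexNumbers.

Section LineDerivatives.
Variables (R : realType) (d : nat).
Local Notation Rd := 'rV[R]_d.
Implicit Types (F : Rd -> R^o) (x v : Rd).

Lemma norm_coord x k : `|x 0 k| <= `|x|.
Proof.
rewrite [leRHS]/Num.norm/= mx_normrE.
exact: (le_bigmax _ (fun ij : 'I_1 * 'I_d => `|x ij.1 ij.2|) (0, k)).
Qed.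

Lemma is_derive_line F x v t : differentiable F (x + t *: v) ->
  is_derive (t : R) 1 (fun s : R => F (x + s *: v)) ('D_v F (x + t *: v)).
Proof.
move=> dF; have E : (fun h : R => h^-1 *: (((fun s : R => F (x + s *: v)) \o shift t)
    (h *: 1) - F (x + t *: v))) =
    (fun h : R => h^-1 *: ((F \o shift (x + t *: v)) (h *: v) - F (x + t *: v))).
  by apply/funext => h /=; rewrite scalerDl -scalerA scale1r addrCA.
split; first by rewrite /derivable E; exact: diff_derivable.
by rewrite /derive E.
Qed.

Lemma derive_sum_coord F x v : differentiable F x ->
  'D_v F x = \sum_k v 0 k * 'D_('e_k) F x.
Proof.
move=> dF; rewrite deriveE// {1}(row_sum_delta v) linear_sum.
by apply: eq_bigr => k _; rewrite linearZ deriveE.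
Qed.

Lemma MVT_line F x v : (forall y, differentiable F y) ->
  exists2 c : R, 0 <= c <= 1 & F (x + v) - F x = 'D_v F (x + c *: v).
Proof.
move=> dF.
have D t := is_derive_line (dF (x + t *: v)).
pose g : R -> R := fun s => F (x + s *: v).
have gc : {within `[0, 1], continuous g}.
  by apply: derivable_within_continuous => t _; case: (D t).
have [c c01] := MVT_segment ler01 (fun t _ => D t) gc.
rewrite /g scale1r scale0r addr0 subr0 mulr1 => E; exists c => //.
Qed.

Lemma lipschitz_line F x v C : (forall y, differentiable F y) ->
  (forall k y, `|'D_('e_k) F y| <= C) ->
  `|F (x + v) - F x| <= d%:R * C * `|v|.
Proof.
move=> dF FC; have [c _ ->] := MVT_line x v dF.
rewrite derive_sum_coord//; apply: le_trans (ler_norm_sum _ _ _) _.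
apply: (@le_trans _ _ (\sum_(k < d) C * `|v|)).
  by apply: ler_sum => k _; rewrite normrM mulrC ler_pM// norm_coord.
by rewrite sumr_const card_ord -mulrA mulr_natl.
Qed.

(** The mean value theorem on the segment, followed by [lipschitz_line] for each partial derivative
    at the intermediate point. The constant is crude; only the quadratic order in [|v|] matters. *)
Lemma taylor_line F x v C : (forall y, differentiable F y) ->
  (forall k y, differentiable ('D_('e_k) F : Rd -> R^o) y) ->
  (forall k l y, `|'D_('e_l) ('D_('e_k) F : Rd -> R^o) y| <= C) ->
  `|F (x + v) - F x - \sum_k v 0 k * 'D_('e_k) F x| <= d%:R ^+ 2 * C * `|v| ^+ 2.
Proof.
move=> dF dDF FC; have [c /andP[c0 c1] ->] := MVT_line x v dF.
rewrite derive_sum_coord// -sumrB; apply: le_trans (ler_norm_sum _ _ _) _.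
apply: (@le_trans _ _ (\sum_(k < d) `|v| * (d%:R * C * `|v|))).
  apply: ler_sum => k _; rewrite -mulrBr normrM ler_pM// ?norm_coord//.
  apply: le_trans (lipschitz_line _ _ (dDF k) (FC k)) _.
  have C0 : 0 <= C by apply: le_trans (FC k k x).
  by rewrite ler_wpM2l ?mulr_ge0// normrZ ger0_norm// ler_piMl.
rewrite sumr_const card_ord -[leLHS]mulr_natl.
rewrite [leLHS](_ : _ = d%:R ^+ 2 * C * `|v| ^+ 2)//; ring.
Qed.

End LineDerivatives.

Section ComplexParts.
Variable R : realType.

Lemma ReB (a b : R[i]) : complex.Re (a - b) = complex.Re a - complex.Re b.
Proof. by case: a b => ? ? []. Qed.

Lemma ImB (a b : R[i]) : complex.Im (a - b) = complex.Im a - complex.Im b.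
Proof. by case: a b => ? ? []. Qed.

Lemma Re_sumZ (I : Type) (r : seq I) (c : I -> R) (z : I -> R[i]) :
  complex.Re (\sum_(k <- r) (c k)%:C%C * z k) =
  \sum_(k <- r) c k * complex.Re (z k).
Proof.
elim/big_rec2 : _ => //= k x y _ <-; case: (z k) => a b; case: y => a' b' /=.
by rewrite mul0r subr0.
Qed.

Lemma Im_sumZ (I : Type) (r : seq I) (c : I -> R) (z : I -> R[i]) :
  complex.Im (\sum_(k <- r) (c k)%:C%C * z k) =
  \sum_(k <- r) c k * complex.Im (z k).
Proof.
elim/big_rec2 : _ => //= k x y _ <-; case: (z k) => a b; case: y => a' b' /=.
by rewrite mul0r addr0.
Qed.

End ComplexParts.

(** * Smoothness from quadratic Taylor remainders *)

Section QuadraticRemainder.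
Variables (R : realType) (d : nat).
Local Notation Rd := 'rV[R]_d.

Definition lin_form (g : 'I_d -> R) (v : Rd) : R^o := \sum_k v 0 k * g k.

Lemma lin_form_linear g : linear (lin_form g).
Proof.
move=> a u v; rewrite /lin_form scaler_sumr -big_split/=; apply: eq_bigr => k _.
by rewrite !mxE mulrDl -mulrA.
Qed.

HB.instance Definition _ g :=
  GRing.isLinear.Build R Rd R^o _ (lin_form g) (lin_form_linear g).

Lemma lin_form_continuous g : continuous (lin_form g).
Proof.
move=> v; apply: differentiable_continuous.
rewrite (_ : lin_form g = \sum_k ((g k) *: (fun w : Rd => w 0 k : R^o))).
  by apply: differentiable_sum => k; apply: differentiableZ; exact: differentiable_coord.
apply/funext => w; rewrite fct_sumE; apply: eq_bigr => k _.
by rewrite mulrC.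
Qed.

(** Converse of [taylor_line]: a quadratic remainder is o(|v|), so the linear form with coefficients
    [g k] is the differential. *)
Lemma differentiable_quadratic (F : Rd -> R^o) x g C :
  (forall v, `|v| <= 1 ->
    `|F (x + v) - F x - \sum_k v 0 k * g k| <= C * `|v| ^+ 2) ->
  differentiable F x /\ forall k, 'D_('e_k) F x = g k.
Proof.
move=> FC.
have E : F \o shift x = cst (F x) + lin_form g +o_ (0 : Rd) id.
  apply: eqaddoE; apply/eqaddoP => _/posnumP[e].
  have C1 : 0 < `|C| + 1 by rewrite ltr_wpDl.
  pose r := Num.min 1 (e%:num / (`|C| + 1)).
  have r0 : 0 < r by rewrite lt_min ltr01/= divr_gt0.
  near=> v; have vr : `|v| < r.
    by near: v; apply/nbhs_ballP; exists r => //= z; rewrite -ball_normE /= sub0r normrN.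
  rewrite [X in `|X| <= _](_ : _ = F (x + v) - F x - \sum_k v 0 k * g k); last first.
    change (F (v + x) - (F x + lin_form g v) = F (x + v) - F x - lin_form g v).
    by rewrite [v + x]addrC opprD addrA.
  apply: le_trans (FC _ _) _.
    have r1 : r <= 1 by rewrite ge_min lexx.
    exact: ltW (lt_le_trans vr r1).
  rewrite expr2 mulrA ler_wpM2r//.
  apply: (@le_trans _ _ ((`|C| + 1) * `|v|)).
    by rewrite ler_wpM2r// (le_trans (ler_norm _))// lerDl.
  have re : r <= e%:num / (`|C| + 1) by rewrite ge_min lexx orbT.
  by rewrite mulrC -ler_pdivlMr//; exact: ltW (lt_le_trans vr re).
have dE : 'd F x = lin_form g :> (Rd -> R^o).
  by apply: diff_unique E; exact: lin_form_continuous.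
have dF : differentiable F x.
  by apply/diff_locallyP; rewrite dE; split=> //; exact: lin_form_continuous.
split=> // k; rewrite deriveE// dE /lin_form (bigD1 k)//= big1 => [|j jk].
  by rewrite mxE !eqxx mul1r addr0.
by rewrite mxE (negbTE jk) andbF mul0r.
Unshelve. all: by end_near. Qed.

End QuadraticRemainder.

Section Jets.
Variables (R : realType) (d : nat).
Local Notation Rd := 'rV[R]_d.
Implicit Types (f : Rd -> R[i]^o) (x v : Rd) (s : seq 'I_d).

Definition remainder f x v (b : 'I_d -> R[i]) : R[i] :=
  f (x + v) - f x - \sum_k (v 0 k)%:C%C * b k.

Lemma smooth_lipschitz f x v C : smooth f ->
  (forall k y, cabs (partial k f y) <= C) ->
  cabs (f (x + v) - f x) <= (d%:R * C * `|v|) *+ 2.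
Proof.
move=> fs fC; apply: le_trans (cabs_leD _) _; rewrite ReB ImB mulr2n lerD//.
  apply: (lipschitz_line x v (fun y => (fs [::] y).1)) => k y.
  exact: le_trans (normRe_le (partial k f y)) (fC k y).
apply: (lipschitz_line x v (fun y => (fs [::] y).2)) => k y.
exact: le_trans (normIm_le (partial k f y)) (fC k y).
Qed.

Lemma smooth_taylor f x v C : smooth f ->
  (forall k l y, cabs (partial l (partial k f) y) <= C) ->
  cabs (remainder f x v (fun k => partial k f x)) <=
    (d%:R ^+ 2 * C * `|v| ^+ 2) *+ 2.
Proof.
move=> fs fC; apply: le_trans (cabs_leD _) _.
rewrite /remainder !ReB !ImB Re_sumZ Im_sumZ mulr2n lerD//.
  apply: (taylor_line x v (fun y => (fs [::] y).1)) => [k y|k l y].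
    exact: (fs [:: k] y).1.
  exact: le_trans (normRe_le (partial l (partial k f) y)) (fC k l y).
apply: (taylor_line x v (fun y => (fs [::] y).2)) => [k y|k l y].
  exact: (fs [:: k] y).2.
exact: le_trans (normIm_le (partial l (partial k f) y)) (fC k l y).
Qed.

(** Candidate derivatives: [G s] is meant to be the iterated partial derivative of [G [::]] along
    [s]. Unlike differentiability, a remainder bound with an explicit constant survives pointwise
    limits and continuous functionals; this is how limits of bounded families and convolutions are
    shown to be smooth. *)
Definition jet (G : seq 'I_d -> Rd -> R[i]^o) := forall s x, exists C : R,
  forall v, `|v| <= 1 ->
    cabs (remainder (G s) x v (fun k => G (k :: s) x)) <= C * `|v| ^+ 2.

Lemma jet_partial G s x : jet G ->
  cdifferentiable (G s) x /\ forall k, partial k (G s) x = G (k :: s) x.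
Proof.
move=> /(_ s x)[C GC].
have [] := @differentiable_quadratic _ _ (refun (G s)) x
  (fun k => complex.Re (G (k :: s) x)) C.
  move=> v v1; apply: le_trans (GC v v1); rewrite -Re_sumZ -!ReB; exact: normRe_le.
have [] := @differentiable_quadratic _ _ (imfun (G s)) x
  (fun k => complex.Im (G (k :: s) x)) C.
  move=> v v1; apply: le_trans (GC v v1); rewrite -Im_sumZ -!ImB; exact: normIm_le.
move=> dI DI dR DR; split=> // k; rewrite /partial DI DR.
by case: (G (k :: s) x).
Qed.

Lemma partials_jet G s : jet G -> partials s (G [::]) = G s.
Proof.
move=> Gj; elim: s => [//|k s ih]; rewrite /= ih; apply/funext => x.
exact: (jet_partial s x Gj).2.
Qed.

Lemma smooth_jet G : jet G -> smooth (G [::]).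
Proof. by move=> Gj s x; rewrite partials_jet//; exact: (jet_partial s x Gj).1. Qed.

Lemma smooth_partials f s : smooth f -> smooth (partials s f).
Proof. by move=> fs t x; rewrite /partials -foldr_cat; exact: fs. Qed.

Lemma smooth_partial f k : smooth f -> smooth (partial k f).
Proof. exact: (@smooth_partials f [:: k]). Qed.

Lemma partials_cat f s t : partials s (partials t f) = partials (s ++ t) f.
Proof. by rewrite /partials foldr_cat. Qed.

End Jets.

Section Clairaut.
Variables (R : realType) (d : nat).
Local Notation Rd := 'rV[R]_d.
Implicit Types (F : Rd -> R^o) (f : Rd -> R[i]^o) (x v w : Rd).

Lemma derive_shift_arg F w v x : 'D_v (fun y => F (y + w) : R^o) x = 'D_v F (x + w).
Proof.
rewrite /derive; set a := (X in lim (X @ _) = _).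
set b := (X in _ = lim (X @ _)); suff -> : a = b by [].
by apply/funext => h; rewrite /a /b /shift /= addrA.
Qed.

Lemma differentiable_shift_arg F w x : differentiable F (x + w) ->
  differentiable (fun y => F (y + w) : R^o) x.
Proof.
move=> dF.
have dA : differentiable (id + cst w : Rd -> Rd) x.
  by apply: differentiableD => //; exact: differentiable_cst.
by have : differentiable (F \o (id + cst w : Rd -> Rd)) x by exact: differentiable_comp.
Qed.

Definition second_difference F x v w : R := F (x + v + w) - F (x + v) - (F (x + w) - F x).

Lemma second_differenceC F x v w : second_difference F x v w = second_difference F x w v.
Proof. by rewrite /second_difference (addrAC x v w); lra. Qed.

Lemma second_difference_MVT F x v w : (forall y, differentiable F y) ->
  (forall y, differentiable ('D_v F : Rd -> R^o) y) ->
  exists c1 c2 : R, [/\ 0 <= c1 <= 1, 0 <= c2 <= 1 &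
    second_difference F x v w = 'D_w ('D_v F : Rd -> R^o) (x + c1 *: v + c2 *: w)].
Proof.
move=> dF dvF; pose g : Rd -> R^o := (fun y => F (y + w) : R^o) - F.
have dg y : differentiable g y :=
  differentiableB (differentiable_shift_arg (dF (y + w))) (dF y).
have [c1 c1P E1] := MVT_line x v dg.
have [c2 c2P E2] := MVT_line (x + c1 *: v) w dvF.
exists c1, c2; split => //; rewrite -E2 -[LHS]/(g (x + v) - g x) E1.
rewrite /g deriveB; last 2 first.
- by apply: diff_derivable; exact: differentiable_shift_arg.
- exact: diff_derivable.
by rewrite derive_shift_arg.
Qed.

Lemma derivative_scale F x (t : R) v : differentiable F x ->
  'D_(t *: v) F x = t * 'D_v F x.
Proof. by move=> dF; rewrite !deriveE// linearZ. Qed.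

Lemma continuous_dist F x (e : R) : differentiable F x -> 0 < e ->
  exists2 r : R, 0 < r & forall v, `|v| < r -> `|F (x + v) - F x| < e.
Proof.
move=> /differentiable_continuous /cvgrPdist_lt dF e0.
have /nbhs_ballP[r /= r0 rP] := dF e e0.
exists r => // v vr; rewrite distrC; apply: rP; rewrite -ball_normE /=.
by rewrite opprD addrA subrr sub0r normrN.
Qed.

Lemma dist_half (a b c e : R) : `|a - b| < e / 2 -> `|a - c| < e / 2 -> `|b - c| <= e.
Proof.
move=> ab ac; rewrite (splitr e).
have -> : b - c = (b - a) + (a - c) by rewrite addrA subrK.
by apply: le_trans (ler_normD _ _) _; rewrite (distrC b); exact: lerD (ltW ab) (ltW ac).
Qed.

(** The second difference with increments t v and t w is symmetric in v and w, and by the mean value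
    theorem it is t^2 times either mixed derivative at a point close to [x]. Continuity of both
    mixed derivatives at [x] forces equality. *)
Lemma derive_comm F v w x : (forall y, differentiable F y) ->
  (forall y, differentiable ('D_v F : Rd -> R^o) y) ->
  (forall y, differentiable ('D_w F : Rd -> R^o) y) ->
  differentiable ('D_w ('D_v F : Rd -> R^o) : Rd -> R^o) x ->
  differentiable ('D_v ('D_w F : Rd -> R^o) : Rd -> R^o) x ->
  'D_w ('D_v F : Rd -> R^o) x = 'D_v ('D_w F : Rd -> R^o) x.
Proof.
move=> dF dvF dwF d1 d2.
pose H1 := 'D_w ('D_v F : Rd -> R^o) : Rd -> R^o.
pose H2 := 'D_v ('D_w F : Rd -> R^o) : Rd -> R^o.
rewrite -/(H1 x) -/(H2 x).
apply/eqP; rewrite -subr_eq0 -normr_le0; apply/ler_addgt0Pr => e e0.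
have e2 : 0 < e / 2 by rewrite divr_gt0.
have [r1 r10 r1P] := continuous_dist d1 e2.
have [r2 r20 r2P] := continuous_dist d2 e2.
pose r := Num.min r1 r2; have r0 : 0 < r by rewrite lt_min r10.
(* The summand 1 keeps [n] positive for v = w = 0 and makes the inequality in [small] strict. *)
pose n := `|v| + `|w| + 1; have n0 : 0 < n by rewrite /n ltr_wpDl// addr_ge0.
have [t t0 tn] : exists2 t, 0 < t & t * n = r.
  by exists (r / n); rewrite ?divr_gt0// divfK// gt_eqF.
have small c1 c2 (v' w' : Rd) : `|v'| + `|w'| + 1 = n -> 0 <= c1 <= 1 -> 0 <= c2 <= 1 ->
    `|c1 *: (t *: v') + c2 *: (t *: w')| < r.
  move=> nE /andP[c10 c11] /andP[c20 c21].
  apply: (@le_lt_trans _ _ (t * (`|v'| + `|w'|))); last first.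
    by rewrite -tn ltr_pM2l// -nE ltrDl.
  apply: le_trans (ler_normD _ _) _; rewrite !normrZ (ger0_norm c10) (ger0_norm c20).
  rewrite (gtr0_norm t0) mulrDr lerD// ler_piMl// mulr_ge0//; exact: ltW.
have mvt v' w' (Hv : forall y, differentiable ('D_v' F : Rd -> R^o) y)
    (Hw : forall y, differentiable ('D_v' F : Rd -> R^o) y) :
    `|v'| + `|w'| + 1 = n ->
    exists2 u, `|u| < r & second_difference F x (t *: v') (t *: w') =
      t ^+ 2 * 'D_w' ('D_v' F : Rd -> R^o) (x + u).
  move=> nE.
  have DE : 'D_(t *: v') F = t *: ('D_v' F : Rd -> R^o).
    by apply/funext => y; rewrite derivative_scale.
  have dt y : differentiable ('D_(t *: v') F : Rd -> R^o) y.
    by rewrite DE; exact: differentiableZ.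
  have [c1 [c2 [c1P c2P ->]]] := second_difference_MVT x (t *: w') dF dt.
  exists (c1 *: (t *: v') + c2 *: (t *: w')); first exact: small.
  rewrite -addrA DE deriveZ; last exact: diff_derivable.
  by rewrite derivative_scale// expr2 -mulrA.
have [u1 u1r E1] := mvt v w dvF dvF erefl.
have [u2 u2r E2] := mvt w v dwF dwF (congr1 (fun z => z + 1) (addrC _ _)).
have E : H1 (x + u1) = H2 (x + u2).
  apply: (mulfI (lt0r_neq0 (exprn_gt0 2 t0))).
  by rewrite -[LHS]E1 -[RHS]E2 second_differenceC.
have h1 : `|H1 (x + u1) - H1 x| < e / 2.
  by apply: r1P; apply: lt_le_trans u1r _; rewrite ge_min lexx.
have h2 : `|H2 (x + u2) - H2 x| < e / 2.
  by apply: r2P; apply: lt_le_trans u2r _; rewrite ge_min lexx orbT.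
by rewrite add0r; rewrite -E in h2; exact: dist_half h1 h2.
Qed.

Lemma partial_comm f j k x : smooth f ->
  partial j (partial k f) x = partial k (partial j f) x.
Proof.
move=> fs.
have re := @derive_comm (refun f) 'e_k 'e_j x (fun y => (fs [::] y).1)
  (fun y => (fs [:: k] y).1) (fun y => (fs [:: j] y).1)
  (fs [:: j; k] x).1 (fs [:: k; j] x).1.
have im := @derive_comm (imfun f) 'e_k 'e_j x (fun y => (fs [::] y).2)
  (fun y => (fs [:: k] y).2) (fun y => (fs [:: j] y).2)
  (fs [:: j; k] x).2 (fs [:: k; j] x).2.
exact: (congr2 (@Complex R) re im).
Qed.

Lemma partials_rcons f s k : smooth f -> partials (k :: s) f = partials (rcons s k) f.
Proof.
move=> fs; elim: s => [//|j s ih]; rewrite rcons_cons.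
rewrite -[RHS]/(partial j (partials (rcons s k) f)) -ih; apply/funext => x.
exact: (partial_comm k j x (smooth_partials s fs)).
Qed.

Lemma partials_perm f s t : smooth f -> perm_eq s t -> partials s f = partials t f.
Proof.
move=> fs; elim: s t => [|k s ih] t; first by rewrite perm_sym => /perm_nilP ->.
move=> kst; have kt : k \in t by rewrite -(perm_mem kst) mem_head.
case/splitPr: kt kst => t1 t2 kst.
have st : perm_eq s (t1 ++ t2).
  by rewrite -(perm_cons k) (perm_trans kst)// perm_catC /= perm_cons perm_catC.
rewrite [LHS]/= (ih _ st) -[LHS]/(partials (k :: (t1 ++ t2)) f).
rewrite -cat_cons -!partials_cat partials_rcons; last exact: smooth_partials.
by rewrite !partials_cat cat_rcons.
Qed.

Definition multi (s : seq 'I_d) : multiindex d := [ffun k => count_mem k s].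

Definition multi_seq (a : multiindex d) := flatten [seq nseq (a k) k | k <- enum 'I_d].

Lemma count_multi_seq (a : multiindex d) k : count_mem k (multi_seq a) = a k.
Proof.
rewrite /multi_seq count_flatten -map_comp sumnE big_map.
rewrite big_enum (bigD1 k)//= count_nseq /= eqxx mul1n big1 ?addn0// => j jk.
by rewrite count_nseq /= (negbTE jk).
Qed.

Lemma mderiv_partials f s : smooth f -> mderiv (multi s) f = partials s f.
Proof.
move=> fs; apply: partials_perm => //; apply/allP => k _ /=.
by rewrite -/(multi_seq _) count_multi_seq ffunE.
Qed.

Lemma size_multi_seq (a : multiindex d) : size (multi_seq a) = mlen a.
Proof.
rewrite /multi_seq size_flatten /shape -map_comp sumnE big_map big_enum /mlen.
by apply: eq_bigr => k _; rewrite /= size_nseq.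
Qed.

Lemma mlen_multi s : mlen (multi s) = size s.
Proof.
rewrite -size_multi_seq; apply: perm_size; apply/allP => k _ /=.
by rewrite count_multi_seq ffunE.
Qed.

End Clairaut.

(** * Locally convex topologies *)

Section SeminormTheory.
Variables (R : realType) (V : lmodType R[i]).
Implicit Types (q : V -> R).

Lemma seminorm_dist q x y : seminorm q -> `|q x - q y| <= q (x - y).
Proof.
move=> qs; have h1 := qs.1 (x - y) y; rewrite subrK in h1.
have h2 := qs.1 (y - x) x; rewrite subrK -opprB (seminormN _ qs) in h2.
by rewrite ler_norml; apply/andP; split; lra.
Qed.

Lemma seminormZr q (t : R) x : seminorm q -> 0 <= t -> q (t%:C%C *: x) = t * q x.
Proof. by move=> qs t0; rewrite qs.2 cabsR ger0_norm. Qed.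

Lemma seminorm_bigsum (s : seq (V -> R)) : (forall p, p \in s -> seminorm p) ->
  seminorm (fun x => \sum_(p <- s) p x).
Proof.
move=> sP; split=> [x y|a x].
  rewrite -big_split/= big_seq [leRHS]big_seq; apply: ler_sum => p ps.
  exact: (sP p ps).1.
rewrite mulr_sumr big_seq [RHS]big_seq; apply: eq_bigr => p ps.
exact: (sP p ps).2.
Qed.

Lemma le_bigsum (s : seq (V -> R)) p x : (forall p, p \in s -> seminorm p) ->
  p \in s -> p x <= \sum_(p <- s) p x.
Proof.
move=> sP ps; rewrite (perm_big _ (perm_to_rem ps)) big_cons lerDl big_seq.
by apply: sumr_ge0 => r /mem_rem rs; apply: seminorm_ge0; exact: sP.
Qed.

End SeminormTheory.

Section TvsSeminorms.
Variables (R : realType).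

Lemma tvs_seminorm_near (E : tvsType R[i]) (q : E -> R) (x : E) (e : R) :
  seminorm q -> continuous q -> 0 < e -> \forall y \near x, q (y - x) < e.
Proof.
move=> qs qc e0; have sc : (fun y : E => y - x) @ x --> (0 : E).
  rewrite -(subrr x).
  apply: (@continuous_comp _ _ _ (fun y => (y, x)) (fun z => z.1 - z.2)).
    by apply: cvg_pair => /=; [exact: cvg_id|exact: cvg_cst].
  exact: sub_continuous.
apply: (sc [set y | q y < e]); apply: (qc 0 [set t | t < e]).
by rewrite /= seminorm0//; exact: open_nbhs_lt.
Qed.

Lemma near_seminorm_continuous (E : tvsType R[i]) (q : E -> R) : seminorm q ->
  (forall (x : E) e, 0 < e -> \forall y \near x, q (y - x) < e) -> continuous q.
Proof.
move=> qs qc x; apply/cvgrPdist_lt => e e0; apply: filterS (qc x e e0) => y qy.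
by rewrite distrC; exact: le_lt_trans (seminorm_dist _ _ qs) qy.
Qed.

Lemma seminorm_continuous_le (E : tvsType R[i]) (p q : E -> R) (C : R) :
  seminorm p -> seminorm q -> continuous p -> (forall x, q x <= C * p x) ->
  continuous q.
Proof.
move=> ps qs pc qp; apply: near_seminorm_continuous => // x e e0.
have C1 : 0 < `|C| + 1 by rewrite ltr_wpDl.
have := tvs_seminorm_near x ps pc (divr_gt0 e0 C1); apply: filterS => y.
rewrite ltr_pdivlMr// mulrC => pe; apply: le_lt_trans pe.
apply: le_trans (qp _) _; rewrite ler_wpM2r ?(seminorm_ge0 _ ps)//.
by rewrite (le_trans (ler_norm _))// lerDl.
Qed.

Lemma linear_sub (V W : lmodType R[i]) (T : V -> W) x y : linear T -> T (x - y) = T x - T y.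
Proof. by move=> Tl; rewrite addrC -scaleN1r Tl scaleN1r addrC. Qed.

Lemma linear_map0 (V W : lmodType R[i]) (T : V -> W) : linear T -> T 0 = 0.
Proof. by move=> Tl; rewrite -(subrr 0) linear_sub// subrr. Qed.

Lemma linear_scale (V W : lmodType R[i]) (T : V -> W) a x : linear T -> T (a *: x) = a *: T x.
Proof. by move=> Tl; rewrite -[a *: x]addr0 Tl linear_map0// addr0. Qed.

Lemma cabs_seminorm : seminorm (fun z : R[i]^o => cabs z).
Proof. by split=> [x y|a x]; [exact: cabsD|exact: cabsM]. Qed.

Lemma cnbhsP (z : R[i]^o) (U : set R[i]^o) :
  nbhs z U <-> exists2 e : R, 0 < e & forall w, cabs (w - z) < e -> U w.
Proof.
split=> [/nbhs_ballP[e /= e0 eU]|[e e0 eU]].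
  have eR : e = (complex.Re e)%:C%C by rewrite RRe_real// gtr0_real.
  exists (complex.Re e); first by move: e0; rewrite {1}eR ltcR.
  by move=> w zw; apply: eU; rewrite -ball_normE /= distrC cabsE eR ltcR.
apply/nbhs_ballP; exists e%:C%C; first by rewrite /= ltcR.
by move=> w; rewrite -ball_normE /= distrC cabsE ltcR; exact: eU.
Qed.

Lemma cabs_continuous : continuous (fun z : R[i]^o => cabs z).
Proof.
apply: near_seminorm_continuous; first exact: cabs_seminorm.
by move=> x e e0; apply/cnbhsP; exists e.
Qed.

Lemma seminorm_cscale (q : R[i]^o -> R) z : seminorm q -> q z = cabs z * q 1.
Proof. by move=> qs; rewrite -qs.2 /GRing.scale /= mulr1. Qed.

Lemma seminorm_linear (V W : lmodType R[i]) (T : V -> W) (q : W -> R) :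
  linear T -> seminorm q -> seminorm (fun x => q (T x)).
Proof. exact: seminorm_comp. Qed.

Lemma functional_continuousP (E : tvsType R[i]) (f : E -> R[i]^o) : linear f ->
  continuous f <-> continuous (fun x => cabs (f x)).
Proof.
move=> fl; have fs := seminorm_linear fl cabs_seminorm; split=> [fc|fc] x.
  by apply: continuous_comp; [exact: fc|exact: cabs_continuous].
move=> U /cnbhsP[e e0 eU]; have := tvs_seminorm_near x fs fc e0.
by apply: filterS => y; rewrite linear_sub//; exact: eU.
Qed.

End TvsSeminorms.

Section LcsTheory.
Variables (R : realType) (V : lmodType R[i]) (Q : seminorm_family V).

Lemma lcs_seminorm_continuous q : seminorms Q q -> continuous (q : lcs Q -> R).
Proof.
move=> Qq; have qs := seminormsP Qq.
apply: (@near_seminorm_continuous _ (lcs Q)) => // x e e0.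
exists [:: q], e; split=> // [p|y]; first by rewrite inE => /eqP ->.
by apply; rewrite mem_head.
Qed.

Lemma lcs_continuous (E : tvsType R[i]) (T : E -> lcs Q) : linear T ->
  (forall q, seminorms Q q -> continuous (fun x => q (T x))) -> continuous T.
Proof.
move=> Tl Tc x U [s [e [sQ e0 sU]]].
suff : \forall y \near x, forall q, q \in s -> q (T y - T x : V) < e.
  by apply: filterS => y; exact: sU.
elim: s sQ {sU} => [|q s ih] sQ; first by apply: nearW => y q; rewrite in_nil.
have Qq : seminorms Q q by apply: sQ; rewrite mem_head.
have qs : seminorm (fun y => q (T y)) by apply: seminorm_comp => //; exact: seminormsP Qq.
have h1 := tvs_seminorm_near x qs (Tc q Qq) e0.
have h2 : \forall y \near x, forall p, p \in s -> p (T y - T x : V) < e.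
  by apply: ih => p ps; apply: sQ; rewrite in_cons ps orbT.
apply: filterS2 h1 h2 => y h1 h2 p; rewrite in_cons => /orP[/eqP->|]; last exact: h2.
by rewrite -linear_sub.
Qed.

Lemma lcs_seminorm_bound (q : V -> R) : seminorm q -> continuous (q : lcs Q -> R) ->
  exists s (C : R), [/\ (forall p, p \in s -> seminorms Q p), 0 <= C &
    forall x, q x <= C * \sum_(p <- s) p x].
Proof.
move=> qs qc; have [s [e [sQ e0 sU]]] : nbhs (0 : lcs Q) [set x | q x < 1].
  by apply: (qc 0 [set t | t < 1]); rewrite seminorm0//; exact: open_nbhs_lt.
have sS p : p \in s -> seminorm p by move=> /sQ; exact: seminormsP.
have ss := seminorm_bigsum sS.
exists s, e^-1; split; [exact: sQ|by rewrite invr_ge0 ltW|move=> x].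
(* The vector is divided by e^-1 S + c with c > 0 arbitrary, because S may vanish. *)
apply/ler_addgt0Pr => c c0; set S := \sum_(p <- s) p x.
have S0 : 0 <= S := seminorm_ge0 x ss.
have t0 : 0 < e^-1 * S + c by rewrite ltr_wpDl// mulr_ge0// invr_ge0 ltW.
have ti0 : 0 <= (e^-1 * S + c)^-1 by rewrite invr_ge0 ltW.
have : q ((e^-1 * S + c)^-1%:C%C *: x) < 1.
  apply: sU => p ps; rewrite subr0 seminormZr//; last exact: sS.
  rewrite mulrC ltr_pdivrMr// mulrDr mulrA divff ?gt_eqF// mul1r.
  by apply: le_lt_trans (le_bigsum x sS ps) _; rewrite ltrDl mulr_gt0.
by rewrite seminormZr// mulrC ltr_pdivrMr// mul1r => /ltW.
Qed.

Lemma lcs_bounded (B : set (lcs Q)) :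
  (forall q, seminorms Q q -> exists C, forall x, B x -> q x <= C) -> tvs_bounded B.
Proof.
move=> BQ U [s [e [sQ e0 sU]]].
have [C C0 CP] : exists2 C : R, 0 < C &
    forall q x, q \in s -> B x -> q (x : V) < C.
  elim: s sQ {sU} => [|q s ih] sQ; first by exists 1.
  have [C1 C1P] := BQ q (sQ q (mem_head _ _)).
  have [|C C0 CP] := ih; first by move=> p ps; apply: sQ; rewrite in_cons ps orbT.
  exists (C + `|C1|) => [|p x]; first by rewrite ltr_wpDr.
  rewrite in_cons => /orP[/eqP-> /C1P|ps Bx].
    by move=> h; apply: le_lt_trans h _; rewrite (le_lt_trans (ler_norm _))// ltrDr.
  by rewrite (lt_le_trans (CP _ _ ps Bx))// lerDl.
exists (C / e) => [|a ra x Bx]; first by rewrite divr_gt0.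
have a0 : 0 < cabs a by apply: lt_le_trans ra; rewrite divr_gt0.
have an0 : a != 0 by apply: contraTneq a0 => ->; rewrite cabs0 ltxx.
exists (a^-1 *: (x : V)); last by rewrite scalerA divff// scale1r.
apply: sU => q qs; rewrite subr0 (seminormsP (sQ q qs)).2 ComplexField.Normc.normcV.
rewrite mulrC ltr_pdivrMr//; apply: lt_le_trans (CP q x qs Bx) _.
by rewrite mulrC -ler_pdivrMr.
Qed.

End LcsTheory.

(** * The weighted spaces *)

Lemma bigsum_le (R : realType) (V : Type) (s : seq (V -> R)) x K :
  (forall p, p \in s -> p x <= K) -> \sum_(p <- s) p x <= (size s)%:R * K.
Proof.
elim: s => [|p s ih] sK; first by rewrite big_nil mul0r.
rewrite big_cons /= -[(size s).+1%:R]natr1 mulrDl mul1r addrC lerD//.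
  by apply: ih => r rs; apply: sK; rewrite in_cons rs orbT.
by apply: sK; rewrite mem_head.
Qed.

Section SequenceBounds.
Variables (R : realType) (d : nat) (M : weight_sequence R).
Local Notation Rd := 'rV[R]_d.
Implicit Types (h : {posnum R}) (w : Rd -> {posnum R}) (f : Rd -> R[i]^o).

(* by symmetry of partial derivatives, the norm of bspace may be computed over
   all sequences of directions instead of multi-indices *)
Definition sbound h w f (C : R) := forall s x,
  h%:num ^+ size s * cabs (partials s f x) * (w x)%:num <= C * M (size s).

Lemma sbound_bterm h w f C : smooth f ->
  sbound h w f C <-> forall p, bterm M h w p f <= C.
Proof.
move=> fs; split=> [fC [a x]|fC s x].
  by rewrite /bterm ler_pdivrMr ?wseq_gt0//= -size_multi_seq; exact: fC.
rewrite -ler_pdivrMr ?wseq_gt0//; have := fC (multi s, x).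
by rewrite /bterm /= mderiv_partials// mlen_multi.
Qed.

Lemma sbound_ge0 h w f C : sbound h w f C -> 0 <= C.
Proof.
move=> /(_ [::] 0) fC; have : 0 <= C * M 0%N.
  by apply: le_trans fC; rewrite !mulr_ge0// cabs_ge0.
by rewrite pmulr_lge0// wseq_gt0.
Qed.

Lemma sbound_le h w f C C' : C <= C' -> sbound h w f C -> sbound h w f C'.
Proof.
move=> CC' fC s x; apply: le_trans (fC s x) _.
by rewrite ler_wpM2r// ltW// wseq_gt0.
Qed.

Lemma bset_sbound h w f : bset M h w f <-> smooth f /\ exists C, sbound h w f C.
Proof.
split=> [[fs [C fC]]|[fs [C fC]]]; split=> //; exists C.
  by apply/sbound_bterm => // p; apply: fC; exists p.
by move=> _ [p _ <-]; move: p; apply/sbound_bterm.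
Qed.

Lemma sbound_bnorm h w (f : subsp (bsub M h w)) : sbound h w (subsp_val f) (bnorm f).
Proof.
apply/sbound_bterm; first exact: (subspW f).1.
by move=> p; apply: ub_le_sup; [exact: (subspW f).2|exists p].
Qed.

Lemma bnorm_le h w (f : subsp (bsub M h w)) C : sbound h w (subsp_val f) C -> bnorm f <= C.
Proof.
move=> fC; apply: ge_sup; first by exists (bterm M h w ([ffun=> 0%N], 0) (subsp_val f)), ([ffun=> 0%N], 0).
move=> _ [p _ <-]; move: p; apply/sbound_bterm => //; exact: (subspW f).1.
Qed.

Lemma sbound_comb h w f g (a : R[i]) C C' : smooth f -> smooth g ->
  sbound h w f C -> sbound h w g C' -> sbound h w (a *: f + g) (cabs a * C + C').
Proof.
move=> fs gs /(sbound_bterm _ _ _ fs) fC /(sbound_bterm _ _ _ gs) gC.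
apply/sbound_bterm; first exact: smoothP.
move=> p; apply: le_trans (bterm_comb M h w p a fs gs) _.
by rewrite lerD// ler_wpM2l ?cabs_ge0.
Qed.

Lemma bspace_seminorm_bound h w (q : bspace M h w -> R) : seminorm q -> continuous q ->
  exists2 C : R, 0 <= C &
    forall (f : bspace M h w) K, sbound h w (subsp_val f) K -> q f <= C * K.
Proof.
move=> qs qc; have [s [C [sQ C0 qC]]] := lcs_seminorm_bound qs qc.
exists (C * (size s)%:R) => [|f K fK]; first by rewrite mulr_ge0.
apply: le_trans (qC f) _; rewrite -mulrA ler_wpM2l//.
by apply: bigsum_le => p /sQ ->; exact: bnorm_le.
Qed.

Lemma bspace_seminorm_continuous h w (q : bspace M h w -> R) C : seminorm q ->
  (forall (f : bspace M h w) K, sbound h w (subsp_val f) K -> q f <= C * K) ->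
  continuous q.
Proof.
move=> qs qC; apply: (@seminorm_continuous_le R (bspace M h w) (@bnorm R d M h w) q C) => //.
- exact: bnorm_seminorm.
- exact: lcs_seminorm_continuous.
- by move=> f; apply: qC; exact: sbound_bnorm.
Qed.

End SequenceBounds.

Section SpaceBounds.
Variables (R : realType) (d : nat) (M A : weight_sequence R).
Local Notation Rd := 'rV[R]_d.
Implicit Types h : {posnum R}.

Lemma sbound_weightO_le h N N' (f : Rd -> R[i]^o) C : (1 <= N)%N -> (N <= N')%N ->
  sbound M h (weightO A N') f C -> sbound M h (weightO A N) f C.
Proof.
move=> N1 NN' fC s x; apply: le_trans (fC s x).
have w : expR (- assoc_fun A (enorm (N%:R^-1 *: x))) <=
    expR (- assoc_fun A (enorm (N'%:R^-1 *: x))).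
  rewrite ler_expR lerN2; apply: le_assoc; rewrite !enormZ.
  apply: ler_wpM2r; first exact: sqrtr_ge0.
  rewrite !ger0_norm ?invr_ge0// lef_pV2 ?posrE ?ltr0n ?ler_nat//.
  exact: leq_trans NN'.
by apply: ler_wpM2l w; rewrite mulr_ge0 ?cabs_ge0// exprn_ge0.
Qed.

Lemma eset_sbound h (f : Rd -> R[i]^o) : smooth f ->
  (forall N, (1 <= N)%N -> exists C, sbound M h (weightO A N) f C) -> eset M A h f.
Proof. by move=> fs fC N N1; apply/bset_sbound; split=> //; exact: fC. Qed.

Lemma espace_sbound h (f : espace d M A h) N : (1 <= N)%N ->
  exists C, sbound M h (weightO A N) (subsp_val f) C.
Proof. by move=> N1; have /bset_sbound[] := subspW f N N1. Qed.

Lemma espace_smooth h (f : espace d M A h) : smooth (subsp_val f).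
Proof. exact: (subspW f 1%N isT).1. Qed.

Definition onorm h N (N1 : (1 <= N)%N) : espace d M A h -> R :=
  @bnorm R d M h (weightO A N) \o incl (@esub_bsub R d M A h N N1).

Lemma onorm_family h N (N1 : (1 <= N)%N) : seminorms (efamily d M A h) (onorm N1).
Proof. by exists N, N1. Qed.

Lemma onorm_le h N (N1 : (1 <= N)%N) (f : espace d M A h) C :
  sbound M h (weightO A N) (subsp_val f) C -> onorm N1 f <= C.
Proof. exact: (@bnorm_le _ _ _ _ _ (incl (@esub_bsub R d M A h N N1) f)). Qed.

Lemma sbound_onorm h N (N1 : (1 <= N)%N) (f : espace d M A h) :
  sbound M h (weightO A N) (subsp_val f) (onorm N1 f).
Proof. exact: (sbound_bnorm (incl (@esub_bsub R d M A h N N1) f)). Qed.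

(** The weights e^{-A(. / N)} increase with N, so the finitely many norms that dominate a continuous
    seminorm are all dominated by the one with the largest N. *)
Lemma espace_seminorm_bound h (q : espace d M A h -> R) : seminorm q -> continuous q ->
  exists C N, [/\ 0 <= C, (1 <= N)%N & forall (f : espace d M A h) K,
    sbound M h (weightO A N) (subsp_val f) K -> q f <= C * K].
Proof.
move=> qs qc; have [s [C [sQ C0 qC]]] := lcs_seminorm_bound qs qc.
suff [N N1 NP] : exists2 N, (1 <= N)%N & forall (f : espace d M A h) K p, p \in s ->
    sbound M h (weightO A N) (subsp_val f) K -> p f <= K.
  exists (C * (size s)%:R), N; split=> [||f K fK]; [by rewrite mulr_ge0|exact: N1|].
  apply: le_trans (qC f) _; rewrite -mulrA ler_wpM2l//.
  by apply: bigsum_le => p ps; exact: NP.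
elim: s sQ {qC} => [|p s ih] sQ; first by exists 1%N.
have [|N N1 NP] := ih; first by move=> r rs; apply: sQ; rewrite in_cons rs orbT.
have [N' [N'1 pE]] := sQ p (mem_head _ _).
exists (maxn N N'); first by rewrite leq_max N1.
move=> f K r; rewrite in_cons => /orP[/eqP->|rs] fK.
  by rewrite pE; exact: (onorm_le N'1 (sbound_weightO_le N'1 (leq_maxr N N') fK)).
exact: NP rs (sbound_weightO_le N1 (leq_maxl N N') fK).
Qed.

Lemma espace_seminorm_continuous h (q : espace d M A h -> R) C N : (1 <= N)%N ->
  seminorm q -> (forall (f : espace d M A h) K,
    sbound M h (weightO A N) (subsp_val f) K -> q f <= C * K) -> continuous q.
Proof.
move=> N1 qs qC; have pQ := @onorm_family h N N1.
apply: (@seminorm_continuous_le R (espace d M A h) (onorm N1) q C) => //.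
- exact: seminormsP pQ.
- exact: lcs_seminorm_continuous.
- by move=> f; apply: qC; exact: sbound_onorm.
Qed.

Lemma espace_bounded h (B : set (espace d M A h)) :
  (forall N, (1 <= N)%N -> exists C, forall f : espace d M A h, B f ->
     sbound M h (weightO A N) (subsp_val f) C) -> tvs_bounded B.
Proof.
move=> BC; apply: lcs_bounded => _ [N [N1 ->]]; have [C CP] := BC N N1.
by exists C => f Bf; exact: (onorm_le N1 (CP f Bf)).
Qed.

Lemma bounded_espace h (B : set (espace d M A h)) N : (1 <= N)%N -> tvs_bounded B ->
  exists C, forall f : espace d M A h, B f -> sbound M h (weightO A N) (subsp_val f) C.
Proof.
move=> N1 Bb; have pQ := @onorm_family h N N1.
have [C CP] := @tvs_bounded_seminorm R (espace d M A h) B (onorm N1)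
  (seminormsP pQ) (lcs_seminorm_continuous pQ) Bb.
exists C => f Bf; apply: sbound_le (sbound_onorm N1 f).
by apply: CP; exists f.
Qed.

Lemma e_incl_linear h : linear (@e_incl R d M A h).
Proof. exact: incl_linear. Qed.

Lemma ocspace_functional (f : ocspace d M A -> R[i]^o) : linear f ->
  (forall h, exists C N, (1 <= N)%N /\ forall (g : espace d M A h) K,
     sbound M h (weightO A N) (subsp_val g) K -> cabs (f (e_incl g)) <= C * K) ->
  continuous f.
Proof.
move=> fl fC; apply/functional_continuousP => //.
have fs := seminorm_linear fl (@cabs_seminorm R).
apply: lcs_seminorm_continuous; split=> // h; have [C [N [N1 CP]]] := fC h.
have es : @seminorm R (espace d M A h) (fun g => cabs (f (e_incl g))).
  exact: (@seminorm_linear R (espace d M A h) (ocspace d M A) _ _ (@e_incl_linear h) fs).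
exact: (espace_seminorm_continuous N1 es CP).
Qed.

Lemma ocspace_seminorm_bound (q : ocspace d M A -> R) h : seminorm q -> continuous q ->
  exists C N, [/\ 0 <= C, (1 <= N)%N & forall (f : espace d M A h) K,
    sbound M h (weightO A N) (subsp_val f) K -> q (e_incl f) <= C * K].
Proof.
move=> qs qc.
have es : @seminorm R (espace d M A h) (fun f => q (e_incl f)).
  exact: (@seminorm_linear R (espace d M A h) (ocspace d M A) _ _ (@e_incl_linear h) qs).
have ec : continuous (fun f : espace d M A h => q (e_incl f)).
  have ic : continuous (@e_incl R d M A h : espace d M A h -> ocspace d M A).
    exact: (@inductive_continuous _ _ _ _ (@e_incl R d M A) h (@e_incl_linear h)).
  move=> f; exact: (@continuous_comp (espace d M A h) (ocspace d M A) R _ q f (ic f) (qc _)).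
exact: espace_seminorm_bound es ec.
Qed.

Definition s_incl h (f : bspace M h (weightS A h)) : sspace d M A :=
  incl (@bsub_ssub R d M A h) f.

Lemma s_incl_linear h : linear (@s_incl h).
Proof. exact: incl_linear. Qed.

Lemma sspace_seminorm_bound (q : sspace d M A -> R) h : seminorm q -> continuous q ->
  exists2 C : R, 0 <= C & forall (f : bspace M h (weightS A h)) K,
    sbound M h (weightS A h) (subsp_val f) K -> q (s_incl f) <= C * K.
Proof.
move=> qs qc.
have es : @seminorm R (bspace M h (weightS A h)) (fun f => q (s_incl f)).
  exact: (@seminorm_linear R (bspace M h (weightS A h)) (sspace d M A) _ _ (@s_incl_linear h) qs).
have ec : continuous (fun f : bspace M h (weightS A h) => q (s_incl f)).
  have ic : continuous (@s_incl h : bspace M h (weightS A h) -> sspace d M A).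
    exact: (@inductive_continuous _ _ _ _ (@s_incl) h (@s_incl_linear h)).
  move=> f; exact: (@continuous_comp (bspace M h (weightS A h)) (sspace d M A) R _ q f (ic f) (qc _)).
exact: bspace_seminorm_bound es ec.
Qed.

Lemma sspace_seminorm_continuous (q : sspace d M A -> R) : seminorm q ->
  (forall h, exists C, forall (f : bspace M h (weightS A h)) K,
    sbound M h (weightS A h) (subsp_val f) K -> q (s_incl f) <= C * K) ->
  continuous q.
Proof.
move=> qs qC; apply: lcs_seminorm_continuous; split=> // h; have [C CP] := qC h.
have es : @seminorm R (bspace M h (weightS A h)) (fun f => q (s_incl f)).
  exact: (@seminorm_linear R (bspace M h (weightS A h)) (sspace d M A) _ _ (@s_incl_linear h) qs).
exact: (bspace_seminorm_continuous es CP).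
Qed.

Lemma sspace_sbound (f : sspace d M A) : smooth (subsp_val f) /\
  exists h C, sbound M h (weightS A h) (subsp_val f) C.
Proof. by have [h /bset_sbound[fs [C fC]]] := subspW f; split=> //; exists h, C. Qed.

End SpaceBounds.

(** * Weight sequences *)

Section AssociatedFunction.
Variables (R : realType) (M : weight_sequence R).
Implicit Types (t C : R).

Local Notation T t := (expR (assoc_fun M t)).
Local Notation mu := (wquot M).

(** Together with [assoc_le], this identifies e^{M(t)} as the supremum of t^p M_0 / M_p, so that
    estimates need no logarithms. At t = 0 the terms are 1 for p = 0 and 0 otherwise, in agreement
    with M(0) = 0. *)
Lemma assoc_term t p : 0 <= t -> t ^+ p * M 0%N / M p <= T t.
Proof.
have M0 := wseq_gt0 M.
rewrite le_eqVlt => /predU1P[<-|t0].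
  rewrite /assoc_fun ltxx expR0; case: p => [|p].
    by rewrite expr0 mul1r divff// gt_eqF.
  by rewrite exprS !mul0r.
have u0 : 0 < t ^+ p * M 0%N / M p by rewrite divr_gt0// mulr_gt0// exprn_gt0.
rewrite -[leLHS]lnK ?posrE// ler_expR {1}/assoc_fun t0.
by apply: ub_le_sup; [exact: assoc_ubound|exists p].
Qed.

Lemma assoc_le t C : (forall p, t ^+ p * M 0%N / M p <= C) -> T t <= C.
Proof.
have M0 := wseq_gt0 M; move=> tC.
have C1 : 1 <= C by have := tC 0%N; rewrite expr0 mul1r divff// gt_eqF.
rewrite /assoc_fun; case: ifPn => [t0|_]; last by rewrite expR0.
have C0 : 0 < C := lt_le_trans ltr01 C1.
rewrite -[leRHS]lnK ?posrE// ler_expR; apply: ge_sup.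
  by exists (ln (t ^+ 0 * M 0%N / M 0%N)), 0%N.
move=> _ [p _ <-]; rewrite ler_ln ?posrE//.
by rewrite divr_gt0// mulr_gt0// exprn_gt0.
Qed.

Lemma assoc_ge1 t : 1 <= T t.
Proof. by rewrite -expR0 ler_expR assoc_ge0. Qed.

Lemma assoc_exp_le s t : s <= t -> T s <= T t.
Proof. by move=> st; rewrite ler_expR; exact: le_assoc. Qed.

Lemma sqr_le_of (x y : R) : 0 <= x -> 0 <= y -> x ^+ 2 <= y ^+ 2 -> x <= y.
Proof. by move=> x0 y0; rewrite ler_pXn2r ?nnegrE. Qed.

(** (M.2) with p = q bounds the square of the p-th term of the supremum at t by C0 M_0 times the
    2p-th term at H t. In logarithms: 2 M(t) <= M(H t) + log c. *)
Lemma assoc_double : cond_M2 M -> exists c H : R, [/\ 1 <= c, 1 <= H &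
  forall t, 0 <= t -> T t ^+ 2 <= c * T (H * t)].
Proof.
have M0 := wseq_gt0 M; move=> [C0 [H [C01 H1 M2]]].
have H0 : 0 < H := lt_le_trans ltr01 H1.
have C00 : 0 < C0 := lt_le_trans ltr01 C01.
have [c c1 cC] : exists2 c : R, 1 <= c & C0 * M 0%N <= c.
  by exists (Num.max 1 (C0 * M 0%N)); rewrite le_max lexx ?orbT.
have c0 : 0 < c := lt_le_trans ltr01 c1.
exists c, H; split=> [||t t0]; [exact: c1|exact: H1|].
have X0 : 0 <= c * T (H * t) by rewrite mulr_ge0 ?expR_ge0// ltW.
rewrite -[leRHS]sqr_sqrtr// lerXn2r ?nnegrE ?sqrtr_ge0 ?expR_ge0//.
apply: assoc_le => p.
have u0 : 0 <= t ^+ p * M 0%N / M p.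
  by rewrite divr_ge0 ?(ltW (M0 _))// mulr_ge0 ?exprn_ge0// ltW.
apply: (sqr_le_of u0 (sqrtr_ge0 _)).
rewrite sqr_sqrtr//; have Ht0 : 0 <= H * t by rewrite mulr_ge0// ltW.
apply: le_trans (_ : c * ((H * t) ^+ (p + p) * M 0%N / M (p + p)%N) <= _); last first.
  by rewrite ler_wpM2l ?(ltW c0)//; exact: assoc_term.
rewrite [leRHS]mulrA ler_pdivlMr//.
have h : t ^+ (p + p) * M (p + p)%N <= t ^+ (p + p) * (C0 * H ^+ (p + p) * M p * M p).
  by rewrite ler_wpM2l ?exprn_ge0.
have -> : (t ^+ p * M 0%N / M p) ^+ 2 * M (p + p)%N =
    (M 0%N / M p) ^+ 2 * (t ^+ (p + p) * M (p + p)%N).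
  by rewrite -mulrA exprMn -exprM muln2 -addnn; ring.
apply: le_trans (ler_wpM2l _ h) _; first by rewrite sqr_ge0.
have -> : (M 0%N / M p) ^+ 2 * (t ^+ (p + p) * (C0 * H ^+ (p + p) * M p * M p)) =
    C0 * M 0%N * ((H * t) ^+ (p + p) * M 0%N).
  have Mp0 : M p != 0 by rewrite gt_eqF.
  rewrite [(H * t) ^+ _]exprMn; move: (t ^+ _) (H ^+ _) (M 0%N) (M p) Mp0 => u v w z z0.
  by field.
by rewrite ler_wpM2r// mulr_ge0 ?exprn_ge0// ltW.
Qed.

Lemma wquot_gt0 p : 0 < mu p.
Proof. by rewrite divr_gt0// wseq_gt0. Qed.

Lemma wquotS p : M p.+1 = M p * mu p.+1.
Proof. by rewrite /wquot /= mulrC divfK// gt_eqF// wseq_gt0. Qed.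

Lemma wquot_le p q : cond_M1 M -> (1 <= p)%N -> (p <= q)%N -> mu p <= mu q.
Proof.
move=> M1 p1 /subnK <-; elim: (q - p)%N => [//|k ih].
rewrite addSn; apply: le_trans ih _; have := M1 (k + p)%N (leq_trans p1 (leq_addl _ _)).
rewrite /wquot /=; case: (k + p)%N (leq_trans p1 (leq_addl k p)) => // j _ /=.
have M0 := wseq_gt0 M.
rewrite ler_pdivrMr// mulrAC ler_pdivlMr// -expr2 => h.
by rewrite (mulrC (M _)).
Qed.

Lemma wseq_le_pow p : cond_M1 M -> (1 <= p)%N -> M p <= M 0%N * mu p ^+ p.
Proof.
move=> M1 p1.
suff H k : (k <= p)%N -> M k <= M 0%N * mu p ^+ k by exact: H.
elim: k => [|k ih] kp; first by rewrite expr0 mulr1.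
rewrite wquotS exprSr mulrA ler_pM ?(ltW (wquot_gt0 _)) ?(ltW (wseq_gt0 _ _))//.
  by apply: ih; exact: ltnW.
exact: wquot_le.
Qed.

Lemma wseq_add_ge p k : cond_M1 M -> (1 <= p)%N -> M p * mu p ^+ k <= M (p + k)%N.
Proof.
move=> M1 p1; elim: k => [|k ih]; first by rewrite expr0 mulr1 addn0.
rewrite addnS wquotS exprSr mulrA ler_pM//.
- by rewrite mulr_ge0 ?exprn_ge0 ?(ltW (wquot_gt0 _)) ?(ltW (wseq_gt0 _ _)).
- exact: ltW (wquot_gt0 _).
- by apply: wquot_le => //; rewrite leqW// leq_addr.
Qed.

(** By (M.1) the terms t^b / M_b at t = mu_p increase up to b = p and decrease afterwards, so the
    supremum defining e^{M(mu_p)} is attained at index p. *)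
Lemma assoc_wquot p b : cond_M1 M -> (1 <= p)%N -> mu p ^+ b / M b <= mu p ^+ p / M p.
Proof.
move=> M1 p1; have M0 := wseq_gt0 M; have m0 := wquot_gt0 p.
rewrite ler_pdivrMr// mulrAC ler_pdivlMr//.
have [pb|/ltnW bp] := leqP p b.
  rewrite -(subnKC pb) exprD -mulrA ler_wpM2l ?exprn_ge0 ?(ltW m0)// mulrC.
  exact: wseq_add_ge.
have -> : mu p ^+ p = mu p ^+ b * mu p ^+ (p - b) by rewrite -exprD subnKC.
rewrite -mulrA ler_wpM2l ?exprn_ge0 ?(ltW m0)//.
suff H k : (b + k <= p)%N -> M (b + k)%N <= M b * mu p ^+ k.
  by rewrite -{1}(subnKC bp) mulrC; apply: H; rewrite subnKC.
elim: k => [|k ih] kp; first by rewrite expr0 addn0 mulr1.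
rewrite addnS wquotS exprSr mulrA ler_pM ?(ltW (wquot_gt0 _)) ?(ltW (M0 _))//.
  by apply: ih; apply: leq_trans kp; rewrite leq_add2l.
by apply: wquot_le => //; rewrite -addnS.
Qed.

(** The maximal term is the p-th one, and M_p mu_p^p <= M_{2p} <= C0 H^{2p} M_p^2 by (M.1) and
    (M.2). *)
Lemma assoc_wquot_growth : cond_M1 M -> cond_M2 M -> exists c F : R, [/\ 1 <= c, 1 <= F &
  forall p, (1 <= p)%N -> T (mu p) <= c * F ^+ p].
Proof.
have M0 := wseq_gt0 M; move=> M1 [C0 [H [C01 H1 M2]]].
have H0 : 0 < H := lt_le_trans ltr01 H1.
have [c c1 cC] : exists2 c : R, 1 <= c & C0 * M 0%N <= c.
  by exists (Num.max 1 (C0 * M 0%N)); rewrite le_max lexx ?orbT.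
exists c, (H ^+ 2); split=> [||p p1]; [exact: c1|by rewrite exprn_ege1|].
apply: assoc_le => b.
have h := le_trans (wseq_add_ge p M1 p1) (M2 p p).
have {h}h : mu p ^+ p / M p <= C0 * (H ^+ 2) ^+ p.
  rewrite ler_pdivrMr// -(ler_pM2l (M0 p)) (le_trans h)//.
  by rewrite -exprM mul2n -addnn le_eqVlt; apply/orP; left; apply/eqP; ring.
rewrite mulrAC; apply: le_trans (ler_wpM2r (ltW (M0 _)) (assoc_wquot b M1 p1)) _.
apply: le_trans (ler_wpM2r (ltW (M0 _)) h) _.
by rewrite mulrAC ler_wpM2r// exprn_ge0// exprn_ge0// ltW.
Qed.

(** Iterating [assoc_double] j times bounds the 2^j-th power of e^{M(s / H^j)} by a^{2^j} e^{M(s)}.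
    Taking roots replaces the growth rate E by E^{1 / 2^j}, which is at most G for large j. *)
Lemma assoc_shrink (t : nat -> R) (c E G : R) : cond_M2 M -> (forall p, 0 <= t p) ->
  1 <= c -> 1 < G -> (forall p, T (t p) <= c * E ^+ p) -> 0 <= E ->
  exists H c' : R, [/\ 1 <= H, 1 <= c' & forall p, T (t p / H) <= c' * G ^+ p].
Proof.
move=> M2 t0 c1 G1 tE E0; have [a [H [a1 H1 TH]]] := assoc_double M2.
have H0 : 0 < H := lt_le_trans ltr01 H1.
have Hn : H != 0 by rewrite gt_eqF.
have a0 : 0 < a := lt_le_trans ltr01 a1.
have c0 : 0 < c := lt_le_trans ltr01 c1.
have G0 : 0 < G := lt_trans ltr01 G1.
have iter j s : 0 <= s -> T (s / H ^+ j) ^+ (2 ^ j) <= a ^+ (2 ^ j) * T s.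
  move=> s0; elim: j => [|j ih]; first by rewrite expr0 divr1 expn0 !expr1 ler_peMl ?expR_ge0.
  have h : T (s / H ^+ j.+1) ^+ 2 <= a * T (s / H ^+ j).
    have -> : s / H ^+ j = H * (s / H ^+ j.+1).
      by rewrite exprS; field; rewrite ?Hn ?expf_neq0.
    by apply: TH; rewrite divr_ge0// exprn_ge0// ltW.
  rewrite expnS exprM; apply: le_trans (lerXn2r (2 ^ j) _ _ h) _.
  - by rewrite nnegrE exprn_ge0// expR_ge0.
  - by rewrite nnegrE mulr_ge0 ?expR_ge0// ltW.
  - rewrite exprMn mulnC exprM expr2 -mulrA ler_wpM2l//.
    by rewrite exprn_ge0// ltW.
have [j jE] : exists j : nat, E <= G ^+ (2 ^ j).
  have [n nE] : exists n : nat, E <= G ^+ n.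
    have g0 : 0 < G - 1 by rewrite subr_gt0.
    exists (Num.truncn (E / (G - 1))).+1.
    have h n : 1 + (G - 1) *+ n <= G ^+ n.
      elim: n => [|n ih]; first by rewrite mulr0n addr0 expr0.
      rewrite exprS; apply: le_trans (ler_wpM2l (ltW G0) ih).
      have g2 : 0 <= (G - 1) * ((G - 1) *+ n) by rewrite mulr_ge0 ?mulrn_wge0// ltW.
      rewrite mulrSr; move: ((G - 1) *+ n) g2 => z g2; nra.
    apply: le_trans (h _); rewrite -mulr_natl.
    apply: le_trans (_ : (E / (G - 1)) * (G - 1) <= _); first by rewrite divfK// gt_eqF.
    rewrite ler_wpDl// ler_wpM2r ?(ltW g0)//.
    by apply: ltW; rewrite truncnS_gt.
  by exists n; apply: le_trans nE _; rewrite ler_eXn2l// ltnW// ltn_expl.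
exists (H ^+ j), (a * c); split=> [||p].
- exact: exprn_ege1.
- by rewrite mulr_ege1.
have n0 : (0 < 2 ^ j)%N by rewrite expn_gt0.
have X0 : 0 <= a * c * G ^+ p by rewrite mulr_ge0 ?exprn_ge0 ?mulr_ge0// ltW.
rewrite -(ler_pXn2r n0) ?nnegrE ?expR_ge0//.
apply: le_trans (iter j (t p) (t0 p)) _.
rewrite -[a * c * _]mulrA exprMn ler_wpM2l ?exprn_ge0 ?(ltW a0)//.
apply: le_trans (tE p) _; rewrite exprMn -exprM mulnC exprM ler_pM ?exprn_ge0 ?(ltW c0)//.
  by rewrite ler_eXnr.
by apply: lerXn2r => //; rewrite nnegrE ?exprn_ge0// ltW.
Qed.

(** Of the series in (M.3) only the terms with indices from q to p are kept; there are p - q + 1 of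
    them, each at least 1 / mu_p. *)
Lemma wquot_M3 : cond_M1 M -> cond_M3 M -> exists2 C : R, 1 <= C &
  forall p q, (1 <= q)%N -> (q <= p)%N -> mu q * (p - q).+1%:R <= C * q%:R * mu p.
Proof.
move=> M1 [C C1 M3]; exists C => // p q q1 qp.
have m0 := wquot_gt0.
have h : (p - q).+1%:R / mu p <= C * q%:R / mu q.
  rewrite -lee_fin; apply: ltW; apply: le_lt_trans (M3 q q1).
  apply: le_trans (@nneseries_lim_ge R (fun i => (1 / mu i)%:E) xpredT q p.+1 _); last first.
    by move=> n _ _; rewrite lee_fin divr_ge0// ltW.
  rewrite sumEFin lee_fin.
  apply: le_trans (_ : \sum_(q <= i < p.+1) (mu p)^-1 <= _).
    by rewrite sumr_const_nat subSn// mulr_natl.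
  rewrite big_nat_cond [leRHS]big_nat_cond; apply: ler_sum => i /andP[/andP[qi ip] _].
  rewrite mul1r lef_pV2 ?posrE//; apply: wquot_le => //; exact: leq_trans qi.
by move: h; rewrite ler_pdivrMr// mulrAC ler_pdivlMr// mulrC.
Qed.

End AssociatedFunction.

Section PeakParameters.
Variables (R : realType) (M A : weight_sequence R).
Hypotheses (M1 : cond_M1 M) (M2 : cond_M2 M) (M3 : cond_M3 M).
Hypotheses (A1 : cond_M1 A) (A2 : cond_M2 A).
Local Notation mu := (wquot M).
Local Notation a := (wquot A).
Local Notation TM t := (expR (assoc_fun M t)).
Local Notation TA t := (expR (assoc_fun A t)).

(** This is how (M.3) produces the peaks: multiplying the index by a constant L multiplies the
    quotient by as large a factor as desired. It is [wquot_M3] at p = L q. *)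
Lemma wquot_stretch (W : R) : 1 <= W -> exists2 L : nat, (1 <= L)%N &
  forall q, (1 <= q)%N -> W * mu q <= mu (L * q)%N.
Proof.
move=> W1; have [C C1 CP] := wquot_M3 M1 M3.
have C0 : 0 < C := lt_le_trans ltr01 C1.
have [L L1 LP] : exists2 L : nat, (1 <= L)%N & C * W <= L%:R - 1.
  exists (Num.truncn (C * W)).+2 => //.
  by rewrite -[(Num.truncn _).+2%:R]natr1 addrK ltW// truncnS_gt.
exists L => // q q1; have qL : (q <= L * q)%N by rewrite leq_pmull.
have h := CP _ _ q1 qL; have q0 : 0 < q%:R :> R by rewrite ltr0n.
have Cq0 : 0 < C * q%:R by rewrite mulr_gt0.
rewrite -(ler_pM2l Cq0); apply: le_trans h.
rewrite mulrA [leRHS]mulrC ler_wpM2r ?(ltW (wquot_gt0 _ _))//.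
rewrite -natr1 natrB// natrM.
have : C * W * q%:R <= (L%:R - 1) * q%:R by rewrite ler_pM2r.
by move: (L%:R : R) (q%:R : R) => x y; lra.
Qed.

(** The case q = 1 of [wquot_M3]. It allows the order r of a peak to be absorbed into its frequency
    mu_r. *)
Lemma wquot_linear : exists2 C : R, 0 < C & forall p, (1 <= p)%N -> p%:R <= C * mu p.
Proof.
have [C C1 CP] := wquot_M3 M1 M3; have C0 : 0 < C := lt_le_trans ltr01 C1.
have m0 := wquot_gt0 M 1; exists (C / mu 1%N); first by rewrite divr_gt0.
move=> p p1; have := CP p 1%N isT p1; rewrite mulr1 -subSn// subn1 /= => h.
by rewrite mulrAC ler_pdivlMr// mulrC.
Qed.

(* r, xi, s, beta are the order, frequency, step and amplitude of the q-th peak; the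
   choice xi = mu_r, s ~ 1 / a_r makes it bounded with weights in M and A, and by (M.3)
   mu_r with r = L (q + 1) exceeds any given multiple of mu_(q+1), so that the derivative
   of order q + 1 at pi / s is large; c must not depend on m *)
Lemma peak_parameters : exists c : R, forall m, (1 <= m)%N -> exists k K : nat,
  [/\ (1 <= k)%N, (1 <= K)%N & exists (r : nat -> nat) (xi s beta : nat -> R),
  [/\ forall q, [/\ 0 < s q, 0 <= xi q & 0 < beta q],
      forall q b, beta q * ((s q * m%:R) ^+ r q * (A (r q) / A 0%N)) *
        (xi q + (r q)%:R * (s q + A 0%N / A 1%N)) ^+ b <= c * M b,
      forall q b, beta q * k%:R^-1 ^+ b * (xi q + (r q)%:R * s q) ^+ b <= c * M b &
      forall Y, exists q,
        Y * m%:R ^+ q.+1 * M q.+1 * TA (pi / s q / K%:R) < beta q * xi q ^+ q.+1]].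
Proof.
have M0 := wseq_gt0 M; have A0 := wseq_gt0 A.
have m0 := wquot_gt0 M; have a0 := wquot_gt0 A.
have [Cl Cl0 lin] := wquot_linear.
pose al := A 0%N / A 1%N; have al0 : 0 < al by rewrite divr_gt0.
have al1 : al = (a 1%N)^-1 by rewrite /a /= invf_div.
(* [D * mu p] bounds the frequencies mu_p + p (s + al) that occur in the derivatives, since s <= al
   and p = O(mu_p). *)
have [D D1 DP] : exists2 D : R, 1 <= D & forall p, (1 <= p)%N ->
    mu p + p%:R * (al + al) <= D * mu p.
  exists (1 + Cl * (al + al)) => [|p p1]; first by rewrite lerDl mulr_ge0 ?addr_ge0// ltW.
  rewrite mulrDl mul1r lerD2l mulrAC ler_wpM2r ?addr_ge0 ?(ltW al0)//; exact: lin.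
have [LD LD1 LDP] := wquot_stretch D1.
have [c1 [F [c11 F1 FP]]] := assoc_wquot_growth M1 M2.
have [c2 [G [c21 G1 GP]]] := assoc_wquot_growth A1 A2.
have c10 : 0 < c1 := lt_le_trans ltr01 c11.
(* [E] is the exponential rate of e^{M(D mu_p)}; the step s is tuned to it below. *)
have [E [E1 EP]] : exists E : R, 1 <= E /\ forall p, (1 <= p)%N -> TM (D * mu p) <= c1 * E ^+ p.
  exists (F ^+ LD); split=> [|p p1]; first exact: exprn_ege1.
  rewrite -exprM; apply: le_trans (FP _ _); last by rewrite muln_gt0 LD1.
  by apply: assoc_exp_le; exact: LDP.
have E0 : 0 < E := lt_le_trans ltr01 E1.
have D0 : 0 < D := lt_le_trans ltr01 D1.
exists (c1 / M 0%N) => m m1; have mR : 1 <= m%:R :> R by rewrite ler1n.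
have mR0 : 0 < m%:R :> R by rewrite ltr0n.
(* The peaks have to beat m^{q+1}, whence the factor m. Of 16^q = 4^q 4^q, one factor pays for two
   losses of 2^q, from e^{M(D mu_r / k)} and from e^{A(. / K)}; the other is at least q and so
   outgrows the arbitrary constant [Y]. *)
have [|L L1 LP] := @wquot_stretch (16 * m%:R).
  by rewrite mulr_ege1// ler1n.
pose P q := (L * q.+1)%N.
have P1 q : (1 <= P q)%N by rewrite muln_gt0 L1.
(* Division by [HM], respectively [HA], makes e^{M(D mu_r)} and e^{A(a_r)} grow at most like 2^q.
   [k] and [K] are chosen accordingly; [K] contains pi m E because the peak lies at pi / s = pi m E
   a_r. *)
have [|||||HM [c3 [HM1 c31 HMP]]] := @assoc_shrink _ M (fun q => D * mu (P q)) (c1 * E ^+ L) (E ^+ L) 2 M2.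
- by move=> q; rewrite mulr_ge0// ltW.
- by rewrite mulr_ege1// exprn_ege1.
- by rewrite ltr1n.
- by move=> q; apply: le_trans (EP _ (P1 q)) _; rewrite -mulrA -exprS -exprM.
- by rewrite exprn_ge0// ltW.
have [|||||HA [c4 [HA1 c41 HAP]]] := @assoc_shrink _ A (fun q => a (P q)) (c2 * G ^+ L) (G ^+ L) 2 A2.
- by move=> q; rewrite ltW.
- by rewrite mulr_ege1// exprn_ege1.
- by rewrite ltr1n.
- by move=> q; apply: le_trans (GP _ (P1 q)) _; rewrite -mulrA -exprS -exprM.
- by rewrite exprn_ge0// (le_trans ler01).
pose k := (Num.truncn HM).+1; pose K := (Num.truncn (pi * m%:R * E * HA)).+1.
have kP : HM <= k%:R by apply: ltW; rewrite truncnS_gt.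
have KP : pi * m%:R * E * HA <= K%:R by apply: ltW; rewrite truncnS_gt.
clearbody k K.
have k1 : 1 <= k%:R :> R := le_trans HM1 kP.
have pi0 : 0 < pi :> R := pi_gt0 R.
have HA0 : 0 < HA := lt_le_trans ltr01 HA1.
have HM0 : 0 < HM := lt_le_trans ltr01 HM1.
have K0 : 0 < K%:R :> R by apply: lt_le_trans KP; rewrite !mulr_gt0.
have k0 : 0 < k%:R :> R := lt_le_trans ltr01 k1.
have k1n : (1 <= k)%N by rewrite ler1n in k1.
have K1n : (1 <= K)%N by rewrite ltr0n in K0.
exists k, K; split; [exact: k1n|exact: K1n|].
(* Since A_r <= A_0 a_r^r, this s gives (s m)^r A_r / A_0 <= E^-r, which cancels the growth e^{M(D
   mu_r)} <= c1 E^r. The amplitude 1 / e^{M(D mu_r / k)} yields the bound in E_{1/k}. *)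
exists P, (fun q => mu (P q)), (fun q => (m%:R * E * a (P q))^-1),
  (fun q => (TM (D * mu (P q) / k%:R))^-1).
have y0 q : 0 < m%:R * E * a (P q) := mulr_gt0 (mulr_gt0 mR0 E0) (a0 _).
have s0 q : 0 < (m%:R * E * a (P q))^-1 by rewrite invr_gt0.
have sal q : (m%:R * E * a (P q))^-1 <= al.
  have aP : a 1%N <= m%:R * E * a (P q).
    apply: le_trans (wquot_le A1 (leqnn 1) (P1 q)) _.
    by apply: ler_peMl; [exact: ltW|exact: mulr_ege1].
  have h1 : a 1%N \is Num.pos by rewrite posrE; exact: a0.
  have h2 : m%:R * E * a (P q) \is Num.pos by rewrite posrE; exact: y0.
  by rewrite al1 lef_pV2.
have Xi q : 0 <= mu (P q) + (P q)%:R * ((m%:R * E * a (P q))^-1 + al) <= D * mu (P q).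
  apply/andP; split.
    apply: addr_ge0 (ltW (m0 _)) _; apply: mulr_ge0 => //.
    exact: addr_ge0 (ltW (s0 _)) (ltW al0).
  apply: le_trans (DP _ (P1 q)); rewrite lerD2l; apply: ler_wpM2l => //.
  by rewrite lerD2r; exact: sal.
have Xi' q : 0 <= mu (P q) + (P q)%:R * (m%:R * E * a (P q))^-1 <= D * mu (P q).
  apply/andP; split.
    by apply: addr_ge0 (ltW (m0 _)) _; apply: mulr_ge0 => //; exact: (ltW (s0 _)).
  have /andP[_ h] := Xi q; apply: le_trans h; rewrite lerD2l; apply: ler_wpM2l => //.
  by rewrite lerDl; exact: ltW.
have Dm0 q : 0 <= D * mu (P q) := mulr_ge0 (ltW D0) (ltW (m0 _)).
have bterm t b : 0 <= t -> t ^+ b <= TM t * (M b / M 0%N).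
  move=> t0; have := assoc_term M b t0; rewrite -mulrA -invf_div.
  by rewrite ler_pdivrMr// divr_gt0.
have T0 t : 0 < TM t by exact: expR_gt0.
split => [q|q b|q b|Y].
- by split; [exact: s0|exact: ltW|rewrite invr_gt0].
- have sm : ((m%:R * E * a (P q))^-1 * m%:R) ^+ P q * (A (P q) / A 0%N) <= (E ^+ P q)^-1.
    have -> : (m%:R * E * a (P q))^-1 * m%:R = (E * a (P q))^-1.
      by rewrite -mulrA invfM mulrAC mulVf ?mul1r// gt_eqF.
    rewrite exprVn exprMn invfM -[leRHS]mulr1 -mulrA ler_wpM2l ?invr_ge0 ?exprn_ge0 ?(ltW E0)//.
    rewrite ler_pdivrMl ?exprn_gt0// mulr1 ler_pdivrMr// mulrC.
    exact: wseq_le_pow.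
  have /andP[x0 xD] := Xi q.
  have xb : (mu (P q) + (P q)%:R * ((m%:R * E * a (P q))^-1 + al)) ^+ b <=
      c1 * E ^+ P q * (M b / M 0%N).
    apply: le_trans (lerXn2r b _ _ xD) _; rewrite ?nnegrE ?Dm0//.
    apply: le_trans (bterm _ _ _) _; first by rewrite Dm0.
    by rewrite ler_wpM2r ?divr_ge0 ?(ltW (M0 _))//; apply: EP.
  apply: le_trans (_ : (E ^+ P q)^-1 * (c1 * E ^+ P q * (M b / M 0%N)) <= _).
    have X0 : 0 <= ((m%:R * E * a (P q))^-1 * m%:R) ^+ P q * (A (P q) / A 0%N).
      exact: mulr_ge0 (exprn_ge0 _ (mulr_ge0 (ltW (s0 _)) (ltW mR0)))
        (divr_ge0 (ltW (A0 _)) (ltW (A0 _))).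
    have b0 : 0 <= (TM (D * mu (P q) / k%:R))^-1 by rewrite invr_ge0 ltW.
    apply: ler_pM xb; [exact: mulr_ge0 b0 X0|exact: exprn_ge0 x0|].
    apply: le_trans sm; apply: ler_piMl => //.
    by rewrite invf_le1// assoc_ge1.
  have e0 : E ^+ P q != 0 by rewrite expf_neq0// gt_eqF.
  have m00 : M 0%N != 0 by rewrite gt_eqF.
  by move: (E ^+ P q) (M 0%N) e0 m00 => e w e0 w0; rewrite le_eqVlt; apply/orP; left;
    apply/eqP; field; rewrite e0 w0.
- have /andP[x0 xD] := Xi' q.
  rewrite -mulrA -exprMn.
  apply: le_trans (_ : (TM (D * mu (P q) / k%:R))^-1 * (TM (D * mu (P q) / k%:R) * (M b / M 0%N)) <= _).
    rewrite ler_wpM2l ?invr_ge0 ?(ltW (T0 _))//.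
    apply: le_trans (bterm _ _ _); last by rewrite divr_ge0 ?Dm0// ltW.
    have ki0 : 0 <= k%:R^-1 :> R by rewrite invr_ge0 ltW.
    apply: lerXn2r; rewrite ?nnegrE; [exact: mulr_ge0 ki0 x0|exact: mulr_ge0 (Dm0 _) ki0|].
    by rewrite mulrC; exact: ler_wpM2r.
  rewrite mulKf ?gt_eqF// -mulrA [_^-1 * _]mulrC; apply: ler_peMl c11.
  exact: divr_ge0 (ltW (M0 _)) (ltW (M0 _)).
have TMk q : TM (D * mu (P q) / k%:R) <= c3 * 2 ^+ q.
  apply: le_trans (HMP q); apply: assoc_exp_le.
  by rewrite ler_wpM2l ?lef_pV2 ?posrE ?Dm0.
have TAK q : TA (pi / (m%:R * E * a (P q))^-1 / K%:R) <= c4 * 2 ^+ q.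
  apply: le_trans (HAP q); apply: assoc_exp_le.
  rewrite invrK ler_pdivrMr// [leRHS]mulrAC ler_pdivlMr// [leRHS]mulrC.
  apply: le_trans (_ : pi * m%:R * E * HA * a (P q) <= _); last by exact: ler_wpM2r (ltW (a0 _)) _ _ KP.
  by rewrite le_eqVlt; apply/orP; left; apply/eqP; ring.
have c40 : 0 < c4 := lt_le_trans ltr01 c41.
have c30 : 0 < c3 := lt_le_trans ltr01 c31.
have [q qP] : exists q : nat, `|Y| * (M 0%N * c3 * c4) < q%:R.
  by exists (Num.truncn (`|Y| * (M 0%N * c3 * c4))).+1; rewrite truncnS_gt.
exists q; rewrite [ltRHS]mulrC ltr_pdivlMr//.
have low : (16 * m%:R) ^+ q.+1 * (M q.+1 / M 0%N) <= mu (P q) ^+ q.+1.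
  have l0 : 0 <= 16 * m%:R * mu q.+1 := mulr_ge0 (mulr_ge0 (ler0n _ _) (ltW mR0)) (ltW (m0 _)).
  have l1 : (16 * m%:R * mu q.+1) ^+ q.+1 <= mu (P q) ^+ q.+1.
    by apply: lerXn2r (LP q.+1 isT); rewrite nnegrE// ltW.
  apply: le_trans l1; rewrite [in leRHS]exprMn.
  apply: ler_wpM2l; first exact: exprn_ge0 (mulr_ge0 (ler0n _ _) (ltW mR0)).
  by rewrite ler_pdivrMr// mulrC; exact: wseq_le_pow.
apply: lt_le_trans low; rewrite exprMn.
have up : Y * m%:R ^+ q.+1 * M q.+1 * TA (pi / (m%:R * E * a (P q))^-1 / K%:R) *
    TM (D * mu (P q) / k%:R) <= `|Y| * (c4 * 2 ^+ q) * (c3 * 2 ^+ q) * (m%:R ^+ q.+1 * M q.+1).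
  have -> : Y * m%:R ^+ q.+1 * M q.+1 * TA (pi / (m%:R * E * a (P q))^-1 / K%:R) *
    TM (D * mu (P q) / k%:R) = Y * TA (pi / (m%:R * E * a (P q))^-1 / K%:R) *
    TM (D * mu (P q) / k%:R) * (m%:R ^+ q.+1 * M q.+1) by ring.
  have mM : 0 <= m%:R ^+ q.+1 * M q.+1 by rewrite mulr_ge0 ?exprn_ge0 ?(ltW (M0 _)).
  rewrite ler_wpM2r//; apply: le_trans (_ : `|Y| * TA (pi / (m%:R * E * a (P q))^-1 / K%:R) *
    TM (D * mu (P q) / k%:R) <= _).
    by rewrite !ler_wpM2r ?expR_ge0// ler_norm.
  by rewrite ler_pM ?mulr_ge0 ?expR_ge0// ler_wpM2l.
apply: le_lt_trans up _.
have -> : 16 ^+ q.+1 * m%:R ^+ q.+1 * (M q.+1 / M 0%N) =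
   16 ^+ q.+1 / M 0%N * (m%:R ^+ q.+1 * M q.+1) by move: (16 ^+ _) (m%:R ^+ _) (M _) (_^-1) => x y z w; ring.
rewrite ltr_pM2r ?mulr_gt0 ?exprn_gt0// ltr_pdivlMr//.
have -> : `|Y| * (c4 * 2 ^+ q) * (c3 * 2 ^+ q) * M 0%N =
    `|Y| * (M 0%N * c3 * c4) * (2 ^+ q * 2 ^+ q) by ring.
have h4 : 2 ^+ q * 2 ^+ q = 4 ^+ q :> R by rewrite -exprMn -natrM.
have h16 : 16 ^+ q.+1 = 16 * (4 ^+ q * 4 ^+ q) :> R by rewrite exprS -exprMn -natrM.
rewrite h4 h16 mulrA ltr_pM2r ?exprn_gt0//; apply: lt_le_trans qP _.
have : (q <= 4 ^ q)%N by rewrite ltnW// ltn_expl.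
rewrite -(ler_nat R) natrX => h; apply: le_trans h _.
by rewrite ler_peMl ?exprn_ge0// ler1n.
Qed.

End PeakParameters.

(** * A bounded set which is not bounded in any step *)

Section ComplexExponential.
Variable R : realType.
Implicit Types (t u v : R).

Lemma MVT_zero (f df : R -> R) v : (forall t, is_derive t (1 : R) f (df t)) ->
  exists2 c, `|c| <= `|v| & f v - f 0 = df c * v.
Proof.
move=> fd; have fc (a b : R) : {within `[a, b], continuous f}.
  by apply: derivable_within_continuous => t _; case: (fd t).
have [v0|/ltW v0] := leP 0 v.
  have [c + E] := MVT_segment v0 (fun t _ => fd t) (fc _ _).
  rewrite in_itv /= => /andP[c0 cv]; exists c; first by rewrite !ger0_norm.
  by rewrite E subr0.
have [c + E] := MVT_segment v0 (fun t _ => fd t) (fc _ _).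
rewrite in_itv /= => /andP[vc c0]; exists c; first by rewrite !ler0_norm// lerN2.
by rewrite -opprB E sub0r mulrN opprK.
Qed.

Lemma norm_sin_le v : `|sin v| <= `|v|.
Proof.
have [c _] := MVT_zero v (@is_derive_sin R).
rewrite sin0 subr0 => ->; rewrite normrM ler_piMl//.
by rewrite ler_norml cos_geN1 cos_le1.
Qed.

Lemma norm_sin_le1 v : `|sin v| <= 1.
Proof. by rewrite ler_norml sin_geN1 sin_le1. Qed.

Lemma norm_cos1_le v : `|cos v - 1| <= `|v|.
Proof.
have [c _] := MVT_zero v (@is_derive_cos R).
by rewrite cos0 => ->; rewrite normrM normrN ler_piMl// norm_sin_le1.
Qed.

Lemma norm_cos1_le2 v : `|cos v - 1| <= v ^+ 2.
Proof.
have [c cv] := MVT_zero v (@is_derive_cos R).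
rewrite cos0 => ->; rewrite normrM normrN -real_normK ?num_real// expr2 ler_wpM2r//.
exact: le_trans (norm_sin_le c) cv.
Qed.

Lemma norm_sinB_le v : `|sin v - v| <= v ^+ 2.
Proof.
have [c cv] := @MVT_zero (sin - id) (fun t => cos t - 1) v _.
rewrite -[LHS]/((sin v - v) - (sin 0 - 0)) sin0 subrr subr0 => ->.
rewrite normrM -real_normK ?num_real// expr2 ler_wpM2r//.
exact: le_trans (norm_cos1_le c) cv.
Qed.

Definition cexp t : R[i] := Complex (cos t) (sin t).

Lemma cexpD t u : cexp (t + u) = cexp t * cexp u.
Proof. by rewrite /cexp cosD sinD; congr Complex; ring. Qed.

Lemma cabs_cexp t : cabs (cexp t) = 1.
Proof. by rewrite /ComplexField.Normc.normc /= cos2Dsin2 sqrtr1. Qed.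

Lemma cexp_taylor v : cabs (cexp v - 1 - Complex 0 v) <= v ^+ 2 *+ 2.
Proof.
apply: le_trans (cabs_leD _) _; rewrite mulr2n lerD//=.
  by rewrite subr0; exact: norm_cos1_le2.
by rewrite subr0; exact: norm_sinB_le.
Qed.

Lemma cabs_cexp1 v : cabs (1 - cexp v) <= `|v| *+ 2.
Proof.
rewrite cabsBC; apply: le_trans (cabs_leD _) _; rewrite mulr2n lerD//=.
  exact: norm_cos1_le.
by rewrite subr0; exact: norm_sin_le.
Qed.

Lemma cexp_pi t : cexp (t + pi) = - cexp t.
Proof. by rewrite /cexp cosDpi sinDpi. Qed.

End ComplexExponential.

(** * Derivatives of the one-dimensional peaks *)

Section Peaks.
Variables (R : realType) (s : R).
Implicit Types (eta u v : R) (i b : nat).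

Local Notation I := (Complex 0 1 : R[i]).

(* b-th derivative of u |-> ((1 - e^{isu}) / 2)^i e^{i eta u} *)
Fixpoint peak i b eta u : R[i] :=
  if i is j.+1 then (1 / 2)%:C%C * (peak j b eta u - peak j b (eta + s) u)
  else (Complex 0 eta) ^+ b * cexp (eta * u).

Lemma peak_taylor i b eta : exists C : R, forall u v,
  cabs (peak i b eta (u + v) - peak i b eta u - v%:C%C * peak i b.+1 eta u) <= C * v ^+ 2.
Proof.
elim: i eta => [|i ih] eta.
  exists (cabs (Complex 0 eta : R[i]) ^+ b * (eta ^+ 2 *+ 2)) => u v /=.
  have -> : Complex 0 eta ^+ b * cexp (eta * (u + v)) - Complex 0 eta ^+ b * cexp (eta * u) -
      v%:C%C * (Complex 0 eta ^+ b.+1 * cexp (eta * u)) =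
      Complex 0 eta ^+ b * cexp (eta * u) * (cexp (eta * v) - 1 - Complex 0 (eta * v)).
    have -> : Complex 0 (eta * v) = v%:C%C * Complex 0 eta :> R[i].
      by apply/eqP; rewrite eq_complex /= !mul0r mulr0 subr0 addr0 mulrC !eqxx.
    rewrite mulrDr cexpD exprS; move: (Complex 0 eta : R[i]) (cexp _) (cexp _) => w y z; move: (w ^+ b) => x.
    by ring.
  rewrite !cabsM cabs_cexp mulr1 cabsX -mulrA ler_wpM2l ?exprn_ge0 ?cabs_ge0//.
  by apply: le_trans (cexp_taylor _) _; rewrite exprMn mulrnAl.
have [C1 H1] := ih eta; have [C2 H2] := ih (eta + s).
exists (1 / 2 * (C1 + C2)) => u v /=.
have -> : forall a1 a2 b1 b2 c1 c2 w : R[i],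
    (1 / 2)%:C%C * (a1 - a2) - (1 / 2)%:C%C * (b1 - b2) - w * ((1 / 2)%:C%C * (c1 - c2)) =
    (1 / 2)%:C%C * ((a1 - b1 - w * c1) - (a2 - b2 - w * c2)) by move=> *; ring.
rewrite cabsM cabsR ger0_norm// -[leRHS]mulrA; apply: ler_wpM2l => //.
by rewrite mulrDl; apply: le_trans (cabsB _ _) _; exact: lerD.
Qed.

Hypothesis s0 : 0 <= s.

(** Unfolding the recursion gives 2^i exponentials with coefficients of modulus 2^-i and frequencies
    between eta and eta + i s. *)
Lemma peak_le i b eta u : 0 <= eta -> cabs (peak i b eta u) <= (eta + i%:R * s) ^+ b.
Proof.
elim: i eta => [|i ih] eta eta0 /=.
  rewrite cabsM cabs_cexp mulr1 cabsX mul0r addr0.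
  have -> // : cabs (Complex 0 eta : R[i]) = eta.
  by rewrite /ComplexField.Normc.normc expr0n add0r sqrtr_sqr ger0_norm.
rewrite cabsM cabsR ger0_norm//.
have h1 : cabs (peak i b eta u) <= (eta + i.+1%:R * s) ^+ b.
  apply: le_trans (ih _ eta0) _; apply: lerXn2r; rewrite ?nnegrE ?addr_ge0 ?mulr_ge0//.
  by rewrite lerD2l ler_wpM2r// ler_nat.
have h2 : cabs (peak i b (eta + s) u) <= (eta + i.+1%:R * s) ^+ b.
  have -> : eta + i.+1%:R * s = eta + s + i%:R * s by rewrite -natr1; ring.
  by apply: ih; rewrite addr_ge0.
have h3 := cabsB (peak i b eta u) (peak i b (eta + s) u).
by lra.
Qed.

(** At pi / s, raising the frequency by s changes the sign of the exponential, so the differences in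
    the recursion become sums of terms with a common phase and nothing cancels. *)
Lemma peak_top i b eta : 0 < s -> 0 <= eta -> exists2 rho : R, eta ^+ b <= rho &
  peak i b eta (pi / s) = I ^+ b * cexp (eta * (pi / s)) * rho%:C%C.
Proof.
move=> s_gt0; have sn0 : s != 0 by rewrite gt_eqF.
elim: i eta => [|i ih] eta eta0 /=.
  exists (eta ^+ b) => //; have -> : Complex 0 eta = I * eta%:C%C.
    by apply/eqP; rewrite eq_complex /=; apply/andP; split; apply/eqP; ring.
  by rewrite exprMn -rmorphXn /= mulrAC.
have [r1 r1P ->] := ih _ eta0; have [|r2 r2P ->] := ih (eta + s); first exact: addr_ge0.
exists (1 / 2 * (r1 + r2)).
  have h : eta ^+ b <= r2.
    by apply: le_trans r2P; apply: lerXn2r; rewrite ?nnegrE ?addr_ge0// lerDl.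
  by lra.
have -> : (eta + s) * (pi / s) = eta * (pi / s) + pi by rewrite mulrDl; field.
rewrite cexp_pi [in RHS]rmorphM [in RHS]rmorphD /=.
by move: (I ^+ b) (cexp _) => x y; ring.
Qed.

Lemma peak0 i eta u :
  peak i 0 eta u = ((1 / 2)%:C%C * (1 - cexp (s * u))) ^+ i * cexp (eta * u).
Proof.
elim: i eta => [|i ih] eta /=; first by rewrite !expr0.
by rewrite !ih mulrDl cexpD exprS; ring.
Qed.

(** The product rule. The recursion that defines [peak] hides the zero of order [i] at the origin;
    this one keeps track of it, since a derivative lowers the order by at most one. For [i] = 0 the
    vanishing coefficient makes the value of [i.-1] irrelevant. *)
Lemma peakS i b eta u : peak i b.+1 eta u =
  Complex 0 eta * peak i b eta u -
  (1 / 2)%:C%C * (i%:R * (Complex 0 s * peak i.-1 b (eta + s) u)).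
Proof.
have IR (x y : R) : Complex 0 (x + y) = Complex 0 x + Complex 0 y :> R[i].
  by apply/eqP; rewrite eq_complex /= addr0 !eqxx.
elim: i eta => [|i ih] eta; first by rewrite /= mul0r mulr0 subr0 exprS mulrA.
rewrite [LHS]/= !ih IR; case: i ih => [|i] _ /=; first by ring.
rewrite -!natr1; ring.
Qed.

Lemma cabs_iR (t : R) : 0 <= t -> cabs (Complex 0 t : R[i]) = t.
Proof.
by move=> t0; rewrite /ComplexField.Normc.normc expr0n add0r sqrtr_sqr ger0_norm.
Qed.

(** [W] stands for e^{A(u / m)}. The factor with the zero of order i is at most (s |u|)^i. A
    derivative that lowers the order costs i s, and s (s m)^{i-1} A_{i-1} <= al (s m)^i A_i with al
    = A_0 / A_1, by (M.1) and m >= 1; hence the contribution i al to the frequency. *)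
Lemma peak_weighted (A : weight_sequence R) (m : nat) (W u : R) i b eta :
  cond_M1 A -> (1 <= m)%N -> (forall j, `|u| ^+ j <= W * (m%:R ^+ j * (A j / A 0%N))) ->
  0 <= eta ->
  cabs (peak i b eta u) <= W * ((s * m%:R) ^+ i * (A i / A 0%N)) *
    (eta + i%:R * (s + A 0%N / A 1%N)) ^+ b.
Proof.
move=> A1 m1 Wu; have A0 := wseq_gt0 A.
have W0 : 0 <= W by have := Wu 0%N; rewrite !expr0 mul1r divff ?gt_eqF// mulr1; lra.
have [al al0 alE] : exists2 al : R, 0 < al & A 0%N / A 1%N = al.
  by exists (A 0%N / A 1%N); rewrite ?divr_gt0.
have alP j : A j <= al * A j.+1.
  have := wquot_le A1 (leqnn 1) (isT : (1 <= j.+1)%N).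
  rewrite /wquot /= -alE ler_pdivlMr// mulrAC ler_pdivrMr// => h.
  by rewrite mulrAC ler_pdivlMr// mulrC (mulrC (A 0%N)).
rewrite alE; have mR : 1 <= m%:R :> R by rewrite ler1n.
elim: b i eta => [|b ih] i eta eta0.
  rewrite peak0 cabsM cabs_cexp mulr1 expr0 mulr1 cabsX.
  apply: (@le_trans _ _ ((s * `|u|) ^+ i)).
    apply: lerXn2r; rewrite ?nnegrE ?cabs_ge0 ?mulr_ge0//.
    rewrite cabsM cabsR ger0_norm//.
    by have h := cabs_cexp1 (s * u); rewrite normrM (ger0_norm s0) in h; lra.
  rewrite !exprMn [leRHS](_ : _ = s ^+ i * (W * (m%:R ^+ i * (A i / A 0%N)))); last by ring.
  by rewrite ler_wpM2l// exprn_ge0.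
have X0 j t : 0 <= t -> 0 <= t + j%:R * (s + al).
  by move=> t0; rewrite addr_ge0 ?mulr_ge0 ?addr_ge0 ?(ltW al0).
have Z0 j : 0 <= W * ((s * m%:R) ^+ j * (A j / A 0%N)).
  exact: mulr_ge0 W0 (mulr_ge0 (exprn_ge0 _ (mulr_ge0 s0 (ler0n _ _)))
    (divr_ge0 (ltW (A0 _)) (ltW (A0 _)))).
rewrite peakS; apply: le_trans (cabsB _ _) _.
rewrite !cabsM cabs_iR// cabs_iR// cabsR ger0_norm// -(rmorph_nat (@real_complex R)) cabsR ger0_norm//.
have h1 := ih i eta eta0.
have second : i%:R * (s * cabs (peak i.-1 b (eta + s) u)) <=
    i%:R * al * (W * ((s * m%:R) ^+ i * (A i / A 0%N)) * (eta + i%:R * (s + al)) ^+ b).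
  case: i h1 => [|j] _; first by rewrite !mul0r.
  rewrite -mulrA ler_wpM2l//=; have es : 0 <= eta + s by rewrite addr_ge0.
  apply: le_trans (ler_wpM2l s0 (ih j (eta + s) es)) _.
  have XX : (eta + s + j%:R * (s + al)) ^+ b <= (eta + j.+1%:R * (s + al)) ^+ b.
    apply: lerXn2r; rewrite ?nnegrE ?X0//.
    by rewrite -natr1; lra.
  have ZZ : s * (W * ((s * m%:R) ^+ j * (A j / A 0%N))) <= al * (W * ((s * m%:R) ^+ j.+1 * (A j.+1 / A 0%N))).
    have -> : s * (W * ((s * m%:R) ^+ j * (A j / A 0%N))) = W * s * (s * m%:R) ^+ j / A 0%N * A j by ring.
    have -> : al * (W * ((s * m%:R) ^+ j.+1 * (A j.+1 / A 0%N))) =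
        W * s * (s * m%:R) ^+ j / A 0%N * (m%:R * (al * A j.+1)) by rewrite exprS; ring.
    apply: ler_wpM2l; first by rewrite !mulr_ge0 ?exprn_ge0 ?mulr_ge0 ?invr_ge0 ?(ltW (A0 _)).
    apply: le_trans (alP j) _; apply: ler_peMl mR.
    by rewrite mulr_ge0 ?(ltW al0) ?(ltW (A0 _)).
  rewrite [leLHS]mulrA [leRHS]mulrA; apply: (ler_pM _ _ ZZ XX).
  - exact: mulr_ge0 s0 (Z0 _).
  - by rewrite exprn_ge0 ?X0.
have Y0 : 0 <= W * ((s * m%:R) ^+ i * (A i / A 0%N)) * (eta + i%:R * (s + al)) ^+ b.
  by rewrite mulr_ge0 ?exprn_ge0 ?X0.
rewrite exprSr [leRHS]mulrA; move: (W * _ * _ ^+ b) h1 second Y0 => Y h1 second Y0.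
have i0 : 0 <= i%:R :> R by [].
have h3 := ler_wpM2l eta0 h1.
have is0 : 0 <= i%:R * s * Y by rewrite !mulr_ge0.
have ia0 : 0 <= i%:R * al * Y by rewrite !mulr_ge0// ltW.
have -> : Y * (eta + i%:R * (s + al)) = eta * Y + i%:R * s * Y + i%:R * al * Y by ring.
by lra.
Qed.

End Peaks.

Section PeakFunctions.
Variables (R : realType) (d : nat) (k0 : 'I_d).
Local Notation Rd := 'rV[R]_d.

Lemma enorm_ge0 (x : Rd) : 0 <= enorm x.
Proof. exact: sqrtr_ge0. Qed.

Lemma coord_le_enorm (x : Rd) k : `|x 0 k| <= enorm x.
Proof.
rewrite -sqrtr_sqr /enorm ler_wsqrtr// (bigD1 k)//= lerDl.
by apply: sumr_ge0 => j _; exact: sqr_ge0.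
Qed.

Lemma enorm_delta (t : R) : 0 <= t -> enorm (t *: 'e_k0 : Rd) = t.
Proof.
move=> t0; rewrite /enorm (bigD1 k0)//= big1 => [|j jk]; last first.
  by rewrite !mxE (negbTE jk) andbF mulr0 expr0n.
by rewrite !mxE !eqxx mulr1 addr0 sqrtr_sqr ger0_norm.
Qed.

Lemma enormV_scale (n : nat) (x : Rd) : enorm (n%:R^-1 *: x) = n%:R^-1 * enorm x.
Proof. by rewrite enormZ ger0_norm// invr_ge0. Qed.

(** The peaks depend on the coordinate [k0] alone, so derivatives in any other direction vanish. *)
Definition peak_jet (s : R) i eta (t : seq 'I_d) : Rd -> R[i]^o :=
  fun y => if all (pred1 k0) t then peak s i (size t) eta (y 0 k0) else 0.

Lemma peak_jetP s i eta : jet (peak_jet s i eta).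
Proof.
move=> t x; have [C CP] := peak_taylor s i (size t) eta; exists `|C| => v _.
rewrite /remainder /peak_jet; have [tk|tk] := boolP (all _ t); last first.
  rewrite subrr sub0r cabsN big1 => [|k _].
    by rewrite cabs0 mulr_ge0// exprn_ge0.
  by rewrite /= (negbTE tk) andbF mulr0.
rewrite (bigD1 k0)//= eqxx tk /= big1 => [|k kk]; last by rewrite (negbTE kk) mulr0.
rewrite addr0 mxE; apply: le_trans (CP _ _) _.
apply: (@le_trans _ _ (`|C| * (v 0 k0) ^+ 2)).
  by rewrite ler_wpM2r ?sqr_ge0 ?ler_norm.
rewrite ler_wpM2l// -real_normK ?num_real// lerXn2r ?nnegrE//.
exact: norm_coord.
Qed.

Variables (M A : weight_sequence R).
Hypotheses (M1 : cond_M1 M) (M2 : cond_M2 M) (M3 : cond_M3 M).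
Hypotheses (A1 : cond_M1 A) (A2 : cond_M2 A).

(** The four clauses give membership in E_1, the weighted bound uniform in m, boundedness in
    E_{1/k}, and unboundedness in E_{1/m}. *)
Lemma peak_family : exists c : R, 0 <= c /\ forall m, (1 <= m)%N -> exists k K : nat,
  [/\ (1 <= k)%N, (1 <= K)%N & exists psi : nat -> Rd -> R[i]^o,
  [/\ forall q, smooth (psi q) /\ exists C, forall t y,
        cabs (partials t (psi q) y) <= C * M (size t),
      forall q t y, cabs (partials t (psi q) y) <=
        c * M (size t) * expR (assoc_fun A (enorm (m%:R^-1 *: y))),
      forall q t y, k%:R^-1 ^+ size t * cabs (partials t (psi q) y) <= c * M (size t) &
      forall Y, exists q t y, Y * m%:R ^+ size t * M (size t) *
        expR (assoc_fun A (enorm (K%:R^-1 *: y))) < cabs (partials t (psi q) y)]].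
Proof.
have M0 := wseq_gt0 M; have A0 := wseq_gt0 A.
have [c cP] := peak_parameters M1 M2 M3 A1 A2.
exists `|c|; split=> // m m1; have [k [K [k1 K1 [r [xi [s [beta [sx weighted unweighted peaks]]]]]]]] := cP m m1.
exists k, K; split=> //.
pose psi q : Rd -> R[i]^o := (beta q)%:C%C *: peak_jet (s q) (r q) (xi q) [::].
have cM b : c * M b <= `|c| * M b by rewrite ler_wpM2r ?ler_norm// ltW.
have sm q : smooth (psi q).
  rewrite /psi -[_ *: _]addr0; apply: smoothP; last exact: smooth0.
  exact/smooth_jet/peak_jetP.
have pE q t y : partials t (psi q) y = (beta q)%:C%C * peak_jet (s q) (r q) (xi q) t y.
  rewrite /psi -[_ *: _]addr0 partialsP; last 2 first.
  - exact/smooth_jet/peak_jetP.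
  - exact: smooth0.
  by rewrite partials0 addr0 partials_jet//; exact: peak_jetP.
have cpE q t y : cabs (partials t (psi q) y) = beta q * cabs (peak_jet (s q) (r q) (xi q) t y).
  have [_ _ b0] := sx q.
  by rewrite pE cabsM cabsR ger0_norm// ltW.
have jet_le q t (y : Rd) (B : R) : 0 <= B -> cabs (peak (s q) (r q) (size t) (xi q) (y 0 k0)) <= B ->
    cabs (peak_jet (s q) (r q) (xi q) t y) <= B.
  by move=> B0 H; rewrite /peak_jet; case: ifP; rewrite ?cabs0.
have Xr0 q : 0 <= xi q + (r q)%:R * s q.
  by have [s0 x0 _] := sx q; rewrite addr_ge0// mulr_ge0// ltW.
have glob q t y : cabs (peak_jet (s q) (r q) (xi q) t y) <= (xi q + (r q)%:R * s q) ^+ size t.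
  have [s0 x0 _] := sx q; apply: jet_le; first exact: exprn_ge0.
  by apply: peak_le => //; exact: ltW.
exists psi; split.
- move=> q; split=> //; have [s0 x0 b0] := sx q.
  exists (beta q * (expR (assoc_fun M (xi q + (r q)%:R * s q)) / M 0%N)) => t y.
  rewrite cpE -mulrA ler_wpM2l ?(ltW b0)//; apply: le_trans (glob q t y) _.
  have := assoc_term M (size t) (Xr0 q); rewrite ler_pdivrMr// => h.
  by rewrite mulrAC ler_pdivlMr.
- move=> q t y; have [s0 x0 b0] := sx q.
  set W := expR _; have W0 : 0 <= W by exact: expR_ge0.
  apply: (@le_trans _ _ (c * M (size t) * W)); last by rewrite ler_wpM2r.
  apply: le_trans (ler_wpM2r W0 (weighted q (size t))); rewrite cpE -!mulrA ler_wpM2l ?(ltW b0)//.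
  have X0 : 0 <= (s q * m%:R) ^+ r q * (A (r q) / A 0%N) *
      (xi q + (r q)%:R * (s q + A 0%N / A 1%N)) ^+ size t * W.
    rewrite !mulr_ge0 ?exprn_ge0 ?addr_ge0 ?mulr_ge0 ?invr_ge0 ?addr_ge0 ?divr_ge0//; exact: ltW.
  rewrite !mulrA -mulrA in X0 *.
  apply: jet_le; first by move: X0; rewrite !mulrA.
  apply: le_trans (@peak_weighted R (s q) (ltW s0) A m W (y 0 k0) _ _ _ A1 m1 _ x0) _.
    move=> j; have y0 : 0 <= enorm (m%:R^-1 *: y) := enorm_ge0 _.
    have mR : 0 < m%:R :> R by rewrite ltr0n.
    have := assoc_term A j y0; rewrite -/W -mulrA -invf_div ler_pdivrMr ?divr_gt0// => h.
    rewrite mulrCA -ler_pdivrMl ?exprn_gt0//; apply: le_trans h.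
    rewrite -exprVn -exprMn; apply: lerXn2r; rewrite ?nnegrE ?mulr_ge0 ?invr_ge0//.
    by rewrite enormV_scale ler_wpM2l ?invr_ge0// coord_le_enorm.
  by rewrite le_eqVlt; apply/orP; left; apply/eqP; ring.
- move=> q t y; have [s0 x0 b0] := sx q.
  apply: le_trans (cM _); apply: le_trans (unweighted q (size t)).
  rewrite cpE mulrCA -mulrA ler_wpM2l ?(ltW b0)// ler_wpM2l// ?exprn_ge0 ?invr_ge0//.
- move=> Y; have [q qP] := peaks Y; have [s0 x0 b0] := sx q.
  exists q, (nseq q.+1 k0), ((pi / s q) *: 'e_k0).
  have ps0 : 0 <= pi / s q by rewrite divr_ge0 ?pi_ge0// ltW.
  rewrite size_nseq enormV_scale enorm_delta// [_^-1 * _]mulrC cpE.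
  apply: lt_le_trans qP _; rewrite ler_wpM2l ?(ltW b0)//.
  have an : all (pred1 k0) (nseq q.+1 k0) by rewrite all_nseq /= eqxx.
  rewrite /peak_jet an size_nseq !mxE !eqxx mulr1.
  have [rho rhoP ->] := peak_top (ltW s0) (r q) q.+1 s0 x0.
  rewrite !cabsM cabs_cexp cabsX cabs_iR// expr1n !mul1r cabsR.
  exact: le_trans rhoP (ler_norm _).
Qed.

(* a bounded subset of the inductive limit which is not bounded in any step *)
Lemma irregular_set : exists B : set (ocspace d M A),
  (forall q : ocspace d M A -> R, seminorm q -> continuous q ->
     exists C, forall f, B f -> q f <= C) /\
  (forall m : nat, (1 <= m)%N -> exists2 K : nat, (1 <= K)%N & forall Y : R,
     exists f t y, B f /\ Y * m%:R ^+ size t * M (size t) *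
       expR (assoc_fun A (enorm (K%:R^-1 *: y))) < cabs (partials t (subsp_val f) y)).
Proof.
have M0 := wseq_gt0 M; have [c [c0 cP]] := peak_family.
(* The choice is indexed by all naturals, so index m belongs to the parameter m + 1. The components
   [p.1.1], [p.1.2] and [p.2] are k, K and psi. *)
have /choice[p pP] : forall m : nat, exists p : nat * nat * (nat -> Rd -> R[i]^o),
    [/\ (1 <= p.1.1)%N, (1 <= p.1.2)%N &
  [/\ forall q, smooth (p.2 q) /\ exists C, forall t y,
        cabs (partials t (p.2 q) y) <= C * M (size t),
      forall q t y, cabs (partials t (p.2 q) y) <=
        c * M (size t) * expR (assoc_fun A (enorm (m.+1%:R^-1 *: y))),
      forall q t y, p.1.1%:R^-1 ^+ size t * cabs (partials t (p.2 q) y) <= c * M (size t) &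
      forall Y, exists q t y, Y * m.+1%:R ^+ size t * M (size t) *
        expR (assoc_fun A (enorm (p.1.2%:R^-1 *: y))) < cabs (partials t (p.2 q) y)]].
  move=> m; have [k [K [k1 K1 [psi psiP]]]] := cP m.+1 isT.
  by exists (k, K, psi).
have wO N (y : Rd) : 0 < expR (- assoc_fun A (enorm (N%:R^-1 *: y))) <= 1.
  by rewrite expR_gt0 -expR0 ler_expR lerNl oppr0 assoc_ge0.
have in1 m q : eset M A 1%:pos ((p m).2 q).
  have [_ _ [/(_ q)[sm [C CP]] _ _ _]] := pP m.
  apply: eset_sbound => // N N1; exists C => t y; rewrite expr1n mul1r.
  have /andP[w0 w1] := wO N y; apply: le_trans (CP t y).
  by apply: ler_piMr => //; exact: cabs_ge0.
pose B : set (ocspace d M A) := [set f | exists m q, subsp_val f = (p m).2 q].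
exists B; split; last first.
  move=> [//|m] _; have [_ K1 [_ _ _ low]] := pP m; exists (p m).1.2 => // Y.
  have [q [t [y h]]] := low Y.
  have fh : ocset M A ((p m).2 q) by exists 1%:pos; exact: in1.
  by exists (@mksub _ _ (ocsub d M A) _ fh), t, y; split=> //; exists m, q.
move=> n ns nc.
have [C1 [N1 [C10 N11 C1P]]] := ocspace_seminorm_bound 1%:pos ns nc.
have large m q (f : ocspace d M A) : (N1 <= m.+1)%N -> subsp_val f = (p m).2 q -> n f <= C1 * c.
  move=> Nm fE; have -> : f = e_incl (@mksub _ _ (esub d M A 1%:pos) _ (in1 m q)) by apply: val_inj.
  apply: C1P; apply: sbound_weightO_le N11 Nm _ => t y /=.
  have [_ _ [_ + _ _]] := pP m => /(_ q t y) h; rewrite expr1n mul1r.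
  have /andP[w0 _] := wO m.+1 y.
  by rewrite expRN ler_pdivrMr ?expR_gt0.
have /choice[C2 C2P] : forall m, exists C, forall q (f : ocspace d M A), subsp_val f = (p m).2 q -> n f <= C.
  move=> m; have [k1 _ [_ _ unweighted _]] := pP m.
  have k0' : 0 < (p m).1.1%:R^-1 :> R by rewrite invr_gt0 ltr0n.
  have [C [N [C0 N0 CP]]] := ocspace_seminorm_bound (PosNum k0') ns nc.
  exists (C * c) => q f fE.
  have sb N' : sbound M (PosNum k0') (weightO A N') ((p m).2 q) c.
    move=> t y /=; have /andP[w0 w1] := wO N' y; apply: le_trans (unweighted q t y).
    apply: ler_piMr => //; apply: mulr_ge0; [exact: exprn_ge0 (ltW k0')|exact: cabs_ge0].
  have fh : eset M A (PosNum k0') ((p m).2 q).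
    apply: eset_sbound => [|N' _]; last by exists c; exact: sb.
    exact: (in1 m q 1%N isT).1.
  have -> : f = e_incl (@mksub _ _ (esub d M A (PosNum k0')) _ fh) by apply: val_inj.
  by apply: CP; exact: sb.
exists (C1 * c + \sum_(m < N1) `|C2 m|) => f [m [q fE]].
have S0 : 0 <= \sum_(m < N1) `|C2 m| by apply: sumr_ge0.
have [Nm|mN] := leqP N1 m.
  by apply: le_trans (large m q f (leqW Nm) fE) _; rewrite lerDl.
apply: le_trans (C2P m q f fE) _; apply: ler_wpDl; first exact: mulr_ge0.
rewrite (bigD1 (Ordinal mN))//=; apply: le_trans (ler_norm _) _; rewrite lerDl.
exact: sumr_ge0.
Qed.

End PeakFunctions.

(** * Uniform boundedness on Banach disks *)

Section UniformBoundedness.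
Variables (R : realType) (E : tvsType R[i]) (D : set E).
Hypothesis Dd : banach_disk D.

Lemma disk_absconv (a b : R) x y : `|a| + `|b| <= 1 -> D x -> D y ->
  D (a%:C%C *: x + b%:C%C *: y).
Proof. by have [_ Da _ _ _] := Dd => ab; apply: Da; rewrite !cabsR. Qed.

Lemma disk0 : D 0.
Proof.
have [[x Dx] _ _ _ _] := Dd.
have := @disk_absconv 0 0 x x; rewrite !scale0r addr0 normr0 addr0.
by apply.
Qed.

Lemma disk_opp x : D x -> D (- x).
Proof.
move=> Dx; have := @disk_absconv (-1) 0 x x; rewrite scale0r addr0.
by rewrite rmorphN1 scaleN1r normrN1 normr0 addr0; apply.
Qed.

Lemma gauge_le (t : R) x : 0 < t -> D x -> minkowski_gauge D (t%:C%C *: x) <= t.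
Proof.
move=> t0 Dx; apply: ge_inf; last by split=> //; exists x.
by exists 0 => s /= [s0 _]; exact: ltW.
Qed.

Lemma gauge_lt (t : R) x : disk_span D x -> minkowski_gauge D x < t ->
  exists2 s : R, 0 < s < t & exists2 y, D y & x = s%:C%C *: y.
Proof.
move=> [u u0 [y Dy xE]] xt.
have [|s [s0 sy] st] := inf_lt _ xt; first by exists u; split=> //; exists y.
by exists s => //; rewrite s0.
Qed.

Lemma seminorm_gauge (p : E -> R) (N t : R) x : seminorm p -> (forall y, D y -> p y <= N) ->
  disk_span D x -> minkowski_gauge D x < t -> p x <= t * N.
Proof.
move=> ps pN Dx xt; have [s /andP[s0 st] [y Dy ->]] := gauge_lt Dx xt.
have N0 : 0 <= N := le_trans (seminorm_ge0 0 ps) (pN _ disk0).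
rewrite seminormZr ?(ltW s0)//; apply: le_trans (ler_wpM2l (ltW s0) (pN _ Dy)) _.
by rewrite ler_wpM2r// ltW.
Qed.

Lemma expr_lower (n : nat) : 1 + (n%:R / 3) <= (4 / 3) ^+ n :> R.
Proof.
elim: n => [|n ih]; first by rewrite expr0 mul0r addr0.
rewrite exprS -natr1; have n0 : 0 <= n%:R :> R by [].
by move: (_ ^+ n) (n%:R) ih n0 => x y; lra.
Qed.

Lemma expr_small (e : R) : 0 < e -> exists n : nat, 3^-1 ^+ n < e.
Proof.
move=> e0; exists (Num.truncn e^-1).+1.
have h : e^-1 < (Num.truncn e^-1).+1%:R by rewrite truncnS_gt.
rewrite exprVn invf_plt ?posrE ?exprn_gt0//; apply: lt_le_trans h _.
by rewrite -natrX ler_nat ltnW// ltn_expl.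
Qed.

(* gliding hump: a sum of small multiples of elements of the disk on which a
   sequence of seminorms with rapidly growing bounds is unbounded *)
Lemma banach_disk_uniform_bound (P : set (E -> R)) :
  (forall p, P p -> seminorm p /\ continuous p) ->
  (forall x, exists C, forall p, P p -> p x <= C) ->
  exists C, forall p x, P p -> D x -> p x <= C.
Proof.
have [_ _ Db _ Dcomplete] := Dd; move=> Pc Px; apply: contrapT => unb.
(* 4^n outgrows the coefficients 3^-n of the series below, so that [N n * t n] tends to infinity. *)
have /choice[p pP] : forall n : nat, exists p, P p /\ exists2 x, D x & 4 ^+ n < p x.
  move=> n; apply: contrapT => h; apply: unb; exists (4 ^+ n) => p x pp Dx.
  by rewrite leNgt; apply/negP => lt; apply: h; exists p; split=> //; exists x.
pose N n := sup (p n @` D).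
have ub n : has_ubound (p n @` D).
  by have [/Pc[ps pc] _] := pP n; exact: tvs_bounded_seminorm ps pc Db.
have pN n y : D y -> p n y <= N n by move=> Dy; apply: ub_le_sup => //; exists y.
have N4 n : 4 ^+ n <= N n.
  by have [_ [x Dx h]] := pP n; apply: ltW (lt_le_trans h _); exact: pN.
have N0 n : 0 < N n by apply: lt_le_trans (N4 n); rewrite exprn_gt0.
have ps n : seminorm (p n) by have [/Pc[]] := pP n.
pose t n : R := 3^-1 ^+ n.
have t0 n : 0 < t n by rewrite exprn_gt0.
(* If f nearly attains the supremum of p_n on D, one of f and -f works: by the triangle inequality
   p_n(y + t f) + p_n(y - t f) >= 2 t p_n(f). *)
have /choice[F FP] : forall ny : nat * E, exists w, D w /\
    t ny.1 * (2 / 3 * N ny.1) <= p ny.1 (ny.2 + (t ny.1)%:C%C *: w).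
  move=> [n y] /=; have Nn := N0 n.
  have hs : has_sup (p n @` D).
    by split; [exists (p n 0); exists 0; [exact: disk0|]|exact: ub].
  have N3 : 0 < N n / 3 by rewrite divr_gt0.
  have [_ [f Df <-] fN] := sup_adherent N3 hs.
  have {}fN : 2 / 3 * N n <= p n f by move: fN; rewrite -/(N n); lra.
  have h : t n * (2 / 3 * N n) <= t n * p n f by rewrite ler_wpM2l// ltW.
  have [g|g] := leP (t n * (2 / 3 * N n)) (p n (y + (t n)%:C%C *: f)).
    by exists f.
  exists (- f); split; first exact: disk_opp.
  rewrite leNgt; apply/negP => g'; rewrite scalerN in g'.
  have := (ps n).1 (y + (t n)%:C%C *: f) (- (y + (t n)%:C%C *: - f)).
  rewrite (seminormN _ (ps n)) scalerN opprD opprK addrACA subrr add0r -scalerDl -rmorphD /=.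
  rewrite seminormZr// ?addr_ge0 ?(ltW (t0 _))// mulrDl; lra.
pose y := fix y n : E := if n is k.+1 then y k + (t k)%:C%C *: F (k, y k) else 0.
(* The tail of the geometric series: t_n F + (3/2) t_{n+1} z = (3/2) t_n ((2/3) F + (1/3) z), and D
   is convex. *)
have yD n k : exists2 z, D z & y (n + k)%N - y n = (3 / 2 * t n)%:C%C *: z.
  elim: k n => [|k ih] n; first by exists 0; [exact: disk0|rewrite addn0 subrr scaler0].
  have [z Dz zE] := ih n.+1; have [DF _] := FP (n, y n).
  exists ((2 / 3)%:C%C *: F (n, y n) + (1 / 3)%:C%C *: z).
    by apply: disk_absconv => //; rewrite !ger0_norm//; lra.
  rewrite -[y (n + k.+1)%N](subrK (y n.+1)) addnS -addSn zE /=.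
  rewrite -addrA [y n + _]addrC addrK addrC scalerDr !scalerA -!rmorphM /=.
  congr (_%:C%C *: _ + _%:C%C *: _); first by field.
  by rewrite /t exprS; field.
have yspan n k : disk_span D (y (n + k)%N - y n).
  have [z Dz ->] := yD n k; exists (3 / 2 * t n); first by rewrite mulr_gt0.
  by exists z.
have ygauge n k : minkowski_gauge D (y (n + k)%N - y n) <= 3 / 2 * t n.
  by have [z Dz ->] := yD n k; apply: gauge_le => //; rewrite mulr_gt0.
have ygaugeN n k : minkowski_gauge D (y n - y (n + k)%N) <= 3 / 2 * t n.
  have [z Dz zE] := yD n k; rewrite -opprB zE -scalerN.
  by apply: gauge_le (disk_opp Dz); rewrite mulr_gt0.
have tle m n : (m <= n)%N -> t n <= t m.
  by move=> mn; apply: ler_wiXn2l => //; lra.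
have [||l Dl lP] := Dcomplete y.
- by move=> n; have := yspan 0%N n; rewrite add0n subr0.
- move=> e e0; have [n ne] := expr_small (divr_gt0 e0 (ltr0n _ 2 : 0 < 2)).
  have {}ne : 3 / 2 * t n < e by move: ne; rewrite -/(t n); lra.
  exists n => i j ni nj; apply: le_lt_trans ne.
  have [ij|/ltnW ji] := leqP i j.
    rewrite -(subnKC ij); apply: le_trans (ygaugeN _ _) _.
    by rewrite ler_wpM2l// tle.
  rewrite -(subnKC ji); apply: le_trans (ygauge _ _) _.
  by rewrite ler_wpM2l// tle.
have [C CP] := Px l.
(* The n-th summand forces p_n(y_{n+1}) >= (2/3) N_n t_n, the later ones change this by at most
   (1/2) N_n t_n, and passing to the limit l by at most (1/12) N_n t_n; what remains is 1/12. *)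
have low n : N n * t n / 12 <= p n l.
  have t12 : 0 < t n / 12 by rewrite divr_gt0.
  have [m mP] := lP _ t12; pose k := (n.+1 + m)%N.
  have [_ h1] := FP (n, y n); rewrite [in X in _ <= X]/= -[_ + _]/(y n.+1) in h1.
  have h2 : p n (y k - y n.+1) <= 3 / 2 * t n.+1 * N n.
    have [z Dz ->] := yD n.+1 m; rewrite seminormZr ?mulr_ge0 ?(ltW (t0 _))//.
    by rewrite ler_wpM2l ?mulr_ge0 ?(ltW (t0 _))//; exact: pN.
  have lspan : disk_span D (y k - l).
    have [a a0 [u Du ->]] := Dl; have [z Dz] := yD 0%N k.
    rewrite add0n subr0 => ->; set b := 3 / 2 * t 0%N.
    have b0 : 0 < b by rewrite mulr_gt0.
    have ab : 0 < a + b by rewrite addr_gt0.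
    exists (a + b) => //.
    exists ((b / (a + b))%:C%C *: z + (- (a / (a + b)))%:C%C *: u).
      apply: disk_absconv => //; rewrite normrN !ger0_norm ?divr_ge0 ?(ltW ab) ?(ltW a0) ?(ltW b0)//.
      by rewrite -mulrDl addrC divff// gt_eqF.
    rewrite scalerDr !scalerA -!rmorphM /= mulrN rmorphN /= scaleNr.
    by congr (_%:C%C *: _ - _%:C%C *: _); rewrite mulrC divfK// gt_eqF.
  have h3 : p n (y k - l) <= t n / 12 * N n.
    by apply: seminorm_gauge (ps n) (pN n) lspan _; apply: mP; rewrite leq_addl.
  have h4 := (ps n).1 (y n.+1 - y k) (y k); rewrite subrK in h4.
  have h5 := (ps n).1 (y k - l) l; rewrite subrK in h5.
  rewrite -opprB (seminormN _ (ps n)) in h4.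
  have tS : t n.+1 = t n / 3 by rewrite /t exprS mulrC.
  rewrite tS in h2; move: h1 h2 h3 h4 h5 => /=.
  have -> : t n * (2 / 3 * N n) = 2 / 3 * (N n * t n) by ring.
  have -> : 3 / 2 * (t n / 3) * N n = 1 / 2 * (N n * t n) by field.
  have -> : t n / 12 * N n = (N n * t n) / 12 by ring.
  by lra.
have up n : (4 / 3) ^+ n <= 12 * C.
  have := le_trans (low n) (CP (p n) (pP n).1).
  have : (4 / 3) ^+ n <= N n * t n.
    by rewrite /t exprMn ler_wpM2r// exprn_ge0.
  by move: (_ ^+ n) (N n * t n) => a b; lra.
have [n h] : exists n : nat, 36 * `|C| < n%:R.
  by exists (Num.truncn (36 * `|C|)).+1; rewrite truncnS_gt.
have h1 := le_trans (expr_lower n) (up n).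
by have h3 := ler_norm C; move: (n%:R) h h1 => b; lra.
Qed.

End UniformBoundedness.

(** * Polars in the dual *)

Lemma sup_image_le (R : realType) (T : Type) (B : set T) (f : T -> R) (C : R) : 0 <= C ->
  (forall x, B x -> f x <= C) -> sup [set f x | x in B] <= C.
Proof.
move=> C0 fC; have [->|/set0P [x Bx]] := eqVneq B set0; first by rewrite image_set0 sup0.
by apply: ge_sup => [|_ [y By <-]]; [exists (f x), x|exact: fC].
Qed.

Lemma subsp_val_comb (R : realType) (V : lmodType R[i]) (W : lsubspace V) (a : R[i])
  (x y : subsp W) : subsp_val (a *: x + y) = a *: subsp_val x + subsp_val y.
Proof. by []. Qed.

Lemma hom_comb (R : realType) (E F : tvsType R[i]) (a : R[i]) (f g : hom E F) x :
  subsp_val (a *: f + g) x = a *: subsp_val f x + subsp_val g x.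
Proof. by []. Qed.

Lemma hom_comb2 (R : realType) (E F : tvsType R[i]) (a b : R[i]) (f g : hom E F) x :
  subsp_val (a *: f + b *: g) x = a *: subsp_val f x + b *: subsp_val g x.
Proof. by []. Qed.

Lemma hom_scale (R : realType) (E F : tvsType R[i]) (a : R[i]) (f : hom E F) x :
  subsp_val (a *: f) x = a *: subsp_val f x.
Proof. by []. Qed.

Section DualTopology.
Variables (R : realType) (d : nat) (M A : weight_sequence R).
Local Notation Rd := 'rV[R]_d.
Local Notation dual := (hom (ocspace d M A) R[i]^o).

Definition deriv_at (t : seq 'I_d) (y : Rd) (f : ocspace d M A) : R[i]^o :=
  partials t (subsp_val f) y.

Lemma ocspace_smooth (f : ocspace d M A) : smooth (subsp_val f).
Proof.
by have [h fh] := subspW f; exact: (@espace_smooth _ _ _ _ h (@mksub _ _ (esub d M A h) _ fh)).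
Qed.

Lemma deriv_at_linear t y : linear (deriv_at t y).
Proof.
move=> a f g; rewrite /deriv_at subsp_val_comb.
by rewrite (partialsP a t (ocspace_smooth f) (ocspace_smooth g)).
Qed.

Lemma deriv_at_bound t y h N (f : Rd -> R[i]^o) K :
  sbound M h (weightO A N) f K -> cabs (partials t f y) <=
    K * (M (size t) * h%:num^-1 ^+ size t * expR (assoc_fun A (enorm (N%:R^-1 *: y)))).
Proof.
move=> /(_ t y) /=; rewrite expRN ler_pdivrMr ?expR_gt0// mulrC -ler_pdivlMr ?exprn_gt0//.
move=> /le_trans; apply; rewrite le_eqVlt; apply/orP; left; apply/eqP.
by rewrite exprVn; ring.
Qed.

Lemma deriv_at_continuous t y : continuous (deriv_at t y).
Proof.
apply: ocspace_functional; first exact: deriv_at_linear.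
move=> h; exists (M (size t) * h%:num^-1 ^+ size t * expR (assoc_fun A (enorm (1%:R^-1 *: y)))), 1%N.
split=> // g K gK; rewrite mulrC.
exact: (deriv_at_bound t y gK).
Qed.

Definition deriv_functional (t : seq 'I_d) (y : Rd) : dual :=
  @mksub _ _ (hom_subspace (ocspace d M A) R[i]^o) (deriv_at t y)
    (conj (@deriv_at_linear t y) (@deriv_at_continuous t y)).

Definition polar (B : set (ocspace d M A)) : set dual :=
  [set f | forall psi, B psi -> cabs (subsp_val f psi) <= 1].

Lemma polar_not_nbhs (B : set (ocspace d M A)) :
  (forall m : nat, (1 <= m)%N -> exists2 K : nat, (1 <= K)%N & forall Y : R,
     exists f t y, B f /\ Y * m%:R ^+ size t * M (size t) *
       expR (assoc_fun A (enorm (K%:R^-1 *: y))) < cabs (partials t (subsp_val f) y)) ->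
  ~ nbhs (0 : oc_dual d M A) (polar B).
Proof.
have M0 := wseq_gt0 M.
move=> Birr [s [e [sQ e0 sU]]].
pose X (m K : nat) (t : seq 'I_d) y := m%:R ^+ size t * M (size t) * expR (assoc_fun A (enorm (K%:R^-1 *: (y : Rd)))).
have X0 m K t y : (1 <= m)%N -> 0 < X m K t y.
  by move=> m1; rewrite !mulr_gt0 ?exprn_gt0 ?expR_gt0 ?ltr0n.
(* The order of quantifiers is essential: m depends only on the steps E_h in which the finitely many
   sets are bounded, through 1/h <= m, whereas K is arbitrary because a bounded set of E_h is
   bounded for every weight. So K can be chosen afterwards, depending on m. *)
have [m m1 mP] : exists2 m : nat, (1 <= m)%N & forall K, (1 <= K)%N -> exists2 C : R, 0 <= C &
    forall p t y, p \in s -> p (deriv_functional t y) <= C * X m K t y.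
  elim: s sQ {sU} => [|p s ih] sQ.
    by exists 1%N => // K K1; exists 0 => // p t y; rewrite in_nil.
  have [|m m1 mP] := ih; first by move=> r rs; apply: sQ; rewrite in_cons rs orbT.
  have [_ [q [[h [B0 [B0b ->]]] qs qc pE]]] := sQ p (mem_head _ _).
  have [k k1 kh] : exists2 k : nat, (1 <= k)%N & h%:num^-1 <= k%:R.
    by exists (Num.truncn h%:num^-1).+1 => //; rewrite ltW// truncnS_gt.
  have mk1 : (1 <= maxn m k)%N by rewrite leq_max m1.
  exists (maxn m k) => //.
  move=> K K1; have [C C0 CP] := mP K K1.
  have [D DP] := bounded_espace K1 B0b.
  exists (C + `|D| * q 1); first by rewrite addr_ge0// mulr_ge0//; exact: seminorm_ge0.
  have q10 : 0 <= q 1 by exact: seminorm_ge0.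
  move=> r t y; rewrite in_cons mulrDl => /orP[/eqP->|rs]; last first.
    apply: ler_wpDr.
      exact: mulr_ge0 (mulr_ge0 (normr_ge0 _) q10) (ltW (X0 _ _ _ _ mk1)).
    apply: le_trans (CP r t y rs) _; rewrite ler_wpM2l//.
    rewrite /X ler_wpM2r ?expR_ge0// ler_wpM2r ?(ltW (M0 _))//.
    by rewrite lerXn2r ?nnegrE// ler_nat leq_maxl.
  apply: ler_wpDl; first exact: mulr_ge0 C0 (ltW (X0 _ _ _ _ mk1)).
  have Dq0 : 0 <= `|D| * q 1 * X (maxn m k) K t y.
    exact: mulr_ge0 (mulr_ge0 (normr_ge0 _) q10) (ltW (X0 _ _ _ _ mk1)).
  rewrite pE; apply: sup_image_le => // _ [f Bf <-].
  rewrite seminorm_cscale// mulrAC; apply: ler_wpM2r => //.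
  apply: le_trans (deriv_at_bound t y (sbound_le (ler_norm D) (DP f Bf))) _.
  apply: ler_wpM2l => //.
  rewrite /X ler_wpM2r ?expR_ge0// mulrC ler_wpM2r ?(ltW (M0 _))//.
  apply: lerXn2r; rewrite ?nnegrE//.
  by apply: le_trans kh _; rewrite ler_nat leq_maxr.
have [K K1 KP] := Birr m m1; have [C C0 CP] := mP K K1.
have C1 : 0 < C + 1 by rewrite ltr_wpDl.
have [psi [t [y [Bpsi psiP]]]] := KP ((C + 1) / e).
have Xt := X0 m K t y m1.
(* This multiple keeps the seminorms in [s] below e because C < C + 1, and makes the value at psi
   exceed 1 because the derivative of psi exceeds ((C + 1) / e) X. *)
have ta0 : 0 < e / ((C + 1) * X m K t y) by rewrite divr_gt0// mulr_gt0.
pose ta := e / ((C + 1) * X m K t y).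
have tb (p : dual -> R) : p \in s -> p (ta%:C%C *: deriv_functional t y) < e.
  move=> ps; have -> : p (ta%:C%C *: deriv_functional t y) = ta * p (deriv_functional t y).
    exact: (@seminormZr R dual p ta _ (seminormsP (sQ p ps)) (ltW ta0)).
  apply: le_lt_trans (ler_wpM2l (ltW ta0) (CP p t y ps)) _.
  have -> : ta * (C * X m K t y) = e * (C / (C + 1)).
    rewrite /ta; move: (X m K t y) Xt => x x0; field.
    by rewrite !gt_eqF.
  by rewrite gtr_pMr// ltr_pdivrMr// mul1r ltrDl.
have : polar B (ta%:C%C *: deriv_functional t y).
  by apply: sU => p ps; have := tb p ps; rewrite -[X in p X]subr0.
move=> /(_ psi Bpsi).
have -> : subsp_val (ta%:C%C *: deriv_functional t y) psi =
  ta%:C%C * partials t (subsp_val psi) y by [].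
rewrite cabsM cabsR gtr0_norm// => h.
have : cabs (partials t (subsp_val psi) y) <= (C + 1) / e * X m K t y.
  rewrite -(ler_pM2l ta0); apply: le_trans h _; rewrite le_eqVlt; apply/orP; left.
  by apply/eqP; move: (X m K t y) Xt => x x0; field; rewrite !gt_eqF.
by rewrite leNgt /X !mulrA psiP.
Qed.

Lemma step_bounded1 (psi : ocspace d M A) : step_bounded [set psi].
Proof.
have [h fh] := subspW psi.
pose g : espace d M A h := @mksub _ _ (esub d M A h) _ fh.
exists h, [set g]; split; last first.
  by rewrite image_set1; congr [set _]; apply: val_inj.
apply: espace_bounded => N N1; have [C CP] := espace_sbound g N1.
by exists C => _ ->.
Qed.

Lemma eval_family (psi : ocspace d M A) :
  seminorms (@uniform_family R (ocspace d M A) R[i]^o _ (@step_bounded_bounded R d M A))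
    (fun f => cabs (subsp_val f psi)).
Proof.
exists [set psi], (fun z => cabs z); split.
- exact: step_bounded1.
- exact: cabs_seminorm.
- exact: cabs_continuous.
- by apply/funext => f; rewrite image_set1 sup1.
Qed.

Lemma eval_seminorm (psi : ocspace d M A) :
  seminorm (fun f : dual => cabs (subsp_val f psi)).
Proof. exact: (seminormsP (eval_family psi)). Qed.

Lemma eval_continuous (psi : ocspace d M A) :
  continuous (fun f : oc_dual d M A => cabs (subsp_val f psi)).
Proof. exact: (lcs_seminorm_continuous (eval_family psi)). Qed.

Lemma polar_absolutely_convex B : @absolutely_convex R (oc_dual d M A) (polar B).
Proof.
move=> a b f g ab fB gB psi Bpsi; apply: le_trans ab.
have -> := @hom_comb2 R (ocspace d M A) R[i]^o a b f g psi.
apply: le_trans (cabsD _ _) _; rewrite !cabsM.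
by apply: lerD; apply: ler_piMr; rewrite ?cabs_ge0//; [exact: fB|exact: gB].
Qed.

Lemma polar_absorbs_banach_disk (B : set (ocspace d M A)) (D : set (oc_dual d M A)) :
  (forall q : ocspace d M A -> R, seminorm q -> continuous q ->
     exists C, forall f, B f -> q f <= C) ->
  banach_disk D -> absorbs (polar B : set (oc_dual d M A)) D.
Proof.
move=> Bb Dd.
have [||C CP] := @banach_disk_uniform_bound R (oc_dual d M A) D Dd
    [set p | exists2 psi, B psi & p = (fun f : oc_dual d M A => cabs (subsp_val f psi))].
- by move=> _ [psi _ ->]; split; [exact: eval_seminorm|exact: eval_continuous].
- move=> f; have [fl fc] := subspW f.
  have [|C CP] := Bb (fun psi => cabs (subsp_val f psi)) (seminorm_linear fl (@cabs_seminorm R)).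
    exact/functional_continuousP.
  by exists C => _ [psi Bpsi ->]; exact: CP.
have C1 : 0 < `|C| + 1 by rewrite ltr_wpDl.
exists (`|C| + 1) => // a aC f Df.
have a0 : 0 < cabs a by apply: lt_le_trans aC.
have an0 : a != 0 by apply: contraTneq a0 => ->; rewrite cabs0 ltxx.
exists (a^-1 *: (f : dual)); last by rewrite scalerA divff// scale1r.
move=> psi Bpsi; have -> := @hom_scale R (ocspace d M A) R[i]^o a^-1 f psi.
rewrite cabsM ComplexField.Normc.normcV ler_pdivrMl// mulr1; apply: le_trans aC.
have := CP _ f (ex_intro2 _ _ psi Bpsi erefl) Df => /le_trans; apply.
by apply: le_trans (ler_norm _) _; rewrite lerDl.
Qed.

End DualTopology.

(** * Convolution *)

Section LinearPartials.
Variables (R : realType) (d : nat).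
Local Notation Rd := 'rV[R]_d.
Implicit Types f g : Rd -> R[i]^o.

Lemma partialsZ (a : R[i]) f s : smooth f -> partials s (a *: f) = a *: partials s f.
Proof.
move=> fs; have := partialsP a s fs (@smooth0 R d).
by rewrite partials0 !addr0.
Qed.

Lemma smoothZ (a : R[i]) f : smooth f -> smooth (a *: f).
Proof. by move=> fs; rewrite -[_ *: _]addr0; apply: smoothP => //; exact: smooth0. Qed.

Lemma smoothD f g : smooth f -> smooth g -> smooth (f + g).
Proof. by move=> fs gs; rewrite -[f]scale1r; exact: smoothP. Qed.

Lemma partialsD f g s : smooth f -> smooth g -> partials s (f + g) = partials s f + partials s g.
Proof. by move=> fs gs; have := partialsP 1 s fs gs; rewrite !scale1r. Qed.

Lemma smoothB f g : smooth f -> smooth g -> smooth (f - g).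
Proof. by move=> fs gs; rewrite -scaleN1r; apply: smoothD => //; exact: smoothZ. Qed.

Lemma partialsB f g s : smooth f -> smooth g -> partials s (f - g) = partials s f - partials s g.
Proof.
move=> fs gs; rewrite -scaleN1r partialsD//; last exact: smoothZ.
by rewrite partialsZ// scaleN1r.
Qed.

Lemma smooth_partials_sum (I : Type) (r : seq I) (c : I -> R[i]) (g : I -> Rd -> R[i]^o) s :
  (forall k, smooth (g k)) -> smooth (\sum_(k <- r) c k *: g k) /\
  partials s (\sum_(k <- r) c k *: g k) = \sum_(k <- r) c k *: partials s (g k).
Proof.
move=> gs; elim: r => [|k r [ih1 ih2]].
  by rewrite !big_nil; split; [exact: smooth0|rewrite partials0].
rewrite !big_cons; split; first by apply: smoothP.
by rewrite partialsP// ih2.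
Qed.

Lemma cabs_partials_transl x f s y : smooth f ->
  cabs (partials s (transl x f) y) = cabs (partials s f (x - y)).
Proof.
move=> fs; rewrite partials_transl//.
rewrite -[X in cabs X]/((-1) ^+ size s * partials s f (x - y)).
by rewrite cabsM cabsX cabsN cabs1 expr1n mul1r.
Qed.

Lemma fsum_apply (I : Type) (r : seq I) (F : I -> Rd -> R[i]^o) y :
  (\sum_(k <- r) F k) y = \sum_(k <- r) F k y.
Proof. by elim/big_rec2 : _ => // k a b _ <-. Qed.

(** Up to sign, a derivative at y of the Taylor remainder of x |-> f(x - .) is the remainder of a
    derivative of f at x - y. This allows differentiation under a functional. *)
Lemma cabs_partials_remainder x v f t y C : smooth f ->
  (forall k l z, cabs (partials (l :: k :: t) f z) <= C) ->
  cabs (partials t (transl (x + v) f - transl x f -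
    \sum_k (v 0 k)%:C%C *: transl x (partial k f)) y) <= (d%:R ^+ 2 * C * `|v| ^+ 2) *+ 2.
Proof.
move=> fs fC.
have ts z : smooth (transl z f) by exact: smooth_transl.
have tk k : smooth (transl x (partial k f)).
  by apply: smooth_transl; exact: smooth_partial.
have [sums sumE] := smooth_partials_sum (index_enum 'I_d) (fun k => (v 0 k)%:C%C) t tk.
rewrite partialsB// ?partialsB//; last exact: smoothB.
rewrite sumE !partials_transl//.
have -> : \sum_k (v 0 k)%:C%C *: partials t (transl x (partial k f)) =
    (-1) ^+ size t *: \sum_k (v 0 k)%:C%C *: transl x (partial k (partials t f)).
  rewrite scaler_sumr; apply: eq_bigr => k _.
  rewrite partials_transl; last exact: smooth_partial.
  rewrite scalerA mulrC -scalerA; congr (_ *: (_ *: transl x _)).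
  rewrite -[partial k f]/(partials [:: k] f) partials_cat.
  rewrite -[RHS]/(partials (k :: t) f); apply: partials_perm => //.
  by rewrite perm_catC.
rewrite -!scalerBr; set Z := (X in _ *: X).
rewrite -[X in cabs X]/((-1) ^+ size t * Z y) cabsM cabsX cabsN cabs1 expr1n mul1r.
have -> : Z y = remainder (partials t f) (x - y) v (fun k => partial k (partials t f) (x - y)).
  rewrite /Z /remainder -[LHS]/(_ - _ - (\sum_k _ : Rd -> R[i]^o) y) fsum_apply.
  by rewrite /transl [x + v - y]addrAC.
apply: smooth_taylor; first exact: smooth_partials.
by move=> k l z; exact: fC.
Qed.

End LinearPartials.

Lemma ler_prod3 (R : realType) (a a' c w w' : R) : 0 <= a -> a <= a' -> 0 <= c ->
  0 <= w -> w <= w' -> a * c * w <= a' * c * w'.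
Proof.
move=> a0 aa c0 w0 ww; apply: ler_pM => //; first exact: mulr_ge0.
exact: ler_wpM2r.
Qed.

Section ConvolutionEstimates.
Variables (R : realType) (d : nat) (M A : weight_sequence R).
Local Notation Rd := 'rV[R]_d.
Implicit Types (h : {posnum R}) (w : Rd -> {posnum R}).

Lemma sbound_le_h h h' w w' (f : Rd -> R[i]^o) C : h%:num <= h'%:num ->
  (forall x, (w x)%:num <= (w' x)%:num) -> sbound M h' w' f C -> sbound M h w f C.
Proof.
move=> hh ww fC s x; apply: le_trans (fC s x).
have h0 : 0 <= h%:num by [].
have w0 : 0 <= (w x)%:num by [].
have hs : h%:num ^+ size s <= h'%:num ^+ size s.
  by apply: lerXn2r hh; rewrite nnegrE.
exact: ler_prod3 (exprn_ge0 _ h0) hs (cabs_ge0 _) w0 (ww x).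
Qed.

Lemma weightS_le h h' (x : Rd) : h%:num <= h'%:num ->
  (weightS A h x)%:num <= (weightS A h' x)%:num.
Proof.
move=> hh.
change (expR (assoc_fun A (enorm (h%:num *: x))) <= expR (assoc_fun A (enorm (h'%:num *: x)))).
rewrite ler_expR; apply: le_assoc; rewrite !enormZ !gtr0_norm//.
by apply: ler_wpM2r => //; exact: sqrtr_ge0.
Qed.

Lemma sbound_weightS_le h h' (f : Rd -> R[i]^o) C : h%:num <= h'%:num ->
  sbound M h' (weightS A h') f C -> sbound M h (weightS A h) f C.
Proof. by move=> hh; exact: (sbound_le_h hh (fun x => weightS_le x hh)). Qed.

(** A form of the triangle inequality obtained coordinatewise from (a + b)^2 <= 2 a^2 + 2 b^2,
    convenient for monotone weights. *)
Lemma enorm_add_le (x y : Rd) : enorm (x + y) <= 2 * Num.max (enorm x) (enorm y).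
Proof.
have m0 : 0 <= Num.max (enorm x) (enorm y) by rewrite le_max enorm_ge0.
apply: sqr_le_of; [exact: enorm_ge0|by rewrite mulr_ge0|].
have sq (z : Rd) : enorm z ^+ 2 = \sum_k z 0 k ^+ 2.
  by rewrite sqr_sqrtr//; apply: sumr_ge0 => k _; exact: sqr_ge0.
have h : enorm (x + y) ^+ 2 <= 2 * enorm x ^+ 2 + 2 * enorm y ^+ 2.
  rewrite !sq !mulr_sumr -big_split/=; apply: ler_sum => k _; rewrite mxE.
  move: (x 0 k) (y 0 k) => a b; rewrite -subr_ge0.
  by rewrite (_ : _ - _ = (a - b) ^+ 2) ?sqr_ge0//; ring.
apply: le_trans h _; rewrite exprMn.
have hx : enorm x ^+ 2 <= Num.max (enorm x) (enorm y) ^+ 2.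
  by apply: lerXn2r; rewrite ?nnegrE ?enorm_ge0// le_max lexx.
have hy : enorm y ^+ 2 <= Num.max (enorm x) (enorm y) ^+ 2.
  by apply: lerXn2r; rewrite ?nnegrE ?enorm_ge0// le_max lexx orbT.
by lra.
Qed.

(** The larger of x and y carries the whole left side; the other summand is nonnegative. *)
Lemma assoc_split (k a b : R) (x y : Rd) : 0 <= k -> 2 * k <= a -> 2 * k <= b ->
  assoc_fun A (k * enorm (x + y)) <= assoc_fun A (a * enorm x) + assoc_fun A (b * enorm y).
Proof.
move=> k0 ka kb; have h := ler_wpM2l k0 (enorm_add_le x y).
have x0 := enorm_ge0 x; have y0 := enorm_ge0 y.
have [xy|yx] := leP (enorm y) (enorm x).
  rewrite (max_idPl xy) in h; apply: ler_wpDr; first exact: assoc_ge0.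
  by apply: le_assoc; apply: le_trans h _; rewrite mulrA (mulrC k) ler_wpM2r.
rewrite (max_idPr (ltW yx)) in h; apply: ler_wpDl; first exact: assoc_ge0.
by apply: le_assoc; apply: le_trans h _; rewrite mulrA (mulrC k) ler_wpM2r.
Qed.

Variables (C0 : R) (H : {posnum R}).
Hypotheses (C01 : 1 <= C0).
Hypothesis M2 : forall p q, M (p + q)%N <= C0 * H%:num ^+ (p + q) * M p * M q.

Local Notation shrink h := (h%:num / H%:num)%:pos.

(** (M.2) separates the orders of t and s: H^{|t|} is absorbed by passing from h to h / H, and
    everything that depends on s enters the constant. *)
Lemma sbound_partials h w (f : Rd -> R[i]^o) C s : sbound M h w f C ->
  sbound M (shrink h) w (partials s f) (C * C0 * (H%:num / h%:num) ^+ size s * M (size s)).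
Proof.
move=> fC; have C_ge0 := sbound_ge0 fC; move=> t x; have := fC (t ++ s) x.
rewrite size_cat partials_cat; set c := cabs _; set w0 := (w x)%:num => fE.
have h0 : 0 < h%:num :> R by []. have H0 : 0 < H%:num :> R by [].
have -> : (shrink h)%:num ^+ size t * c * w0 =
    (h%:num ^+ size s * H%:num ^+ size t)^-1 * (h%:num ^+ (size t + size s) * c * w0).
  rewrite /= exprMn exprVn exprD invfM.
  rewrite [X in _ = X](_ : _ = (h%:num ^+ size s)^-1 * h%:num ^+ size s *
     (h%:num ^+ size t / H%:num ^+ size t * c * w0)); last by ring.
  by rewrite mulVf ?mul1r// expf_neq0.
rewrite ler_pdivrMl ?mulr_gt0 ?exprn_gt0//; apply: le_trans fE _.
apply: le_trans (ler_wpM2l C_ge0 (M2 (size t) (size s))) _.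
rewrite exprD exprMn exprVn.
rewrite [leRHS](_ : _ = h%:num ^+ size s * (h%:num ^+ size s)^-1 *
  (C * (C0 * (H%:num ^+ size t * H%:num ^+ size s) * M (size t) * M (size s)))); last by ring.
by rewrite divff ?mul1r// expf_neq0.
Qed.

(** Writing x = (x - y) + y splits e^{A(k x)} into a factor paid by the decay of f at x - y and one
    paid by the weight e^{-A(y / N)}. The outcome is decay in the translation parameter x, which
    becomes the decay of convolutions. *)
Lemma sbound_transl h (f : Rd -> R[i]^o) C s x N (k : R) : smooth f -> (1 <= N)%N ->
  0 <= k -> 2 * k <= h%:num -> 2 * k <= N%:R^-1 -> sbound M h (weightS A h) f C ->
  sbound M (shrink h) (weightO A N) (transl x (partials s f))
    (C * C0 * (H%:num / h%:num) ^+ size s * M (size s) * expR (- assoc_fun A (k * enorm x))).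
Proof.
move=> fs N1 k0 kh kN fC t y.
rewrite cabs_partials_transl; last exact: smooth_partials.
have := sbound_partials s fC t (x - y).
set B := C * C0 * _ * _; set u := _ * cabs _.
have u0 : 0 <= u by rewrite mulr_ge0 ?exprn_ge0 ?cabs_ge0.
change (u * expR (assoc_fun A (enorm (h%:num *: (x - y)))) <= B * M (size t) ->
  u * expR (- assoc_fun A (enorm (N%:R^-1 *: y))) <=
  B * expR (- assoc_fun A (k * enorm x)) * M (size t)).
move=> uB; rewrite [leRHS]mulrAC; apply: le_trans (ler_wpM2r (expR_ge0 _) uB).
rewrite -[leRHS]mulrA -expRD; apply: ler_wpM2l => //.
rewrite ler_expR lerNl opprB lerBlDl.
rewrite -{1}(subrK y x) !enormZ ger0_norm// ger0_norm ?invr_ge0//.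
exact: assoc_split.
Qed.

End ConvolutionEstimates.

Section SubspaceValues.
Variables (R : realType) (V : lmodType R[i]) (W : lsubspace V).

Lemma subsp_val_sub (x y : subsp W) : subsp_val (x - y) = subsp_val x - subsp_val y.
Proof.
have := subsp_val_comb (-1) y x.
by rewrite !scaleN1r addrC => ->; rewrite addrC.
Qed.

Lemma subsp_val_sum (I : Type) (r : seq I) (c : I -> R[i]) (g : I -> subsp W) :
  subsp_val (\sum_(k <- r) c k *: g k) = \sum_(k <- r) c k *: subsp_val (g k).
Proof.
elim: r => [|k r ih]; first by rewrite !big_nil.
by rewrite !big_cons subsp_val_comb ih.
Qed.

Lemma linear_sum_scale (U : lmodType R[i]) (f : V -> U) (I : Type) (r : seq I)
  (c : I -> R[i]) (g : I -> V) : linear f ->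
  f (\sum_(k <- r) c k *: g k) = \sum_(k <- r) c k *: f (g k).
Proof.
move=> fl; elim: r => [|k r ih]; first by rewrite !big_nil linear_map0.
by rewrite !big_cons fl ih.
Qed.

End SubspaceValues.

Section Convolution.
Variables (R : realType) (d : nat) (M A : weight_sequence R).
Local Notation Rd := 'rV[R]_d.
Variables (C0 : R) (H : {posnum R}).
Hypotheses (C01 : 1 <= C0).
Hypothesis M2 : forall p q, M (p + q)%N <= C0 * H%:num ^+ (p + q) * M p * M q.
Local Notation shrink h := (h%:num / H%:num)%:pos.
Implicit Types (h : {posnum R}).

Lemma sbound_transl0 h (phi : Rd -> R[i]^o) C s x N : smooth phi -> (1 <= N)%N ->
  sbound M h (weightS A h) phi C ->
  sbound M (shrink h) (weightO A N) (transl x (partials s phi))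
    (C * C0 * (H%:num / h%:num) ^+ size s * M (size s)).
Proof.
move=> fs N1 fC.
have h0 : 2 * 0 <= h%:num by rewrite mulr0.
have n0 : 2 * 0 <= N%:R^-1 :> R by rewrite mulr0 invr_ge0.
have := sbound_transl M2 s x fs N1 (lexx 0) h0 n0 fC.
by rewrite mul0r /assoc_fun ltxx oppr0 expR0 mulr1.
Qed.

Lemma transl_partials_eset h (phi : Rd -> R[i]^o) C s x : smooth phi ->
  sbound M h (weightS A h) phi C -> eset M A (shrink h) (transl x (partials s phi)).
Proof.
move=> fs fC; apply: eset_sbound.
  by apply: smooth_transl; exact: smooth_partials.
move=> N N1; exists (C * C0 * (H%:num / h%:num) ^+ size s * M (size s)).
exact: sbound_transl0.
Qed.

Lemma transl_partials_ocset (phi : sspace d M A) s x :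
  ocset M A (transl x (partials s (subsp_val phi))).
Proof.
have [fs [h [C fC]]] := sspace_sbound phi.
by exists (shrink h); exact: transl_partials_eset fC.
Qed.

(** The derivative along s, with respect to x, of the translate phi(x - .); differentiating in x
    instead of in the argument avoids signs. *)
Definition oc_transl (phi : sspace d M A) s x : ocspace d M A :=
  @mksub _ _ (ocsub d M A) _ (transl_partials_ocset phi s x).

Lemma hom_bound (f : hom (ocspace d M A) R[i]^o) h : exists C N, [/\ 0 <= C, (1 <= N)%N &
  forall (psi : ocspace d M A) K, eset M A h (subsp_val psi) ->
    sbound M h (weightO A N) (subsp_val psi) K -> cabs (subsp_val f psi) <= C * K].
Proof.
have [fl fc] := subspW f.
have fs := seminorm_linear fl (@cabs_seminorm R).
have [|C [N [C_ge0 N1 CP]]] := ocspace_seminorm_bound h fs.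
  exact/functional_continuousP.
exists C, N; split=> // psi K psih psiK.
have -> : psi = e_incl (@mksub _ _ (esub d M A h) _ psih) by apply: val_inj.
exact: CP.
Qed.

Lemma weightS_ge1 h (x : Rd) : 1 <= (weightS A h x)%:num.
Proof. exact: assoc_ge1. Qed.

Lemma weightO_le1 N (x : Rd) : 0 < (weightO A N x)%:num <= 1.
Proof.
change (0 < expR (- assoc_fun A (enorm (N%:R^-1 *: x))) <= 1).
by rewrite expR_gt0 -expR0 ler_expR lerNl oppr0 assoc_ge0.
Qed.

Lemma remainder_scale (u m D e w : R) : 0 < u ->
  u * ((e * (D * m / u) * w) *+ 2) = (e * D * w) *+ 2 * m.
Proof. by move=> u0; rewrite !mulr2n; field; rewrite gt_eqF. Qed.

Lemma sbound_remainder h (phi : Rd -> R[i]^o) C s x v N : smooth phi ->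
  sbound M h (weightS A h) phi C ->
  sbound M (shrink h) (weightO A N) (transl (x + v) (partials s phi) - transl x (partials s phi) -
    \sum_k (v 0 k)%:C%C *: transl x (partials (k :: s) phi))
   ((d%:R ^+ 2 * (C * C0 * (H%:num / h%:num) ^+ (size s).+2 * M (size s).+2) * `|v| ^+ 2) *+ 2).
Proof.
move=> fs fC t y; set D := C * C0 * _ * _.
have hH : 0 < (shrink h)%:num ^+ size t by rewrite exprn_gt0.
have Ft k l z : cabs (partials (l :: k :: t) (partials s phi) z) <=
    D * M (size t) / (shrink h)%:num ^+ size t.
  have -> : partials (l :: k :: t) (partials s phi) = partials t (partials (l :: k :: s) phi).
    rewrite !partials_cat; apply: partials_perm => //.
    by rewrite perm_sym -[l :: k :: s]/([:: l; k] ++ s) -[l :: k :: t]/([:: l; k] ++ t) perm_catCA -catA.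
  rewrite ler_pdivlMr// mulrC.
  apply: le_trans (sbound_partials M2 (l :: k :: s) fC t z).
  apply: ler_peMr (weightS_ge1 h z).
  by rewrite mulr_ge0 ?cabs_ge0// ltW.
have := cabs_partials_remainder x v y (smooth_partials s fs) Ft.
set r := cabs _.
have r0 : 0 <= r by exact: cabs_ge0.
move=> rB; have /andP[w0 w1] := weightO_le1 N y.
apply: (@le_trans _ _ ((shrink h)%:num ^+ size t * r)).
  by apply: ler_piMr w1; rewrite mulr_ge0// ltW.
apply: le_trans (ler_wpM2l (ltW hH) rB) _.
by rewrite remainder_scale.
Qed.

(** The remainder of the translates is quadratic in |v| not only pointwise but in E_{h/H}, where f
    is bounded by some norm. *)
Lemma hom_jet (f : hom (ocspace d M A) R[i]^o) (phi : sspace d M A) :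
  jet (fun s x => subsp_val f (oc_transl phi s x)).
Proof.
move=> s x; have [fl fc] := subspW f; have [fs [h [C fC]]] := sspace_sbound phi.
have [D [N [D0 N1 DP]]] := hom_bound f (shrink h).
exists (D * ((d%:R ^+ 2 * (C * C0 * (H%:num / h%:num) ^+ (size s).+2 * M (size s).+2)) *+ 2)).
move=> v _; pose rho : ocspace d M A := oc_transl phi s (x + v) - oc_transl phi s x -
   \sum_k (v 0 k)%:C%C *: oc_transl phi (k :: s) x.
have -> : remainder (fun x => subsp_val f (oc_transl phi s x)) x v
    (fun k => subsp_val f (oc_transl phi (k :: s) x)) = subsp_val f rho.
  rewrite /rho (linear_sub _ _ fl) (linear_sub _ _ fl).
  by rewrite (linear_sum_scale _ _ _ fl).
have rhoE : subsp_val rho = transl (x + v) (partials s (subsp_val phi)) -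
    transl x (partials s (subsp_val phi)) -
    \sum_k (v 0 k)%:C%C *: transl x (partials (k :: s) (subsp_val phi)).
  by rewrite /rho subsp_val_sub subsp_val_sub subsp_val_sum.
have rb N' := sbound_remainder s x v N' fs fC; rewrite -rhoE in rb.
have re : eset M A (shrink h) (subsp_val rho).
  apply: eset_sbound; first exact: ocspace_smooth.
  by move=> N' _; eexists; exact: rb.
apply: le_trans (DP rho _ re (rb N)) _.
by rewrite -[leRHS]mulrA mulrnAl.
Qed.

Lemma convolutionE (f : hom (ocspace d M A) R[i]^o) (phi : sspace d M A) :
  convolution f phi = fun x => subsp_val f (oc_transl phi [::] x).
Proof.
by apply/funext => x; rewrite /convolution; congr (subsp_val f _); apply: val_inj.
Qed.

Lemma smooth_convolution f phi : smooth (@convolution R d M A f phi).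
Proof. by rewrite convolutionE; exact: (smooth_jet (hom_jet f phi)). Qed.

Lemma partials_convolution f (phi : sspace d M A) s x :
  partials s (convolution f phi) x = subsp_val f (oc_transl phi s x).
Proof. by rewrite convolutionE (partials_jet s (hom_jet f phi)). Qed.

Lemma convolution_scale (u c w D K u' m : R) : 0 < u -> u * u' = 1 ->
  c <= D * (K * C0 * u' * m * w^-1) -> 0 < w -> u * c * w <= D * C0 * K * m.
Proof.
move=> u0 uu cD w0; have h := ler_wpM2l (ltW u0) (ler_wpM2r (ltW w0) cD).
rewrite -mulrA; apply: le_trans h _.
have -> : u * (D * (K * C0 * u' * m / w) * w) = D * C0 * K * m * (u * u').
  by field; rewrite gt_eqF.
by rewrite uu mulr1.
Qed.

Lemma sbound_convolution f h : exists h' C, forall (phi : sspace d M A) K,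
  sbound M h (weightS A h) (subsp_val phi) K ->
  sbound M h' (weightS A h') (convolution f phi) (C * K).
Proof.
have [D [N [D0 N1 DP]]] := hom_bound f (shrink h).
have Ni : 0 < N%:R^-1 :> R by rewrite invr_gt0 ltr0n.
have [k [kh kN]] : exists k : {posnum R}, 2 * k%:num <= h%:num /\ 2 * k%:num <= N%:R^-1.
  exists (Num.min h%:num (PosNum Ni)%:num / 2)%:pos => /=.
  by rewrite mulrC divfK ?pnatr_eq0// !ge_min !lexx orbT.
have k0 : 0 <= k%:num by [].
(* h' <= h / H compensates the factor (H / h)^{|s|}, and h' <= k keeps the weight below the decay
   rate k, which is limited by the index N of the norm that controls f. *)
have [h' [h'1 h'2]] : exists h' : {posnum R}, h'%:num <= (shrink h)%:num /\ h'%:num <= k%:num.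
  by exists (Num.min (shrink h)%:num k%:num)%:pos; rewrite /= !ge_min !lexx orbT.
exists h', (D * C0) => phi K phiK s x.
have fs := (sspace_sbound phi).1.
have e := DP (oc_transl phi s x) _ (transl_partials_eset s x fs phiK)
  (sbound_transl M2 s x fs N1 k0 kh kN phiK).
rewrite partials_convolution.
set c := cabs _ in e *; have c0 : 0 <= c by exact: cabs_ge0.
have w2 := weightS_le A x h'2.
have h's : h'%:num ^+ size s <= (shrink h)%:num ^+ size s.
  by apply: lerXn2r h'1; rewrite nnegrE.
have w3 : (weightS A h' x)%:num <= expR (assoc_fun A (k%:num * enorm x)).
  apply: le_trans w2 _.
  change (expR (assoc_fun A (enorm (k%:num *: x))) <= expR (assoc_fun A (k%:num * enorm x))).
  by rewrite enormZ ger0_norm.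
have h0 : 0 <= h'%:num ^+ size s by rewrite exprn_ge0.
have wp := le_trans ler01 (weightS_ge1 h' x).
apply: le_trans (ler_prod3 h0 h's c0 wp w3) _.
have uE : (shrink h)%:num ^+ size s * (H%:num / h%:num) ^+ size s = 1.
  by rewrite -exprMn /= mulrA divfK// divff// expr1n.
have u0 : 0 < (shrink h)%:num ^+ size s by rewrite exprn_gt0.
rewrite expRN in e; exact: convolution_scale u0 uE e (expR_gt0 _).
Qed.

Lemma convolution_sset f (phi : sspace d M A) : sset M A (convolution f phi).
Proof.
have [_ [h [K phiK]]] := sspace_sbound phi.
have [h' [C CP]] := sbound_convolution f h.
exists h'; apply/bset_sbound; split; first exact: smooth_convolution.
by exists (C * K); exact: CP.
Qed.

Definition conv_elt f (phi : sspace d M A) : sspace d M A :=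
  @mksub _ _ (ssub d M A) _ (convolution_sset f phi).

Lemma oc_transl_comb (a : R[i]) (phi psi : sspace d M A) x :
  oc_transl (a *: phi + psi) [::] x = a *: oc_transl phi [::] x + oc_transl psi [::] x.
Proof.
by apply: val_inj => /=; reflexivity.
Qed.

Lemma conv_elt_linear f : linear (conv_elt f).
Proof.
move=> a phi psi; apply: val_inj; rewrite [RHS]subsp_val_comb /=.
rewrite !convolutionE; apply/funext => x; have [fl _] := subspW f.
by rewrite oc_transl_comb fl.
Qed.

Lemma conv_elt_continuous f : continuous (conv_elt f).
Proof.
apply: lcs_continuous; first exact: conv_elt_linear.
move=> q [qs qc].
have qc' : continuous (q : sspace d M A -> R) by apply: lcs_seminorm_continuous; split.
apply: sspace_seminorm_continuous.
  exact: (@seminorm_linear R (sspace d M A) (sspace d M A) _ _ (@conv_elt_linear f) qs).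
move=> h; have [h' [C CP]] := sbound_convolution f h.
have [D D0 DP] := sspace_seminorm_bound h' qs qc'.
exists (D * C) => phi K phiK; have cK := CP (s_incl phi) K phiK.
have ch : bset M h' (weightS A h') (convolution f (s_incl phi)).
  by apply/bset_sbound; split; [exact: smooth_convolution|exists (C * K)].
have -> : conv_elt f (s_incl phi) = s_incl (@mksub _ _ (bsub M h' (weightS A h')) _ ch).
  by apply: val_inj.
by rewrite -mulrA; exact: DP.
Qed.

Definition conv_hom f : hom (sspace d M A) (sspace d M A) :=
  @mksub _ _ (hom_subspace (sspace d M A) (sspace d M A)) (conv_elt f)
    (conj (@conv_elt_linear f) (@conv_elt_continuous f)).

(** [conv_hom] lies in the set from which [xget] selects, so the default value never occurs. *)
Lemma convolution_opE f (phi : sspace d M A) :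
  subsp_val (subsp_val (convolution_op f : hom (sspace d M A) (sspace d M A)) phi : sspace d M A) =
  convolution f phi.
Proof.
rewrite /convolution_op; case: xgetP => [T _ TP|noT]; first exact: TP.
by have := noT (conv_hom f); elim.
Qed.

End Convolution.

(** * Seminorms dominated by point evaluations *)

Section UltraLimits.
Variables (R : realType) (I : Type) (U : set_system I).
Hypothesis UU : UltraFilter U.

Lemma ultra_limit_real (f : I -> R) (C : R) : (forall i, `|f i| <= C) ->
  exists l : R, forall e, 0 < e -> U [set i | `|f i - l| < e].
Proof.
move=> fC.
have Fp : ProperFilter (f @ U) by exact: fmap_proper_filter.
have fU : (f @ U) `[- C, C]%classic.
  change (U [set i | f i \in `[- C, C]]); apply: filterE => i /=.
  by rewrite in_itv /= -ler_norml; exact: fC.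
have [l [_ lc]] := segment_compact Fp fU.
exists l => e e0; have [//|Uc] := in_ultra_setVsetC [set i | `|f i - l| < e] UU.
have [x [/= xC xe]] := lc (~` [set x | `|x - l| < e]) (ball l e) Uc (nbhsx_ballx l e e0).
by case: xC; rewrite distrC; move: xe; rewrite -ball_normE.
Qed.

Definition climit (f : I -> R[i]) (l : R[i]) := forall e : R, 0 < e -> U [set i | cabs (f i - l) < e].

Lemma ultra_limit (f : I -> R[i]) (C : R) : (forall i, cabs (f i) <= C) ->
  exists l, climit f l.
Proof.
move=> fC.
have [x xP] := ultra_limit_real (fun i => le_trans (normRe_le (f i)) (fC i)).
have [y yP] := ultra_limit_real (fun i => le_trans (normIm_le (f i)) (fC i)).
exists (Complex x y) => e e0; have e2 : 0 < e / 2 by rewrite divr_gt0.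
apply: filterS2 (xP _ e2) (yP _ e2) => i /= hx hy.
apply: le_lt_trans (cabs_leD _) _; rewrite ReB ImB /= (splitr e).
exact: ltrD.
Qed.

Lemma climit_le (f : I -> R[i]) l (C : R) : climit f l -> U [set i | cabs (f i) <= C] ->
  cabs l <= C.
Proof.
move=> fl fC; apply/ler_addgt0Pr => e e0.
have [i [/= h1 h2]] := filter_ex (filterI fC (fl e e0)).
rewrite -(subrK (f i) l); apply: le_trans (cabsD _ _) _; rewrite addrC lerD//.
by rewrite cabsBC ltW.
Qed.

Lemma climitD f g l m : climit f l -> climit g m -> climit (fun i => f i + g i) (l + m).
Proof.
move=> fl gm e e0; have e2 : 0 < e / 2 by rewrite divr_gt0.
apply: filterS2 (fl _ e2) (gm _ e2) => i /= hf hg.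
have -> : f i + g i - (l + m) = (f i - l) + (g i - m) by ring.
by apply: le_lt_trans (cabsD _ _) _; rewrite (splitr e); exact: ltrD.
Qed.

Lemma climitM (c : R[i]) f l : climit f l -> climit (fun i => c * f i) (c * l).
Proof.
move=> fl e e0; have c0 : 0 < cabs c + 1 by rewrite ltr_wpDl ?cabs_ge0.
apply: filterS (fl _ (divr_gt0 e0 c0)) => i /=; rewrite ltr_pdivlMr// => h.
rewrite -mulrBr cabsM; apply: le_lt_trans h; rewrite mulrC ler_wpM2l ?cabs_ge0//.
by rewrite lerDl.
Qed.

Lemma climit_cst (c : R[i]) : climit (fun=> c) c.
Proof. by move=> e e0; apply: filterE => i /=; rewrite subrr cabs0. Qed.

Lemma climitB f g l m : climit f l -> climit g m -> climit (fun i => f i - g i) (l - m).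
Proof.
move=> fl gm; have := climitD fl (climitM (-1) gm); rewrite mulN1r.
by have -> : (fun i => f i + -1 * g i) = (fun i => f i - g i) by apply/funext => i; rewrite mulN1r.
Qed.

Lemma climit_sum (J : Type) (r : seq J) (f : J -> I -> R[i]) (l : J -> R[i]) :
  (forall j, climit (f j) (l j)) ->
  climit (fun i => \sum_(j <- r) f j i) (\sum_(j <- r) l j).
Proof.
move=> fl; elim: r => [|j r ih].
  rewrite big_nil (_ : (fun=> _) = (fun=> 0)); first exact: climit_cst.
  by apply/funext => i; rewrite big_nil.
rewrite big_cons (_ : (fun=> _) = (fun i => f j i + \sum_(j <- r) f j i)).
  exact: climitD.
by apply/funext => i; rewrite big_cons.
Qed.

End UltraLimits.

(** * Compactness of the inclusions between steps *)

Section Compactness.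
Variables (R : realType) (d : nat) (M A : weight_sequence R).
Local Notation Rd := 'rV[R]_d.
Variables (I : Type) (U : set_system I).
Hypothesis UU : UltraFilter U.
Implicit Types (h : {posnum R}).

Lemma sbound_plain h w (f : Rd -> R[i]^o) C s x : (forall y, 1 <= (w y)%:num) ->
  sbound M h w f C -> cabs (partials s f x) <= C * M (size s) / h%:num ^+ size s.
Proof.
move=> w1 fC; have h0 : 0 < h%:num ^+ size s by rewrite exprn_gt0.
rewrite ler_pdivlMr// mulrC; apply: le_trans (fC s x).
by apply: ler_peMr (w1 x); rewrite mulr_ge0 ?cabs_ge0// ltW.
Qed.

(* uniform second order bounds pass to pointwise limits, so that limits of
   bounded families are smooth *)
Lemma sbound_compact h w (G : I -> Rd -> R[i]^o) C : (forall y, 1 <= (w y)%:num) ->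
  (forall i, smooth (G i)) -> (forall i, sbound M h w (G i) C) ->
  exists g, [/\ smooth g, sbound M h w g C &
    forall s x, climit U (fun i => partials s (G i) x) (partials s g x)].
Proof.
move=> w1 Gs GC.
have lim s x : exists l, climit U (fun i => partials s (G i) x) l.
  exact: (ultra_limit UU (fun i => sbound_plain s x w1 (GC i))).
have /choice[L LP] : forall sx : seq 'I_d * Rd, exists l : R[i],
    climit U (fun i => partials sx.1 (G i) sx.2) l by move=> [s x]; exact: lim.
pose J s : Rd -> R[i]^o := fun x => L (s, x).
have Jj : jet J.
  move=> s x; exists ((d%:R ^+ 2 * (C * M (size s).+2 / h%:num ^+ (size s).+2)) *+ 2) => v _.
  have cl : climit U (fun i => remainder (partials s (G i)) x v (fun k => partials (k :: s) (G i) x))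
      (remainder (J s) x v (fun k => J (k :: s) x)).
    rewrite /remainder; apply: climitB; first by apply: climitB; exact: (LP (_, _)).
    by apply: climit_sum => k; apply: climitM; exact: (LP (_, _)).
  apply: climit_le cl _; apply: filterE => i /=.
  have := @smooth_taylor R d (partials s (G i)) x v
    (C * M (size s).+2 / h%:num ^+ (size s).+2) (smooth_partials s (Gs i)).
  rewrite mulrnAl; apply => k l y.
  exact: (sbound_plain (l :: k :: s) y w1 (GC i)).
exists (J [::]); split=> [||s x]; [exact: smooth_jet| |]; last first.
  by rewrite partials_jet//; exact: (LP (_, _)).
move=> s x; rewrite partials_jet//.
have h0 : 0 < h%:num ^+ size s by rewrite exprn_gt0.
have w0 : 0 < (w x)%:num by [].
rewrite -ler_pdivlMr// mulrC -ler_pdivlMr//.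
apply: climit_le (LP (s, x)) _; apply: filterE => i /=.
by rewrite ler_pdivlMr// mulrC ler_pdivlMr//; exact: GC.
Qed.

Lemma ultra_limit_rV (x : I -> Rd) (rho : R) : (forall i, `|x i| <= rho) ->
  exists l : Rd, forall e, 0 < e -> U [set i | `|x i - l| < e].
Proof.
move=> xr.
have /choice[l lP] : forall k, exists l : R, forall e, 0 < e -> U [set i | `|x i 0 k - l| < e].
  by move=> k; apply: (ultra_limit_real UU) => i; exact: le_trans (norm_coord _ _) (xr i).
exists (\row_k l k) => e e0.
apply: filterS (filter_forall _ (fun k => lP k e e0)) => i /= xi; rewrite [X in X < _]/Num.norm /= mx_normrE.
apply/bigmax_ltP; split=> // [[a k] _]; rewrite /= !mxE ord1.
exact: xi.
Qed.

Lemma norm_le_enorm (x : Rd) : `|x| <= enorm x.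
Proof.
rewrite [X in X <= _]/Num.norm /= mx_normrE.
apply/bigmax_leP; split=> [|[a k] _]; first exact: enorm_ge0.
by rewrite /= ord1; exact: coord_le_enorm.
Qed.

(** If the bound failed on a set in U, bad points in the ball would have a limit l along U; a
    Lipschitz bound common to all i would transfer smallness at l to the bad points. *)
Lemma climit_uniform h (D : I -> Rd -> R[i]^o) C s (rho eta : R) : 0 < eta ->
  (forall i, smooth (D i)) -> (forall i, sbound M h (weightS A h) (D i) C) ->
  (forall x, climit U (fun i => partials s (D i) x) 0) ->
  U [set i | forall x, `|x| <= rho -> cabs (partials s (D i) x) <= eta].
Proof.
move=> eta0 Ds DC Dl.
have [//|Uc] := in_ultra_setVsetC
  [set i | forall x, `|x| <= rho -> cabs (partials s (D i) x) <= eta] UU.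
have [i0 /= ci0] := filter_ex Uc.
(* For rho < 0 the bound would hold vacuously at [i0]. Hence 0 lies in the ball and can serve as
   default point. *)
have rho0 : 0 <= rho.
  rewrite leNgt; apply/negP => r0; apply: ci0 => x xr.
  by have := le_lt_trans xr r0; rewrite normr_lt0.
have /choice[x xP] : forall i, exists x : Rd, `|x| <= rho /\
    (~ (forall x, `|x| <= rho -> cabs (partials s (D i) x) <= eta) -> eta < cabs (partials s (D i) x)).
  move=> i; have [h1|/existsNP[x /not_implyP[xr xe]]] := pselect (forall x, `|x| <= rho -> cabs (partials s (D i) x) <= eta).
    by exists 0; split; [rewrite normr0|].
  by exists x; split=> // _; rewrite ltNge; apply/negP.
have [l lP] := ultra_limit_rV (fun i => (xP i).1).
pose L := C * M (size s).+1 / h%:num ^+ (size s).+1.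
have L0 : 0 <= L.
  by apply: divr_ge0 (mulr_ge0 (sbound_ge0 (DC i0)) (ltW (wseq_gt0 M _))) _; rewrite exprn_ge0.
have w1 (y : Rd) : 1 <= (weightS A h y)%:num by exact: assoc_ge1.
have K0 : 0 < d%:R * L *+ 2 + 1 by rewrite ltr_wpDl// mulrn_wge0// mulr_ge0.
have e2 : 0 < eta / 2 by rewrite divr_gt0.
have dl : 0 < eta / 2 / (d%:R * L *+ 2 + 1) by rewrite divr_gt0.
have [i [/= [ci cl] cx]] := filter_ex (filterI (filterI Uc (Dl l _ e2)) (lP _ dl)).
rewrite subr0 in cl; have cD := (xP i).2 ci.
have lip := @smooth_lipschitz R d (partials s (D i)) l (x i - l) L (smooth_partials s (Ds i))
  (fun k y => sbound_plain (k :: s) y w1 (DC i)).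
rewrite [l + _]addrC subrK in lip.
have n0 : 0 <= `|x i - l| by exact: normr_ge0.
have {}lip : cabs (partials s (D i) (x i) - partials s (D i) l) <= eta / 2.
  apply: le_trans lip _; move: cx; rewrite ltr_pdivlMr// => cx; apply: le_trans (ltW cx).
  have -> : `|x i - l| * (d%:R * L *+ 2 + 1) = (d%:R * L * `|x i - l|) *+ 2 + `|x i - l|.
    by rewrite !mulr2n; ring.
  by rewrite lerDl.
have := cabsD (partials s (D i) (x i) - partials s (D i) l) (partials s (D i) l).
by rewrite subrK; lra.
Qed.

(* for long s or large x the bound comes from h' < h alone; on the remaining finitely
   many s and bounded x, pointwise limits are uniform *)
Lemma sbound_climit h h' (c Ha : R) (D : I -> Rd -> R[i]^o) C (e : R) :
  1 <= c -> (forall t, 0 <= t -> expR (assoc_fun A t) ^+ 2 <= c * expR (assoc_fun A (Ha * t))) ->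
  3 * h'%:num <= h%:num -> Ha * h'%:num <= h%:num -> 0 < e ->
  (forall i, smooth (D i)) -> (forall i, sbound M h (weightS A h) (D i) C) ->
  (forall s x, climit U (fun i => partials s (D i) x) 0) ->
  U [set i | sbound M h' (weightS A h') (D i) e].
Proof.
move=> c1 TT h3 hH e0 Ds DC Dl; have M0 := wseq_gt0 M.
have [i0 _] := filter_ex (@filterT _ U _).
have C_ge0 := sbound_ge0 (DC i0).
have c0 : 0 < c := lt_le_trans ltr01 c1.
have h0 : 0 < h%:num by []. have h'0 : 0 < h'%:num by [].
pose T (x : Rd) := expR (assoc_fun A (h'%:num * enorm x)).
have T1 x : 1 <= T x by exact: assoc_ge1.
have wE x : (weightS A h' x)%:num = T x by rewrite /weightS /= enormZ ger0_norm.
have cC : 0 < c * C + 1 by rewrite ltr_wpDl// mulr_ge0// ltW.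
(* Two gains from shrinking h: 3 h' <= h gives 3^-|s|, and Ha h' <= h gives a second factor e^{A(h'
   x)} by the doubling inequality. *)
have tail i s x : h'%:num ^+ size s * cabs (partials s (D i) x) * T x <=
    3^-1 ^+ size s * (c * C * M (size s)) / T x.
  have T0 : 0 < T x by exact: expR_gt0.
  rewrite ler_pdivlMr// -[leLHS]mulrA -(expr2 (T x)).
  have h1 : T x ^+ 2 <= c * (weightS A h x)%:num.
    apply: le_trans (TT _ _) _; first by rewrite mulr_ge0// ?enorm_ge0// ltW.
    apply: ler_wpM2l; first exact: ltW.
    change (expR (assoc_fun A (Ha * (h'%:num * enorm x))) <= expR (assoc_fun A (enorm (h%:num *: x)))).
    apply: assoc_exp_le; rewrite enormZ (ger0_norm (ltW h0)) mulrA.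
    by apply: ler_wpM2r hH; exact: enorm_ge0.
  have h2 : h'%:num ^+ size s <= 3^-1 ^+ size s * h%:num ^+ size s.
    rewrite -exprMn; have h31 : h'%:num <= 3^-1 * h%:num by lra.
    by apply: lerXn2r h31; rewrite nnegrE// mulr_ge0// ltW.
  have h3' := DC i s x.
  apply: le_trans (_ : (3^-1 ^+ size s * h%:num ^+ size s) * cabs (partials s (D i) x) *
     (c * (weightS A h x)%:num) <= _).
    by apply: ler_prod3; rewrite ?exprn_ge0 ?cabs_ge0 ?(ltW h'0) ?expR_ge0.
  have -> : 3^-1 ^+ size s * h%:num ^+ size s * cabs (partials s (D i) x) *
      (c * (weightS A h x)%:num) =
    3^-1 ^+ size s * (c * (h%:num ^+ size s * cabs (partials s (D i) x) * (weightS A h x)%:num)).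
    by move: (weightS A h x)%:num => w; ring.
  by rewrite ler_wpM2l ?exprn_ge0// -[leRHS]mulrA ler_wpM2l ?(ltW c0).
have [S0 S0P] := expr_small (divr_gt0 e0 cC).
(* From the term of index 1 in the supremum, e^{A(t)} >= t A_0 / A_1; so e^{A(h' x)} >= c C / e once
   |x| >= rho. *)
pose rho := (c * C / e) * (A 1%N / A 0%N) / h'%:num.
have far x : rho <= enorm x -> c * C <= e * T x.
  move=> rx; have A0 := wseq_gt0 A.
  have t0 : 0 <= h'%:num * enorm x by rewrite mulr_ge0 ?enorm_ge0// ltW.
  have := assoc_term A 1 t0; rewrite expr1 -/(T x) => h1.
  rewrite [leRHS]mulrC -ler_pdivrMr//; apply: le_trans h1.
  by move: rx; rewrite /rho ler_pdivrMr// [leRHS]mulrC => rx; rewrite -[leRHS]mulrA -[A 0%N / _]invf_div ler_pdivlMr ?divr_gt0.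
have e3 (s : seq 'I_d) : 0 < e * M (size s) / h'%:num ^+ size s / expR (assoc_fun A (h'%:num * rho)).
  by rewrite !divr_gt0 ?mulr_gt0 ?exprn_gt0 ?expR_gt0.
have unif (s : seq 'I_d) := climit_uniform (s := s) rho (e3 s) Ds DC (Dl s).
have small : U [set i | forall n : 'I_S0, forall s : n.-tuple 'I_d, forall x, `|x| <= rho ->
    cabs (partials s (D i) x) <= e * M (size s) / h'%:num ^+ size s / expR (assoc_fun A (h'%:num * rho))].
  by apply: filter_forall => n; apply: filter_forall => s; exact: unif.
apply: filterS small => i /= small s x; rewrite wE.
have [S0s|sS0] := leqP S0 (size s).
  apply: le_trans (tail i s x) _; rewrite ler_pdivrMr ?expR_gt0//.
  apply: le_trans (_ : e * M (size s) <= _); last first.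
    by apply: ler_peMr (T1 x); rewrite mulr_ge0// ltW.
  rewrite mulrA ler_wpM2r ?(ltW (M0 _))//.
  have sS : 3^-1 ^+ size s <= e / (c * C + 1).
    apply: le_trans (ltW S0P); apply: ler_wiXn2l => //; lra.
  have cC0 : 0 <= c * C by rewrite mulr_ge0// ltW.
  apply: le_trans (ler_wpM2r cC0 sS) _.
  by rewrite mulrAC ler_pdivrMr// ler_wpM2l ?(ltW e0)// lerDl.
have [xr|rx] := leP rho (enorm x).
  apply: le_trans (tail i s x) _; rewrite ler_pdivrMr ?expR_gt0//.
  rewrite mulrA -[leRHS]mulrA [M _ * _]mulrC [leRHS]mulrA; apply: ler_wpM2r; first exact: ltW.
  apply: le_trans (far x xr); apply: ler_piMl; first by rewrite mulr_ge0// ltW.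
  by rewrite exprn_ile1//; lra.
have h1 := small (Ordinal sS0) (in_tuple s) x (le_trans (norm_le_enorm x) (ltW rx)).
have h2 : T x <= expR (assoc_fun A (h'%:num * rho)).
  by apply: assoc_exp_le; rewrite ler_wpM2l// ltW.
move: h1; rewrite /= ler_pdivlMr ?expR_gt0// ler_pdivlMr ?exprn_gt0// => h1.
apply: le_trans _ h1; rewrite -mulrA mulrC; apply: ler_wpM2r; first by rewrite exprn_ge0// ltW.
by apply: ler_wpM2l h2; exact: cabs_ge0.
Qed.

End Compactness.

Section EquicontinuousPoints.
Variables (R : realType) (d : nat) (M A : weight_sequence R).
Local Notation Rd := 'rV[R]_d.
Local Notation point := (R * (seq 'I_d * Rd))%type.
Implicit Types (h : {posnum R}) (f : Rd -> R[i]^o).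

(** The norm of step h is the supremum over p of [pt_weight h p] times the modulus of the derivative
    at p. Thus t times the evaluation at p lies in C times the polar of the unit ball as soon as t
    <= C * pt_weight h p. *)
Definition pt_weight h (p : seq 'I_d * Rd) : R :=
  h%:num ^+ size p.1 * (weightS A h p.2)%:num / M (size p.1).

Definition pt_eval (p : point) f : R := p.1 * cabs (partials p.2.1 f p.2.2).

Lemma weightS_gt0 h (x : Rd) : 0 < (weightS A h x)%:num.
Proof. exact: expR_gt0. Qed.

Lemma pt_weight_gt0 h p : 0 < pt_weight h p.
Proof.
by rewrite /pt_weight divr_gt0 ?wseq_gt0// mulr_gt0 ?exprn_gt0//; exact: weightS_gt0.
Qed.

Lemma sbound_pt h f C : sbound M h (weightS A h) f C <->
  forall p, pt_weight h p * cabs (partials p.1 f p.2) <= C.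
Proof.
have E p : pt_weight h p * cabs (partials p.1 f p.2) <= C <->
    h%:num ^+ size p.1 * cabs (partials p.1 f p.2) * (weightS A h p.2)%:num <= C * M (size p.1).
  rewrite /pt_weight mulrAC ler_pdivrMr ?wseq_gt0//.
  by rewrite [X in _ <-> X <= _]mulrAC.
split=> [fC p|fC s x]; first exact/E/fC.
exact: (E (s, x)).1 (fC (s, x)).
Qed.

Lemma pt_weight_le h h' p : h%:num <= h'%:num -> pt_weight h p <= pt_weight h' p.
Proof.
move=> hh; have h0 : 0 <= h%:num by [].
have hs : h%:num ^+ size p.1 <= h'%:num ^+ size p.1 by apply: lerXn2r hh; rewrite nnegrE.
have w := weightS_le A p.2 hh; have w0 := ltW (weightS_gt0 h p.2).
have Mi : 0 <= (M (size p.1))^-1 by rewrite invr_ge0 ltW// wseq_gt0.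
by apply: ler_wpM2r Mi _ _ _; apply: ler_pM w => //; exact: exprn_ge0.
Qed.

(* (t, (s, x)) encodes the functional f |-> t * partials s f x; equi L says that the
   functionals in L are equicontinuous on every step of sspace *)
Definition equi (L : set point) := (forall p, L p -> 0 <= p.1) /\
  forall h, exists2 C : R, 0 <= C & forall p, L p -> p.1 <= C * pt_weight h p.2.

Lemma equi_eval L h : equi L -> exists2 C : R, 0 <= C & forall p f K, L p ->
  sbound M h (weightS A h) f K -> pt_eval p f <= C * K.
Proof.
move=> [L0 /(_ h)[C C0 CP]]; exists C => // p f K Lp /sbound_pt fK.
apply: le_trans (ler_wpM2r (cabs_ge0 _) (CP p Lp)) _.
by rewrite -mulrA ler_wpM2l.
Qed.

(** As hn tends to 0, for given h all but finitely many of the sets are bounded with the constant r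
    in step h; the remaining sets are finite and admit some constant. *)
Lemma equi_sequence (L : nat -> seq point) (hn : nat -> {posnum R}) (r : R) : 0 <= r ->
  (forall h : {posnum R}, exists n0, forall n, (n0 <= n)%N -> (hn n)%:num <= h%:num) ->
  (forall n p, p \in L n -> 0 <= p.1 <= r * pt_weight (hn n) p.2) ->
  equi [set p | exists n, p \in L n].
Proof.
move=> r0 hn0 Lr; split=> [p [n /Lr/andP[]]//|h].
have [n0 n0P] := hn0 h.
have fin (s : seq point) : exists2 C : R, 0 <= C & forall p, p \in s -> p.1 <= C * pt_weight h p.2.
  elim: s => [|p s [C C0 CP]]; first by exists 0 => // p; rewrite in_nil.
  have w0 := pt_weight_gt0 h p.2.
  exists (C + `|p.1| / pt_weight h p.2); first by rewrite addr_ge0// divr_ge0// ltW.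
  move=> p'; rewrite in_cons mulrDl => /orP[/eqP->|ps].
    rewrite divfK ?gt_eqF//; apply: le_trans (ler_norm _) _.
    by rewrite lerDr mulr_ge0// ltW.
  apply: le_trans (CP _ ps) _; rewrite lerDl.
  exact: mulr_ge0 (divr_ge0 (normr_ge0 _) (ltW w0)) (ltW (pt_weight_gt0 _ _)).
have [C C0 CP] : exists2 C : R, 0 <= C & forall n p, (n < n0)%N -> p \in L n -> p.1 <= C * pt_weight h p.2.
  have [C C0 CP] := fin (flatten [seq L n | n <- iota 0 n0]).
  exists C => // n p nn0 pL; apply: CP; apply/flattenP; exists (L n) => //.
  by apply: map_f; rewrite mem_iota.
exists (C + r); first exact: addr_ge0.
move=> p [n pL]; have w0 := ltW (pt_weight_gt0 h p.2); rewrite mulrDl.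
have [n0n|nn0] := leqP n0 n.
  have /andP[_ h1] := Lr n p pL; apply: le_trans h1 _.
  apply: ler_wpDl; first exact: mulr_ge0.
  exact: ler_wpM2l r0 _ _ (pt_weight_le p.2 (n0P n n0n)).
by apply: le_trans (CP n p nn0 pL) _; rewrite lerDl mulr_ge0.
Qed.

Lemma sspace_step (phi : sspace d M A) h K : sbound M h (weightS A h) (subsp_val phi) K ->
  exists f : bspace M h (weightS A h), phi = s_incl f.
Proof.
move=> phiK; have ph : bset M h (weightS A h) (subsp_val phi).
  by apply/bset_sbound; split; [exact: (sspace_sbound phi).1|exists K].
by exists (@mksub _ _ (bsub M h (weightS A h)) _ ph); apply: val_inj.
Qed.

Lemma equi_seminorm L : equi L -> exists q : sspace d M A -> R,
  [/\ seminorm q, continuous q & forall p phi, L p -> pt_eval p (subsp_val phi) <= q phi].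
Proof.
move=> Leq; have L0 := Leq.1.
pose e (p : point) (phi : sspace d M A) := pt_eval p (subsp_val phi).
have es p : L p -> @seminorm R (sspace d M A) (e p).
  move=> Lp; have p0 := L0 p Lp.
  have sm (phi : sspace d M A) := (sspace_sbound phi).1.
  split=> [f g|a f]; rewrite /e /pt_eval.
    have -> : partials p.2.1 (subsp_val (f + g)) p.2.2 =
        partials p.2.1 (subsp_val f) p.2.2 + partials p.2.1 (subsp_val g) p.2.2.
      by have := partialsD p.2.1 (sm f) (sm g) => /(congr1 (fun F => F p.2.2)).
    by rewrite -mulrDr; apply: ler_wpM2l => //; exact: cabsD.
  have -> : partials p.2.1 (subsp_val (a *: f)) p.2.2 = a * partials p.2.1 (subsp_val f) p.2.2.
    by have := partialsZ a p.2.1 (sm f) => /(congr1 (fun F => F p.2.2)).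
  by rewrite cabsM mulrCA.
have ub (phi : sspace d M A) : has_ubound [set e p phi | p in L].
  have [_ [h [K phiK]]] := sspace_sbound phi; have [C C0 CP] := equi_eval h Leq.
  by exists (C * K) => _ [p Lp <-]; exact: CP.
have qs := seminorm_sup es ub.
exists (fun phi => sup [set e p phi | p in L]); split=> //.
  apply: (sspace_seminorm_continuous qs) => h; have [C C0 CP] := equi_eval h Leq.
  exists C => f K fK; apply: sup_image_le; first by rewrite mulr_ge0// (sbound_ge0 fK).
  by move=> p Lp; exact: CP.
by move=> p phi Lp; apply: ub_le_sup; [exact: ub|exists p].
Qed.

Lemma null_posnum (rho : R) : 0 < rho <= 3^-1 -> exists hn : nat -> {posnum R},
  (forall n, (hn n)%:num = rho ^+ n) /\
  forall h : {posnum R}, exists n0, forall n, (n0 <= n)%N -> (hn n)%:num <= h%:num.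
Proof.
move=> /andP[r0 r3]; exists (fun n => PosNum (exprn_gt0 n r0)); split=> // h.
have h0 : 0 < h%:num by [].
have [n0 n0P] := expr_small h0.
exists n0 => n nn0 /=; apply: le_trans (ltW n0P).
have r1 : rho <= 1 by lra.
apply: le_trans (_ : rho ^+ n0 <= _).
  by apply: ler_wiXn2l r1 _ _ nn0; exact: ltW.
by apply: lerXn2r r3; rewrite nnegrE// ltW.
Qed.

(** In contrast to O_C, bounded sets of S are bounded in a step. Otherwise points violating the
    bound (n + 1)^2 in step [hn n], divided by n + 1, form an equicontinuous set whose supremum is a
    continuous seminorm unbounded on B. *)
Lemma bounded_sspace (B : set (sspace d M A)) : tvs_bounded B ->
  exists h K, forall phi, B phi -> sbound M h (weightS A h) (subsp_val phi) K.
Proof.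
move=> Bb; apply: contrapT => unb.
have [|hn [_ null]] := @null_posnum 3^-1; first by rewrite invr_gt0 ltr0n lexx.
have /choice[p pP] : forall n : nat, exists p : seq 'I_d * Rd, exists2 phi, B phi &
    n.+1%:R ^+ 2 < pt_weight (hn n) p * cabs (partials p.1 (subsp_val phi) p.2).
  move=> n; apply: contrapT => nex; apply: unb; exists (hn n), (n.+1%:R ^+ 2) => phi Bphi.
  apply/sbound_pt => p; rewrite leNgt; apply/negP => lt; apply: nex.
  by exists p, phi.
pose L n : seq point := [:: (pt_weight (hn n) (p n) / n.+1%:R, p n)].
have Leq : equi [set p | exists n, p \in L n].
  apply: (equi_sequence ler01 null) => n q.
  rewrite inE => /eqP -> /=; have w := ltW (pt_weight_gt0 (hn n) (p n)).
  by rewrite divr_ge0//= mul1r ler_pdivrMr// ler_peMr// ler1n.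
have [q [qs qc qP]] := equi_seminorm Leq.
have [C CP] := tvs_bounded_seminorm qs qc Bb.
have [phi Bphi lt] := pP (Num.truncn `|C|).
have Cn : `|C| < (Num.truncn `|C|).+1%:R by rewrite truncnS_gt.
have Lp : [set p | exists n, p \in L n] (pt_weight (hn (Num.truncn `|C|)) (p (Num.truncn `|C|)) /
    (Num.truncn `|C|).+1%:R, p (Num.truncn `|C|)).
  by exists (Num.truncn `|C|); rewrite inE.
have qB : q phi <= C by apply: CP; exists phi.
have := le_trans (qP _ phi Lp) qB; rewrite /pt_eval /= mulrAC ler_pdivrMr//.
move=> h1; have := lt_le_trans lt h1; rewrite expr2 ltr_pM2r// => h2.
by have := lt_trans Cn h2; rewrite ltNge ler_norm.
Qed.

End EquicontinuousPoints.

(** Finite sets directed by inclusion: along U every point is eventually included. The points (s, x)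
    are not countable in general, so limits are taken along an ultrafilter instead of a sequence. *)
Lemma superset_ultrafilter (T : eqType) : exists U : set_system (seq T),
  UltraFilter U /\ forall p : T, U [set s : seq T | p \in s].
Proof.
pose B : set_system (seq T) := [set S : set (seq T) | exists s0 : seq T, forall s : seq T, {subset s0 <= s} -> S s].
have BF : ProperFilter B.
  split; first by move=> [s0 /(_ s0)]; apply.
  split.
  - by exists [::].
  - move=> S1 S2 [s1 h1] [s2 h2]; exists (s1 ++ s2) => s ss; split.
      by apply: h1 => x xs; apply: ss; rewrite mem_cat xs.
    by apply: h2 => x xs; apply: ss; rewrite mem_cat xs orbT.
  - by move=> S1 S2 S12 [s0 h]; exists s0 => s /h /S12.
have [U [UU BU]] := ultraFilterLemma BF; exists U; split=> // p.
by apply: BU; exists [:: p] => s /= sp; apply: sp; rewrite mem_head.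
Qed.

Section BanachDieudonne.
Variables (R : realType) (d : nat) (M A : weight_sequence R).
Local Notation Rd := 'rV[R]_d.
Local Notation index := (seq 'I_d * Rd)%type.
Local Notation point := (R * index)%type.
Implicit Types (h : {posnum R}) (phi : sspace d M A) (L : seq point).

Variables (c Ha : R).
Hypotheses (c1 : 1 <= c)
  (TT : forall t, 0 <= t -> expR (assoc_fun A t) ^+ 2 <= c * expR (assoc_fun A (Ha * t))).
Variable q : sspace d M A -> R.
Hypotheses (qs : seminorm q) (qc : continuous q).

Lemma seminorm_le_sbound h : exists2 C : R, 0 <= C & forall phi K,
  sbound M h (weightS A h) (subsp_val phi) K -> q phi <= C * K.
Proof.
have [C C0 CP] := sspace_seminorm_bound h qs qc; exists C => // phi K phiK.
have [f fE] := sspace_step phiK; rewrite fE; apply: CP.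
by move: phiK; rewrite fE.
Qed.

(** Within the ball of radius r of step h, the polar of L lies in the open unit ball of q. The
    strict inequality leaves room for the limit argument of [controls_step]. *)
Definition controls L h (r : R) := forall phi, sbound M h (weightS A h) (subsp_val phi) r ->
  (forall p, p \in L -> pt_eval p (subsp_val phi) <= 1) -> q phi < 1.

(** If all points were allowed in [s], the polar of these functionals would be the ball of radius r
    in step h. *)
Definition scaled_points h (r : R) (s : seq index) : seq point :=
  [seq (pt_weight M A h p / r, p) | p <- s].

(* if no finite set s works, an ultrafilter limit of counterexamples contradicts
   controls L h r *)
Lemma controls_step L h h1 h2 (r r1 : R) : 0 < r ->
  3 * h2%:num <= h1%:num -> Ha * h2%:num <= h1%:num ->
  controls L h r -> exists s, controls (L ++ scaled_points h r s) h1 r1.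
Proof.
move=> r0 h3 hH Lh; apply: contrapT => nex.
have /choice[phi phiP] : forall s : seq index, exists phi,
    [/\ sbound M h1 (weightS A h1) (subsp_val phi) r1,
      forall p, p \in L ++ scaled_points h r s -> pt_eval p (subsp_val phi) <= 1 & 1 <= q phi].
  move=> s; apply: contrapT => nphi; apply: nex; exists s => phi phi1 phi2.
  by rewrite ltNge; apply/negP => q1; apply: nphi; exists phi.
have [U [UU Up]] := superset_ultrafilter index.
have sm s : smooth (subsp_val (phi s)) := (sspace_sbound (phi s)).1.
have w1 (y : Rd) : 1 <= (weightS A h1 y)%:num by exact: assoc_ge1.
have b1 s : sbound M h1 (weightS A h1) (subsp_val (phi s)) r1 by have [] := phiP s.
have [g [gs gb gl]] := sbound_compact UU w1 sm b1.
have gS : sset M A g by exists h1; apply/bset_sbound; split=> //; exists r1.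
pose psi : sspace d M A := @mksub _ _ (ssub d M A) _ gS.
have eval_le (p : point) : 0 <= p.1 -> U [set s | pt_eval p (subsp_val (phi s)) <= 1] -> pt_eval p g <= 1.
  rewrite le_eqVlt => /predU1P[p0 _|p0 Us].
    by rewrite /pt_eval -p0 mul0r.
  rewrite /pt_eval mulrC -ler_pdivlMr//; apply: (climit_le UU (gl p.2.1 p.2.2)).
  by apply: filterS Us => s /=; rewrite /pt_eval mulrC -ler_pdivlMr.
(* Every point belongs to U-almost all finite sets s, so the limit satisfies the full bound r in
   step h, and the constraints of L pass to the limit; the hypothesis on L applies. *)
have q1 : q psi < 1.
  apply: Lh => [|p pL].
    apply/sbound_pt => p.
    have pw := pt_weight_gt0 M A h p.
    have := eval_le (pt_weight M A h p / r, p); rewrite /pt_eval /= => e.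
    rewrite -[leRHS]mul1r -ler_pdivrMr// mulrAC; apply: e.
      by rewrite divr_ge0// ltW.
    apply: filterS (Up p) => s /= ps; have [_ h4 _] := phiP s.
    apply: (h4 (pt_weight M A h p / r, p)); rewrite mem_cat; apply/orP; right.
    exact: (map_f (fun p => (pt_weight M A h p / r, p))).
  have [p0|p0] := leP 0 p.1.
    apply: eval_le => //; apply: filterE => s /=; have [_ h4 _] := phiP s.
    by apply: h4; rewrite mem_cat pL.
  apply: le_trans ler01; rewrite /pt_eval mulr_le0_ge0 ?cabs_ge0//; exact: ltW.
(* Convergence to psi takes place in the norm of the larger step h2. There q is at most C times the
   norm, so q(phi s - psi) < 1 - q psi for some s, against 1 <= q (phi s). *)
have [C C0 CP] := seminorm_le_sbound h2.
have C1 : 0 < C + 1 by rewrite ltr_wpDl.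
have e0 : 0 < (1 - q psi) / (C + 1) by rewrite divr_gt0// subr_gt0.
pose D s : Rd -> R[i]^o := subsp_val (phi s) - g.
have Ds s : smooth (D s) by apply: smoothB.
have Db s : sbound M h1 (weightS A h1) (D s) (r1 + r1).
  have := sbound_comb (-1) gs (sm s) gb (b1 s).
  by rewrite cabsN cabs1 mul1r scaleN1r addrC.
have Dl t x : climit U (fun s => partials t (D s) x) 0.
  have := climitB UU (gl t x) (climit_cst UU (partials t g x)); rewrite subrr.
  have -> // : (fun s => partials t (subsp_val (phi s)) x - partials t g x) =
    (fun s => partials t (D s) x).
  by apply/funext => s; rewrite /D partialsB.
have US := sbound_climit UU c1 TT h3 hH e0 Ds Db Dl.
have [s /= sD] := filter_ex US.
have [_ _ qs1] := phiP s.
have : q (phi s - psi) <= C * ((1 - q psi) / (C + 1)).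
  by apply: CP; rewrite subsp_val_sub.
have tri : q (phi s) <= q (phi s - psi) + q psi by have := qs.1 (phi s - psi) psi; rewrite subrK.
have : C * ((1 - q psi) / (C + 1)) < 1 - q psi.
  by rewrite mulrCA gtr_pMr ?subr_gt0// ltr_pdivrMr// mul1r ltrDl.
lra.
Qed.

(** The balls of radius r_n in step [hn n] have growing radii and shrinking h, so every phi of S
    lies in one of them. The finite set added at stage n is bounded by 1 / r_n in step [hn n], which
    keeps the union equicontinuous. *)
Lemma banach_dieudonne : exists L : set point, equi M A L /\
  forall phi, (forall p, L p -> pt_eval p (subsp_val phi) <= 1) -> q phi <= 1.
Proof.
(* The ratio of consecutive steps, small enough for both conditions of [controls_step]. *)
pose rho : R := (3 + `|Ha|)^-1.
have Ha0 : 0 < 3 + `|Ha| by rewrite ltr_wpDr.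
have rho0 : 0 < rho by rewrite invr_gt0.
have rho3 : 3 * rho <= 1 by rewrite /rho ler_pdivrMr// mul1r lerDl.
have rhoH : Ha * rho <= 1.
  by rewrite /rho ler_pdivrMr// mul1r (le_trans (ler_norm _))// lerDr.
clearbody rho; have [|hn [hnE null]] := @null_posnum R rho; first by rewrite rho0/=; lra.
have [C C0 CP] := seminorm_le_sbound (hn 0%N).
have C1 : 0 < C + 1 by rewrite ltr_wpDl.
(* r_0 C < 1 starts the induction with no points, r_n tends to infinity, and 1 / r_n <= C + 1 gives
   equicontinuity. *)
pose r n : R := n.+1%:R / (C + 1).
have r0 n : 0 < r n by rewrite divr_gt0.
have base : controls [::] (hn 0%N) (r 0%N).
  move=> phi phib _; apply: le_lt_trans (CP phi _ phib) _.
  by rewrite /r mulrA mulr1 ltr_pdivrMr// mul1r ltrDl.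
have /choice[F FP] : forall Ln : seq point * nat, exists s,
    controls Ln.1 (hn Ln.2) (r Ln.2) ->
    controls (Ln.1 ++ scaled_points (hn Ln.2) (r Ln.2) s) (hn Ln.2.+1) (r Ln.2.+1).
  (* The empty list only makes the choice total; [chosen] always satisfies the control condition. *)
  move=> [L n] /=; have [cL|ncL] := pselect (controls L (hn n) (r n)); last by exists [::].
  have hS k : (hn k.+1)%:num = rho * (hn k)%:num by rewrite !hnE exprS.
  have hp : 0 <= (hn n.+1)%:num by [].
  have [||s sP] := @controls_step L (hn n) (hn n.+1) (hn n.+2) (r n) (r n.+1) (r0 n) _ _ cL.
  - by rewrite hS mulrA ler_piMl.
  - by rewrite hS mulrA ler_piMl.
  by exists s.
pose chosen := fix K n : seq point := if n is k.+1 then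
  K k ++ scaled_points (hn k) (r k) (F (K k, k)) else [::].
have Kc n : controls (chosen n) (hn n) (r n).
  by elim: n => [|n ih] //=; exact: (FP (chosen n, n)).
pose Lam n := scaled_points (hn n) (r n) (F (chosen n, n)).
have KL n p : p \in chosen n -> exists k, p \in Lam k.
  by elim: n => [|n ih] //=; rewrite mem_cat => /orP[/ih//|pL]; exists n.
have rle n : (r n)^-1 <= C + 1.
  by rewrite /r invf_div ler_pdivrMr// ler_peMr ?(ltW C1)// ler1n.
exists [set p | exists n, p \in Lam n]; split.
  apply: (equi_sequence (ltW C1) null) => n p /mapP[i _ ->] /=.
  have w := ltW (pt_weight_gt0 M A (hn n) i).
  by rewrite divr_ge0 ?(ltW (r0 n))//= mulrC ler_wpM2r.
move=> phi phiL; have [_ [h [K phiK]]] := sspace_sbound phi.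
have [n0 n0P] := null h; pose n := maxn n0 (Num.truncn (`|K| * (C + 1))).
have hnh : (hn n)%:num <= h%:num by apply: n0P; rewrite leq_maxl.
apply: ltW; apply: (Kc n phi); last first.
  by move=> p /KL pL; exact: phiL.
apply: sbound_weightS_le hnh _; apply: sbound_le phiK.
apply: le_trans (ler_norm K) _; rewrite /r ler_pdivlMr//.
apply: le_trans (ltW (truncnS_gt _)) _.
by rewrite ler_nat ltnS leq_maxr.
Qed.

End BanachDieudonne.

(** * Continuity of the map from f to its convolution operator *)

Lemma scaled_weight_le (R : realType) (C k u v w e m : R) : 0 <= w -> w <= e -> 0 < e ->
  0 <= v -> u * v <= 1 -> 0 < m -> 0 <= C * k ->
  C * (u * w / m) * (k * v * m / e) <= C * k.
Proof.
move=> w0 we e0 v0 uv m0 Ck.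
have -> : C * (u * w / m) * (k * v * m / e) = C * k * (u * v * (w / e)).
  by field; rewrite !gt_eqF.
apply: ler_piMr => //; apply: le_trans (_ : w / e <= 1).
  by apply: ler_piMl => //; rewrite divr_ge0// ltW.
by rewrite ler_pdivrMr// mul1r.
Qed.

Section ConvolutionContinuity.
Variables (R : realType) (d : nat) (M A : weight_sequence R).
Local Notation Rd := 'rV[R]_d.
Variables (C0 : R) (H : {posnum R}).
Hypotheses (C01 : 1 <= C0).
Hypothesis M2 : forall p q, M (p + q)%N <= C0 * H%:num ^+ (p + q) * M p * M q.
Hypothesis A2 : cond_M2 A.
Local Notation shrink h := (h%:num / H%:num)%:pos.
Local Notation point := (R * (seq 'I_d * Rd))%type.

Lemma sboundZ (h : {posnum R}) w (f : Rd -> R[i]^o) (a : R[i]) C : smooth f ->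
  sbound M h w f C -> sbound M h w (a *: f) (cabs a * C).
Proof.
move=> fs fC s x; rewrite partialsZ//.
rewrite -[cabs ((a *: partials s f) x)]/(cabs (a * partials s f x)) cabsM mulrCA -!mulrA.
by rewrite ler_wpM2l ?cabs_ge0// mulrA; exact: fC.
Qed.

(** Evaluating f here gives t times the derivative along s of the convolution of f and phi at x,
    which is the functional encoded by [p] applied to the convolution. *)
Definition oc_point (p : point) (phi : sspace d M A) : ocspace d M A :=
  p.1%:C%C *: oc_transl M2 phi p.2.1 p.2.2.

(** The factors (H / h)^{|s|} M_s e^{-A(k x)} of [sbound_transl] are cancelled by t <= C * pt_weight
    r (s, x), for r at most h / H and k. Only k and r depend on N, the step h / H does not; hence
    the boundedness in a single step. *)
Lemma oc_point_sbound (L : set point) (h : {posnum R}) K N : equi M A L -> (1 <= N)%N -> exists C,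
  forall p phi, L p -> sbound M h (weightS A h) (subsp_val phi) K ->
    sbound M (shrink h) (weightO A N) (subsp_val (oc_point p phi)) C.
Proof.
move=> [L0 Leq] N1.
have Ni : 0 < N%:R^-1 :> R by rewrite invr_gt0 ltr0n.
have [k [kh kN]] : exists k : {posnum R}, 2 * k%:num <= h%:num /\ 2 * k%:num <= N%:R^-1.
  exists (Num.min h%:num (PosNum Ni)%:num / 2)%:pos => /=.
  by rewrite mulrC divfK ?pnatr_eq0// !ge_min !lexx orbT.
have k0 : 0 <= k%:num by [].
have [r [r1 r2]] : exists r : {posnum R}, r%:num <= (shrink h)%:num /\ r%:num <= k%:num.
  by exists (Num.min (shrink h)%:num k%:num)%:pos; rewrite /= !ge_min !lexx orbT.
have [C C_ge0 CP] := Leq r.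
exists (C * (K * C0)) => p phi Lp phiK.
have K0 := sbound_ge0 phiK; have p0 := L0 p Lp.
have fs := (sspace_sbound phi).1.
have sb := sbound_transl M2 p.2.1 p.2.2 fs N1 k0 kh kN phiK.
have ts : smooth (transl p.2.2 (partials p.2.1 (subsp_val phi))).
  by apply: smooth_transl; exact: smooth_partials.
have := sboundZ p.1%:C%C ts sb; rewrite cabsR (ger0_norm p0).
rewrite -[subsp_val (oc_point p phi)]/(p.1%:C%C *: transl p.2.2 (partials p.2.1 (subsp_val phi))).
apply: sbound_le; set x := p.2.2; set s := p.2.1.
have KC : 0 <= K * C0 by rewrite mulr_ge0// (le_trans ler01).
have CKC : 0 <= C * (K * C0) := mulr_ge0 C_ge0 KC.
have M0 := wseq_gt0 M (size s).
have e0 : 0 < expR (assoc_fun A (k%:num * enorm x)) by exact: expR_gt0.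
have w3 : (weightS A r x)%:num <= expR (assoc_fun A (k%:num * enorm x)).
  apply: le_trans (weightS_le A x r2) _.
  change (expR (assoc_fun A (enorm (k%:num *: x))) <= expR (assoc_fun A (k%:num * enorm x))).
  by rewrite enormZ ger0_norm.
have u0 : 0 <= (H%:num / h%:num) ^+ size s by rewrite exprn_ge0.
have uE : r%:num ^+ size s * (H%:num / h%:num) ^+ size s <= 1.
  rewrite -exprMn exprn_ile1 ?mulr_ge0//.
  apply: le_trans (_ : (shrink h)%:num * (H%:num / h%:num) <= _); first by rewrite ler_wpM2r.
  by rewrite /= mulrA divfK// divff.
have X0 : 0 <= K * C0 * (H%:num / h%:num) ^+ size s * M (size s) *
    expR (- assoc_fun A (k%:num * enorm x)).
  by rewrite mulr_ge0 ?expR_ge0// mulr_ge0 ?(ltW M0)// mulr_ge0.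
apply: le_trans (ler_wpM2r X0 (CP p Lp)) _.
rewrite /pt_weight expRN -/s -/x.
exact: scaled_weight_le (ltW (weightS_gt0 A r x)) w3 e0 u0 uE M0 CKC.
Qed.

Lemma oc_point_step_bounded (L : set point) (B : set (sspace d M A)) : equi M A L ->
  tvs_bounded B -> step_bounded [set psi | exists p phi, [/\ L p, B phi & psi = oc_point p phi]].
Proof.
move=> Leq Bb; have [h [K BK]] := bounded_sspace Bb.
have ope p phi : L p -> B phi -> eset M A (shrink h) (subsp_val (oc_point p phi)).
  move=> Lp Bphi; apply: eset_sbound; first exact: ocspace_smooth.
  by move=> N N1; have [C CP] := oc_point_sbound h K Leq N1; exists C; exact: CP (BK _ Bphi).
exists (shrink h), [set g | exists p phi, [/\ L p, B phi & e_incl g = oc_point p phi]]; split.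
  apply: espace_bounded => N N1; have [C CP] := oc_point_sbound h K Leq N1.
  exists C => g [p [phi [Lp Bphi gE]]].
  by have := CP p phi Lp (BK _ Bphi); rewrite -gE.
apply/seteqP; split=> [_ [p [phi [Lp Bphi ->]]]|_ [g [p [phi [Lp Bphi gE]]] <-]]; last first.
  by exists p, phi.
exists (@mksub _ _ (esub d M A (shrink h)) _ (ope p phi Lp Bphi)); last exact: val_inj.
by exists p, phi; split=> //; exact: val_inj.
Qed.

Lemma hom_sspace_comb (a : R[i]) (S T : Lb_sspace d M A) (phi : sspace d M A) :
  subsp_val (subsp_val (a *: S + T : hom (sspace d M A) (sspace d M A)) phi) =
  a *: subsp_val (subsp_val (S : hom (sspace d M A) (sspace d M A)) phi) +
  subsp_val (subsp_val (T : hom (sspace d M A) (sspace d M A)) phi).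
Proof.
have E := @hom_comb R (sspace d M A) (sspace d M A) a S T phi.
apply: (eq_trans (congr1 (fun z : sspace d M A => subsp_val z) E)).
exact: (@subsp_val_comb R ('rV[R]_d -> R[i]^o) (ssub d M A) a).
Qed.

Lemma convolution_comb (a : R[i]) (f g : oc_dual d M A) (phi : sspace d M A) :
  convolution (a *: f + g : hom _ _) phi = a *: convolution f phi + convolution g phi.
Proof.
by apply/funext => x; exact: (@hom_comb R (ocspace d M A) R[i]^o a f g).
Qed.

Lemma convolution_op_linear :
  linear (@convolution_op R d M A : oc_dual d M A -> Lb_sspace d M A).
Proof.
move=> a f g; apply: val_inj; apply/funext => phi; apply: val_inj.
have E f' := @convolution_opE R d M A C0 H M2 f' phi.
apply: (eq_trans (E (a *: f + g))).
apply: (eq_trans _ (esym (hom_sspace_comb a (convolution_op f) (convolution_op g) phi))).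
rewrite (E f) (E g).
exact: convolution_comb.
Qed.

Lemma pt_evalZ (p : point) (t : R) (f : Rd -> R[i]^o) : smooth f -> 0 <= t ->
  pt_eval p (t%:C%C *: f) = t * pt_eval p f.
Proof.
move=> fs t0; rewrite /pt_eval partialsZ//.
rewrite -[(_ *: partials _ _) _]/(t%:C%C * partials p.2.1 f p.2.2).
by rewrite cabsM cabsR (ger0_norm t0) mulrCA.
Qed.

Lemma seminorm_le_pt_eval (L : set point) (q : sspace d M A -> R) (g : sspace d M A) (r : R) :
  seminorm q ->
  (forall phi, (forall p, L p -> pt_eval p (subsp_val phi) <= 1) -> q phi <= 1) ->
  0 <= r -> (forall p, L p -> pt_eval p (subsp_val g) <= r) -> q g <= r.
Proof.
move=> qs Lq r0 Lr; have gs : smooth (subsp_val g) := (sspace_sbound g).1.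
(* Since [r] may be 0, g is divided by r + e with e > 0 arbitrary. *)
apply/ler_addgt0Pr => e e0; have re : 0 < r + e by rewrite ltr_wpDl.
have ti : 0 <= (r + e)^-1 by rewrite invr_ge0 ltW.
have : q ((r + e)^-1%:C%C *: g) <= 1.
  apply: Lq => p Lp; apply: le_trans (_ : (r + e)^-1 * pt_eval p (subsp_val g) <= _).
    by rewrite -(pt_evalZ p gs ti).
  by rewrite mulrC ler_pdivrMr// mul1r (le_trans (Lr p Lp))// lerDl ltW.
by rewrite (seminormZr _ qs ti) mulrC ler_pdivrMr// mul1r.
Qed.

Lemma convolution_op_bound (c Ha : R) (B : set (sspace d M A)) (q : sspace d M A -> R) :
  1 <= c -> (forall t, 0 <= t -> expR (assoc_fun A t) ^+ 2 <= c * expR (assoc_fun A (Ha * t))) ->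
  tvs_bounded B -> seminorm q -> continuous q -> exists2 B', step_bounded B' &
  forall f phi, B phi -> q (subsp_val (convolution_op f : hom (sspace d M A) (sspace d M A)) phi) <=
    sup [set cabs (subsp_val f psi) | psi in B'].
Proof.
move=> c1 TT Bb qs qc; have [L [Leq Lq]] := banach_dieudonne c1 TT qs qc.
set B' := [set psi | exists p phi, [/\ L p, B phi & psi = oc_point p phi]].
have B'b : step_bounded B' by exact: oc_point_step_bounded.
exists B' => // f phi Bphi; set r := sup _.
have [fl fc] := subspW f.
have fB : has_ubound [set cabs (subsp_val f psi) | psi in B'].
  apply: (@tvs_bounded_seminorm R (ocspace d M A) _ (fun psi => cabs (subsp_val f psi))).
  - exact: (seminorm_linear fl (@cabs_seminorm R)).
  - exact/functional_continuousP.
  - exact: step_bounded_bounded.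
have Lr p : L p -> pt_eval p (convolution f phi) <= r.
  move=> Lp; rewrite /pt_eval (partials_convolution M2).
  apply: ub_le_sup => //; exists (oc_point p phi); first by exists p, phi.
  by rewrite /oc_point linear_scale// cabsM cabsR (ger0_norm (Leq.1 p Lp)).
have r0 : 0 <= r.
  rewrite /r; have [->|/set0P[psi Bpsi]] := eqVneq B' set0; first by rewrite image_set0 sup0.
  by apply: le_trans (ub_le_sup fB (ex_intro2 _ _ psi Bpsi erefl)); exact: cabs_ge0.
apply: (seminorm_le_pt_eval qs Lq r0) => p Lp.
by rewrite (convolution_opE M2); exact: Lr.
Qed.

Lemma convolution_op_continuous :
  continuous (@convolution_op R d M A : oc_dual d M A -> Lb_sspace d M A).
Proof.
have [c [Ha [c1 _ TT]]] := assoc_double A2.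
apply: lcs_continuous; first exact: convolution_op_linear.
move=> q' Q'; have [B [q [Bb qs qc q'E]]] := Q'.
have [B' B'b B'P] := convolution_op_bound c1 TT Bb qs qc.
pose p (f : hom (ocspace d M A) R[i]^o) := sup [set cabs (subsp_val f psi) | psi in B'].
have pQ : seminorms (@uniform_family R (ocspace d M A) R[i]^o _ (@step_bounded_bounded R d M A)) p.
  exists B', (fun z => cabs z); split=> //; [exact: cabs_seminorm|exact: cabs_continuous].
have ps := seminormsP pQ.
apply: (@seminorm_continuous_le R (oc_dual d M A) p _ 1 ps).
- exact: (seminorm_comp convolution_op_linear (seminormsP Q')).
- exact: (lcs_seminorm_continuous pQ).
- move=> f; rewrite mul1r q'E; apply: sup_image_le; first exact: seminorm_ge0 ps.
  by move=> phi Bphi; exact: B'P.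
Qed.

End ConvolutionContinuity.

(** * Comparison of the topologies *)

Lemma lcs_open_sub (R : realType) (V : lmodType R[i]) (Q1 Q2 : seminorm_family V) (U : set V) :
  seminorms Q1 `<=` seminorms Q2 -> open (U : set (lcs Q1)) -> open (U : set (lcs Q2)).
Proof.
move=> Q12; rewrite !openE => Uo x Ux; have [s [e [sQ e0 sU]]] := Uo x Ux.
by exists s, e; split=> // q /sQ /Q12.
Qed.

Section StrongDual.
Variables (R : realType) (d : nat) (M A : weight_sequence R).

Lemma open_oc_strong (U : set (hom (ocspace d M A) R[i]^o)) :
  open (U : set (oc_dual d M A)) -> open (U : set (oc_strong_dual d M A)).
Proof.
apply: lcs_open_sub => _ [B [q [Bs qs qc ->]]].
by exists B, q; split=> //; exact: step_bounded_bounded.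
Qed.

Lemma strong_open_polar (B : set (ocspace d M A)) :
  (forall q : ocspace d M A -> R, seminorm q -> continuous q -> exists C, forall f, B f -> q f <= C) ->
  exists U : set (oc_strong_dual d M A), [/\ open U, U 0 & U `<=` polar B].
Proof.
move=> Bb.
have Bt : @tvs_bounded R (ocspace d M A) B.
  apply: lcs_bounded => q [qs qc]; apply: (Bb q qs).
  by apply: lcs_seminorm_continuous; split.
pose p (f : hom (ocspace d M A) R[i]^o) := sup [set cabs (subsp_val f psi) | psi in B].
have pQ : seminorms (@uniform_family R (ocspace d M A) R[i]^o _ (@subset_refl _ (@tvs_bounded R (ocspace d M A)))) p.
  exists B, (fun z => cabs z); split=> //; [exact: cabs_seminorm|exact: cabs_continuous].
have ps := seminormsP pQ.
have pc := lcs_seminorm_continuous pQ.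
exists (p @^-1` [set t | t < 1]); split.
- by move/continuousP : pc; apply; exact: open_lt.
- by rewrite /preimage /= seminorm0.
move=> f pf psi Bpsi; apply: le_trans (ltW pf); apply: ub_le_sup; last by exists psi.
have [fl fc] := subspW f.
apply: (@tvs_bounded_seminorm R (ocspace d M A) _ (fun psi => cabs (subsp_val f psi))) Bt.
  exact: (seminorm_linear fl (@cabs_seminorm R)).
exact/functional_continuousP.
Qed.

Lemma initial_convolution_open (U : set (hom (ocspace d M A) R[i]^o)) : cond_M2 M -> cond_M2 A ->
  open (U : set (initial_topology (@convolution_op R d M A))) -> open (U : set (oc_dual d M A)).
Proof.
move=> [C0 [H [C01 H1 M2]]] A2 [V Vo <-].
have H0 : 0 < H by exact: lt_le_trans ltr01 H1.
have := @convolution_op_continuous R d M A C0 (PosNum H0) C01 M2 A2.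
by move/continuousP; exact.
Qed.

End StrongDual.

Theorem corollary4p31 (R : realType) (d : nat) (M A : weight_sequence R)
    (d_gt0 : (0 < d)%N)
    (M_M1 : cond_M1 M) (M_M2 : cond_M2 M) (M_M3 : cond_M3 M)
    (A_M1 : cond_M1 A) (A_M2 : cond_M2 A) :
  ~ ultrabornological (oc_dual d M A) /\
  strictly_finer (@open (oc_strong_dual d M A))
                 (@open (initial_topology (@convolution_op R d M A))).
Proof.
have [B [Bb Birr]] := irregular_set (Ordinal d_gt0) M_M1 M_M2 M_M3 A_M1 A_M2.
have B0 := polar_not_nbhs Birr; split.
  move=> /(_ (polar B) (@polar_absolutely_convex R d M A B)) Bn; apply: B0; apply: Bn => D.
  exact: polar_absorbs_banach_disk.
split=> [U /(initial_convolution_open M_M2 A_M2)|sub]; first exact: open_oc_strong.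
(* If every strongly open set were open for the initial topology, U would be open in the dual as
   well, and the polar of B would be a neighbourhood of 0 there. *)
have [U [Uo U0 UB]] := strong_open_polar Bb.
have := initial_convolution_open M_M2 A_M2 (sub U Uo).
rewrite openE => /(_ _ U0); rewrite /interior => Un.
by apply: B0; apply: filterS UB Un.
Qed.
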